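(* Let $\Gamma_0\subset\mathbb{C}$ be a lattice and let $\Gamma_0\supset\Gamma_1\supset\Gamma_2\supset\dots$ be a sequence of subgroups such that for each $i\ge1$ the group $\Gamma_i$ has index $2$ in $\Gamma_{i-1}$ and is optimal in $\Gamma_{i-1}$. For each $n=0,1,2,\dots$ let the triple $(e_1^{(n)},e_2^{(n)},e_3^{(n)})$ consist of the distinct roots of $4x^3-g_2(\Gamma_n)x-g_3(\Gamma_n)$, numbered so that $e_1^{(n)}=\wp(\omega_n/2;\Gamma_n)$, where $\omega_n\in\Gamma_{n+1}\setminus2\Gamma_n$. Then the sequences $\{g_2(\Gamma_n)\}_{n\in\mathbb{N}}$ and $\{g_3(\Gamma_n)\}_{n\in\mathbb{N}}$ converge quadratically fast.
   Context: A lattice is a discrete additive subgroup of $\mathbb{C}$ of rank $2$. For a discrete subgroup $\Gamma\subset\mathbb{C}$, $\wp(z;\Gamma)=\frac1{z^2}+\sum_{u\in\Gamma\setminus\{0\}}\left(\frac1{(z-u)^2}-\frac1{u^2}\right)$, $g_2(\Gamma)=\sum_{u\in\Gamma\setminus\{0\}}60u^{-4}$, $g_3(\Gamma)=\sum_{u\in\Gamma\setminus\{0\}}140u^{-6}$, and $\Delta(\Gamma)=g_2(\Gamma)^3-27g_3(\Gamma)^2$. A subgroup $\Gamma'$ of index $2$ in a lattice $\Gamma$ (such a subgroup is again a lattice) is called optimal if $|\Delta(\Gamma')|\le|\Delta(G)|$ for all subgroups $G\subset\Gamma$ of index $2$. A sequence $\{a_n\in\mathbb{C}\}_{n\in\mathbb{N}}$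 converges quadratically fast if it converges to some $a\in\mathbb{C}$ and there exist $C,q>0$ such that $|a_n-a|\le C\exp(-q2^n)$ for all $n\in\mathbb{N}$. *)

(* Defs.v *)
From HB Require Import structures.
From mathcomp Require Import all_boot all_order all_algebra.
From mathcomp Require Import complex.
From mathcomp Require Import all_classical all_reals all_analysis.
From mathcomp Require summability.

Set Implicit Arguments.
Unset Strict Implicit.
Unset Printing Implicit Defensive.
Import Order.TTheory GRing.Theory Num.Theory.
Import numFieldNormedType.Exports.
Local Open Scope classical_set_scope.
Local Open Scope card_scope.
Local Open Scope ring_scope.
Local Open Scope complex_scope.

(* The library gives every abstract numFieldType the topology of its norm, but
   not the concrete type R[i]; this copies that structure to R[i]. *)
HB.instance Definition _ (R : realType) :=
  NormedModule.copy R[i] R[i]^o.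

Section Subgroups.
Variable R : realType.
Implicit Types (G H : set R[i]) (n : nat).

Definition subgroup G :=
  G 0 /\ (forall x y, G x -> G y -> G (x - y)).

Definition discrete_subgroup G := subgroup G /\ G `<=` isolated G.

Definition Z_independent n (v : 'I_n -> R[i]) :=
  forall c : 'I_n -> int, \sum_(i < n) v i *~ c i = 0 -> forall i, c i = 0.

(* The rank of an abelian group: the maximal size of a Z-independent family. *)
Definition has_rank G n :=
  (exists v : 'I_n -> R[i], (forall i, G (v i)) /\ Z_independent v) /\
  (forall v : 'I_n.+1 -> R[i], (forall i, G (v i)) -> ~ Z_independent v).

Definition lattice G := discrete_subgroup G /\ has_rank G 2.

Definition cosets H G : set (set R[i]) :=
  [set [set x + y | y in H] | x in G].

Definition subgroup_of_index n H G :=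
  [/\ subgroup H, H `<=` G & cosets H G #= `I_n].

End Subgroups.

Section Weierstrass.
Variable R : realType.
Implicit Types (G H : set R[i]) (z : R[i]).

(* Unordered sum over G \ {0}: the limit of the sums over finite subsets. *)
Definition sum_nonzero G (f : R[i] -> R[i]) : R[i] :=
  summability.sum (patch (fun=> 0) (G `\ 0) f).

Definition wp z G : R[i] :=
  z ^- 2 + sum_nonzero G (fun u => (z - u) ^- 2 - u ^- 2).

Definition g2 G : R[i] := sum_nonzero G (fun u => 60 * u ^- 4).

Definition g3 G : R[i] := sum_nonzero G (fun u => 140 * u ^- 6).

Definition Delta G : R[i] := g2 G ^+ 3 - 27 * g3 G ^+ 2.

Definition weierstrass_poly G : {poly R[i]} :=
  4 *: 'X^3 - g2 G *: 'X - (g3 G)%:P.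

Definition optimal H G :=
  subgroup_of_index 2 H G /\
  forall H', subgroup_of_index 2 H' G -> `|Delta H| <= `|Delta H'|.

End Weierstrass.

(* The norm of R[i] takes its values in R[i], hence the cast %:C of the bound. *)
Definition converges_quadratically_fast (R : realType) (a : nat -> R[i]) :=
  exists l : R[i], a n @[n --> \oo] --> l /\
    exists C q : R, [/\ 0 < C, 0 < q &
      forall n, `|a n - l| <= (C * expR (- q * 2 ^+ n))%:C].

(* Main.v *)
Require Import Defs.
From mathcomp Require Import all_boot all_order all_algebra.
From mathcomp Require Import complex finmap.
From mathcomp Require Import all_classical all_reals all_analysis.
From mathcomp Require Import ring lra zify.
From mathcomp Require summability.

(** Let [e] be the value of [wp] at the half period [omega / 2] of [Gamma n], and
    let [c] be the difference of the two other roots of the cubic. Half of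
    [Gamma n.+1] is the union of [Gamma n] and of its translate by [omega / 2].
    Hence the sums of inverse fourth and sixth powers over [Gamma n.+1] are those
    over [Gamma n] plus sums over a translate, and the latter are Taylor
    coefficients of [wp] at the half period. The differential equation of [wp]
    turns them into polynomials in [e] ([index2_invariants]): the new invariants
    are [(15 * e ^+ 2 - g2) / 4] and [(7 * e ^+ 3 + g3) / 8].

    It follows that the discriminant of the sublattice attached to a root is, up
    to the factor 16, the fourth power of the difference of the two other roots
    times its differences to them ([Delta_index2]). All three half periods give
    roots, and different ones ([half_period_roots]). Optimality therefore says
    that [c] is the smallest of the three root differences ([lattice_step]).

    The rest is the convergence of the arithmetic-geometric mean with the right
    choice of square roots. The number [- e / 2] is a root of the next cubic, and two
    successive optimality conditions exclude that it is the distinguished root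
    [e'] of that cubic. Then [e' - e] is [c'] or [- c'], and
    [16 * cabs c' * cabs e' <= cabs c ^+ 2] ([iteration_step]). So [e] converges
    to a nonzero limit, [c] tends to zero quadratically fast, and so do the
    differences between the invariants [3 * e ^+ 2 + c ^+ 2] and
    [e ^+ 3 - e * c ^+ 2] and their limits.

    The two differential equations come from Liouville's theorem
    ([elliptic_eq0]), applied to combinations of [wp] and its derivatives whose
    Laurent expansions at the origin cancel. Liouville's theorem rests on a maximum
    principle proved by averaging over four points, which uses second-order Taylor
    expansions only ([square_principle]). *)

Set Implicit Arguments.
Unset Strict Implicit.
Unset Printing Implicit Defensive.
Import Order.TTheory GRing.Theory Num.Theory.
Import numFieldNormedType.Exports.
Local Open Scope classical_set_scope.
Local Open Scope ring_scope.
Local Open Scope complex_scope.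

(** * Real-valued modulus of complex numbers *)

Section Modulus.
Variable R : realType.
Implicit Types x y z : R[i].

Definition cabs z : R := Normc.normc z.

Lemma normE z : `|z| = (cabs z)%:C.
Proof. by rewrite normc_def; case: z. Qed.

Lemma cabs_ge0 z : 0 <= cabs z.
Proof. by case: z => a b; rewrite /cabs /= sqrtr_ge0. Qed.

Lemma cabs0 : cabs 0 = 0. Proof. exact: Normc.normc0. Qed.
Lemma cabs1 : cabs 1 = 1. Proof. exact: Normc.normc1. Qed.

Lemma cabs_eq0 z : (cabs z == 0) = (z == 0).
Proof.
by apply/eqP/eqP => [/Normc.eq0_normc//|->]; rewrite cabs0.
Qed.

Lemma cabs_gt0 z : (0 < cabs z) = (z != 0).
Proof. by rewrite lt_def cabs_ge0 andbT cabs_eq0. Qed.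

Lemma cabsM x y : cabs (x * y) = cabs x * cabs y.
Proof. exact: Normc.normcM. Qed.

Lemma cabsV x : cabs x^-1 = (cabs x)^-1.
Proof. exact: Normc.normcV. Qed.

Lemma cabsX x n : cabs (x ^+ n) = cabs x ^+ n.
Proof. by elim: n => [|n IH]; rewrite ?expr0 ?cabs1// !exprS cabsM IH. Qed.

Lemma cabsN x : cabs (- x) = cabs x.
Proof. exact: normcN. Qed.

Lemma cabsB x y : cabs (x - y) = cabs (y - x).
Proof. by rewrite -cabsN opprB. Qed.

Lemma cabsD x y : cabs (x + y) <= cabs x + cabs y.
Proof. exact: le_normcD. Qed.

Lemma cabsR (a : R) : cabs a%:C = `|a|.
Proof. by rewrite /cabs /= expr0n addr0 sqrtr_sqr. Qed.

Lemma cabs_nat n : cabs n%:R = n%:R.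
Proof.
have -> : (n%:R : R[i]) = (n%:R)%:C by rewrite rmorph_nat.
by rewrite cabsR ger0_norm.
Qed.

Lemma cabsD_sub x y : cabs x - cabs y <= cabs (x + y).
Proof.
have := cabsD (x + y) (- y); rewrite cabsN addrK; lra.
Qed.

Lemma cabsDD x y z : cabs (x + y + z) <= cabs x + cabs y + cabs z.
Proof. by have := cabsD (x + y) z; have := cabsD x y; lra. Qed.

Lemma cabs_sum (I : Type) (s : seq I) (f : I -> R[i]) :
  cabs (\sum_(i <- s) f i) <= \sum_(i <- s) cabs (f i).
Proof.
elim: s => [|i s IH]; first by rewrite !big_nil cabs0.
by rewrite !big_cons; have := cabsD (f i) (\sum_(i <- s) f i); lra.
Qed.

Lemma sqr_cabs z : cabs z ^+ 2 = complex.Re z ^+ 2 + complex.Im z ^+ 2.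
Proof. by case: z => a b; rewrite /cabs /= sqr_sqrtr// addr_ge0 ?sqr_ge0. Qed.

Lemma Re_le_cabs z : `|complex.Re z| <= cabs z.
Proof.
by rewrite -(@ler_pXn2r _ 2)// ?nnegrE ?cabs_ge0// real_normK ?num_real// sqr_cabs lerDl sqr_ge0.
Qed.

Lemma Im_le_cabs z : `|complex.Im z| <= cabs z.
Proof.
by rewrite -(@ler_pXn2r _ 2)// ?nnegrE ?cabs_ge0// real_normK ?num_real// sqr_cabs lerDr sqr_ge0.
Qed.

Lemma cabs_le_ReIm z : cabs z <= `|complex.Re z| + `|complex.Im z|.
Proof.
have -> : z = (complex.Re z)%:C + 'i%C * (complex.Im z)%:C by rewrite -complexE.
apply: le_trans (cabsD _ _) _; rewrite cabsM !cabsR.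
have -> : cabs 'i%C = 1 by rewrite /cabs /= expr0n add0r expr1n sqrtr1.
by rewrite mul1r -complexE.
Qed.

End Modulus.

(** * Unordered sums of complex families *)

Section Sums.
Variable R : realType.
Variable I : choiceType.
Implicit Types (f g : I -> R[i]) (A B : {fset I}).

Definition has_sum f s := forall e : R, 0 < e ->
  exists A, forall B, (A `<=` B)%fset -> cabs (\sum_(i <- B) f i - s) < e.

Definition abs_bounded f (M : R) := forall A, \sum_(i <- A) cabs (f i) <= M.

Lemma has_sum_unique f s t : has_sum f s -> has_sum f t -> s = t.
Proof.
move=> fs ft; apply/eqP; rewrite -subr_eq0 -cabs_eq0; apply/negPn/negP => ne0.
have e0 : 0 < cabs (s - t) / 2.
  by rewrite divr_gt0// lt_def ne0 cabs_ge0.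
have [A hA] := fs _ e0; have [B hB] := ft _ e0.
have := hA (A `|` B)%fset (fsubsetUl _ _); have := hB (A `|` B)%fset (fsubsetUr _ _).
set u := \sum_(i <- _) _ => h1 h2.
have := cabsD (s - u) (u - t).
rewrite (cabsB s u) (_ : s - u + (u - t) = s - t); last by ring.
lra.
Qed.

Lemma has_sumD f g s t :
  has_sum f s -> has_sum g t -> has_sum (fun i => f i + g i) (s + t).
Proof.
move=> fs gt e e0.
have e20 : 0 < e / 2 by lra.
have [A hA] := fs _ e20; have [B hB] := gt _ e20.
exists (A `|` B)%fset => X; rewrite fsubUset => /andP[AX BX].
rewrite big_split/= opprD addrACA; apply: le_lt_trans (cabsD _ _) _.
by have := hA X AX; have := hB X BX; lra.
Qed.

Lemma has_sumZ f s c : has_sum f s -> has_sum (fun i => c * f i) (c * s).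
Proof.
move=> fs e e0.
have k0 : 0 < cabs c + 1 by have := cabs_ge0 c; lra.
have [|A hA] := fs (e / (cabs c + 1)); first exact: divr_gt0.
exists A => B AB; rewrite -mulr_sumr -mulrBr cabsM.
have := hA B AB; rewrite ltr_pdivlMr//.
have := cabs_ge0 c; have := cabs_ge0 (\sum_(i <- B) f i - s); nra.
Qed.

Lemma has_sum_abs_le f s M : has_sum f s -> abs_bounded f M -> cabs s <= M.
Proof.
move=> fs fM; apply/ler_addgt0Pr => e e0.
have [A hA] := fs _ e0; have := hA A (fsubset_refl _).
have := fM A; have := cabs_sum A f; set u := \sum_(i <- _) _.
have := cabsD u (s - u); rewrite (cabsB s u) addrC subrK; lra.
Qed.

(** A bounded family of finite sums of nonnegative terms converges to its
    supremum. *)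
Lemma nneg_sum (g : I -> R) M : (forall i, 0 <= g i) ->
  (forall A, \sum_(i <- A) g i <= M) ->
  exists s : R, forall e, 0 < e -> exists A, forall B, (A `<=` B)%fset ->
    `|\sum_(i <- B) g i - s| < e.
Proof.
move=> g0 gM; pose E := [set \sum_(i <- A) g i | A in [set: {fset I}]].
have supE : has_sup E.
  split; first by exists (\sum_(i <- fset0%fset) g i), fset0%fset.
  exists M; apply/ubP => x [A _ <-]; exact: gM.
exists (sup E) => e e0.
have [_ [A _ <-] hA] := sup_adherent e0 supE.
exists A => B AB.
have h1 : \sum_(i <- B) g i <= sup E.
  by apply: ub_le_sup; [case: supE | exists B].
have h2 : \sum_(i <- A) g i <= \sum_(i <- B) g i.
  rewrite (big_fsetID _ (fun i => i \in A) B)/=.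
  have -> : [fset x | x in B & x \in A]%fset = A.
    apply/fsetP => x; rewrite !inE/=; apply/andP/idP => [[]//|xA]; split=> //.
    exact: (fsubsetP AB).
  by rewrite lerDl sumr_ge0// => i _; exact: g0.
by rewrite ltr_norml; apply/andP; split; lra.
Qed.

(** The terms are the differences of the nonnegative families [|g| + g] and
    [|g|]. *)
Lemma real_sum (g : I -> R) M :
  (forall A, \sum_(i <- A) `|g i| <= M) ->
  exists s : R, has_sum (fun i => (g i)%:C) s%:C.
Proof.
move=> gM.
have [|A|s hs] := @nneg_sum (fun i => `|g i| + g i) (M + M).
- by move=> i; have := ler_norm (- g i); rewrite normrN; lra.
- rewrite big_split/=; have := gM A.
  have : \sum_(i <- A) g i <= \sum_(i <- A) `|g i|.
    by apply: ler_sum => i _; exact: ler_norm.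
  lra.
have [//|//|t ht] := @nneg_sum (fun i => `|g i|) M.
exists (s - t) => e e0.
have e20 : 0 < e / 2 by lra.
have [A hA] := hs _ e20; have [B hB] := ht _ e20.
exists (A `|` B)%fset => X; rewrite fsubUset => /andP[AX BX].
rewrite -rmorph_sum -rmorphB cabsR.
have := hA X AX; have := hB X BX; rewrite big_split/=.
set u := \sum_(i <- X) `|g i|; set v := \sum_(i <- X) g i.
by rewrite !ltr_norml => /andP[? ?] /andP[? ?]; apply/andP; split; lra.
Qed.

Lemma has_sum_exists f M : abs_bounded f M -> exists s, has_sum f s.
Proof.
move=> fM.
have [|s hs] := @real_sum (fun i => complex.Re (f i)) M.
  by move=> A; apply: le_trans (fM A); apply: ler_sum => i _; exact: Re_le_cabs.
have [|t ht] := @real_sum (fun i => complex.Im (f i)) M.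
  by move=> A; apply: le_trans (fM A); apply: ler_sum => i _; exact: Im_le_cabs.
exists (s%:C + 'i%C * t%:C).
have := has_sumD hs (has_sumZ 'i%C ht).
have -> : (fun i => (complex.Re (f i))%:C + 'i%C * (complex.Im (f i))%:C) = f.
  by apply/funext => i; rewrite -complexE.
by [].
Qed.

(** The link with limits: computing with [has_sum] avoids filters on finite
    sets. *)
Lemma has_sum_sum f s : has_sum f s -> summability.sum f = s.
Proof.
move=> fs; have FF := @summability.totally_filter I.
apply: cvg_lim; first exact: norm_hausdorff.
apply/cvgrPdist_lt => e.
rewrite ltcE => /andP[/eqP Ime Ree].
have [A hA] := fs _ Ree.
exists A => //= B /= AB; have := hA _ AB.
have <- : \sum_(i <- B) f i = summability.partial_sum f B.
  by rewrite /summability.partial_sum big_seq_fsetE.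
rewrite cabsB => h.
by rewrite normE ltcE /= h Ime eqxx.
Qed.

End Sums.

Lemma has_sum_reindex (R : realType) (I J : choiceType) (phi : J -> I)
    (f : I -> R[i]) s :
  bijective phi -> has_sum f s -> has_sum (f \o phi) s.
Proof.
move=> [psi phiK psiK] fs e /fs[A hA].
exists [fset psi i | i in A]%fset => B AB.
have := hA [fset phi j | j in B]%fset.
have -> : \sum_(i <- [fset phi j | j in B]%fset) f i = \sum_(j <- B) f (phi j).
  rewrite big_imfset//= => x y _ _; exact: (can_inj phiK).
apply; apply/fsubsetP => i iA; apply/imfsetP; exists (psi i); last by rewrite psiK.
by apply: (fsubsetP AB); apply/imfsetP; exists i.
Qed.

(** * Sums over sets of complex numbers *)

Section SetSums.
Variable R : realType.
Implicit Types (A B : set R[i]) (f g : R[i] -> R[i]) (M c d : R).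

Definition set_sum A f : R[i] := summability.sum (patch (fun=> 0) A f).

Definition has_set_sum A f s := has_sum (patch (fun=> 0) A f) s.

Definition abs_bounded_on A f M := abs_bounded (patch (fun=> 0) A f) M.

Definition abs_summable A f := exists M, abs_bounded_on A f M.

Lemma patch_in A f x : A x -> patch (fun=> 0) A f x = f x.
Proof. by move=> Ax; rewrite patchE; case: ifPn => //; rewrite notin_setE. Qed.

Lemma patch_out A f x : ~ A x -> patch (fun=> 0) A f x = 0.
Proof. by move=> Ax; rewrite patchE; case: ifPn => //; rewrite in_setE. Qed.

Lemma has_set_sumE A f s : has_set_sum A f s -> set_sum A f = s.
Proof. exact: has_sum_sum. Qed.

Lemma abs_summableP A f : abs_summable A f -> has_set_sum A f (set_sum A f).
Proof.
by move=> [M /has_sum_exists[s fs]]; rewrite (has_set_sumE fs).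
Qed.

Lemma eq_patch A f g : (forall x, A x -> f x = g x) ->
  patch (fun=> 0) A f = patch (fun=> 0) A g :> (R[i] -> R[i]).
Proof.
move=> fg; apply/funext => x; have [Ax|Ax] := pselect (A x).
  by rewrite !patch_in// fg.
by rewrite !patch_out.
Qed.

Lemma eq_has_set_sum A f g s : (forall x, A x -> f x = g x) ->
  has_set_sum A f s -> has_set_sum A g s.
Proof. by move=> fg; rewrite /has_set_sum (eq_patch fg). Qed.

Lemma has_set_sumD A f g s t : has_set_sum A f s -> has_set_sum A g t ->
  has_set_sum A (fun x => f x + g x) (s + t).
Proof.
move=> fs gt; have := has_sumD fs gt; congr has_sum.
apply/funext => x; have [Ax|Ax] := pselect (A x); first by rewrite !patch_in.
by rewrite !patch_out ?addr0.
Qed.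

Lemma has_set_sumZ A f s k : has_set_sum A f s ->
  has_set_sum A (fun x => k * f x) (k * s).
Proof.
move=> fs; have := has_sumZ k fs; congr has_sum.
apply/funext => x; have [Ax|Ax] := pselect (A x); first by rewrite !patch_in.
by rewrite !patch_out ?mulr0.
Qed.

Lemma has_set_sum_bij A B (phi : R[i] -> R[i]) f s : bijective phi ->
  (forall x, A (phi x) <-> B x) ->
  has_set_sum A f s -> has_set_sum B (f \o phi) s.
Proof.
move=> phiB AB fs; have := has_sum_reindex phiB fs; congr has_sum.
apply/funext => x /=; have [Bx|Bx] := pselect (B x).
  by rewrite !patch_in//; exact/AB.
by rewrite !patch_out// => /AB.
Qed.

Lemma has_set_sumU A B f s t : (forall x, A x -> ~ B x) ->
  has_set_sum A f s -> has_set_sum B f t -> has_set_sum (A `|` B) f (s + t).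
Proof.
move=> AB fs ft; have := has_sumD fs ft; congr has_sum.
apply/funext => x; have [Ax|Ax] := pselect (A x).
  by rewrite (patch_out _ (AB _ Ax)) !patch_in ?addr0//; left.
have [Bx|Bx] := pselect (B x).
  by rewrite (patch_out _ Ax) !patch_in ?add0r//; right.
by rewrite !patch_out ?addr0// => -[].
Qed.

Lemma has_set_sum1 a f : has_set_sum [set a] f (f a).
Proof.
move=> e e0; exists [fset a]%fset => B; rewrite fsub1set => aB.
rewrite (big_fsetD1 a)//= patch_in// big1_fset ?addr0 ?subrr ?cabs0// => x.
by rewrite !inE => /andP[/eqP xa _] _; rewrite patch_out.
Qed.

Lemma has_set_sum_le A f s M :
  has_set_sum A f s -> abs_bounded_on A f M -> cabs s <= M.
Proof. exact: has_sum_abs_le. Qed.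

Lemma abs_bounded_on_le A f g M c : 0 <= c ->
  (forall x, A x -> cabs (f x) <= c * cabs (g x)) ->
  abs_bounded_on A g M -> abs_bounded_on A f (c * M).
Proof.
move=> c0 fg gM X; apply: le_trans (ler_wpM2l c0 (gM X)).
rewrite mulr_sumr; apply: ler_sum => x _; have [Ax|Ax] := pselect (A x).
  by rewrite !patch_in ?fg.
by rewrite !patch_out ?cabs0 ?mulr0.
Qed.

Lemma abs_summable_le A f g c : 0 <= c ->
  (forall x, A x -> cabs (f x) <= c * cabs (g x)) ->
  abs_summable A g -> abs_summable A f.
Proof. by move=> c0 fg [M gM]; exists (c * M); exact: abs_bounded_on_le gM. Qed.

Lemma abs_summable_le2 A f g1 g2 c : 0 <= c ->
  (forall x, A x -> cabs (f x) <= c * (cabs (g1 x) + cabs (g2 x))) ->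
  abs_summable A g1 -> abs_summable A g2 -> abs_summable A f.
Proof.
move=> c0 fg [M gM] [N gN]; exists (c * (M + N)) => X.
apply: le_trans (ler_wpM2l c0 (lerD (gM X) (gN X))).
rewrite -big_split mulr_sumr; apply: ler_sum => x _ /=.
have [Ax|Ax] := pselect (A x); first by rewrite !patch_in ?fg.
by rewrite !patch_out ?cabs0 ?addr0 ?mulr0.
Qed.

Lemma abs_summable_bij A B (phi : R[i] -> R[i]) f : bijective phi ->
  (forall x, A (phi x) <-> B x) ->
  abs_summable A f -> abs_summable B (f \o phi).
Proof.
move=> [psi phiK psiK] AB [M fM]; exists M => X.
apply: le_trans (fM [fset phi x | x in X]%fset).
rewrite big_imfset/=; last by move=> x y _ _; exact: (can_inj phiK).
apply: ler_sum => x _; have [Bx|Bx] := pselect (B x).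
  by rewrite !patch_in//; exact/AB.
by rewrite !patch_out ?cabs0// => /AB.
Qed.

(** These two bounds make every series below converge absolutely, the
    remainders of Taylor expansions included. Lattices without the origin and
    their translates off the lattice are the examples. *)
Definition thin A := abs_summable A (fun x => x ^- 3) /\
  exists d : R, 0 < d /\ forall x, A x -> d <= cabs x.

Definition power_sum k A : R[i] := set_sum A (fun x => x ^- k).

Lemma cabs_powV (x : R[i]) k : cabs (x ^- k) = (cabs x) ^- k.
Proof. by rewrite cabsV cabsX. Qed.

Lemma thin_pow_le A k : thin A -> exists c : R, 0 <= c /\
  forall x, A x -> cabs (x ^- (k + 3)) <= c * cabs (x ^- 3).
Proof.
move=> [_ [d [d0 dA]]]; exists (d ^- k); split=> [|x Ax].
  by rewrite invr_ge0 exprn_ge0// ltW.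
have x0 : 0 < cabs x by apply: lt_le_trans (dA _ Ax).
rewrite !cabs_powV exprD invfM; apply: ler_wpM2r.
  by rewrite invr_ge0 exprn_ge0// ltW.
by rewrite lef_pV2 ?posrE ?exprn_gt0// lerXn2r ?nnegrE ?dA// ltW.
Qed.

Lemma thin_pow A k : thin A -> abs_summable A (fun x => x ^- (k + 3)).
Proof.
move=> tA; have [c [c0 cA]] := thin_pow_le k tA.
by apply: abs_summable_le c0 cA _; case: tA.
Qed.

Lemma has_power_sum A k : thin A ->
  has_set_sum A (fun x => x ^- (k + 3)) (power_sum (k + 3) A).
Proof. by move=> tA; apply: abs_summableP; exact: thin_pow. Qed.

End SetSums.

(** * Taylor expansion of inverse powers *)

Section Taylor.
Variable R : realType.
Implicit Types (A : set R[i]) (x h : R[i]).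

Lemma half_gap x h : x != 0 -> cabs h <= cabs x / 2 ->
  x + h != 0 /\ cabs x / 2 <= cabs (x + h).
Proof.
rewrite -cabs_gt0 => x0 hx.
have hh : cabs x / 2 <= cabs (x + h) by have := cabsD_sub x h; lra.
by split=> //; rewrite -cabs_gt0; lra.
Qed.

Lemma inv_pow_half_gap x h k : x != 0 -> cabs h <= cabs x / 2 ->
  cabs ((x + h) ^- k) <= 2 ^+ k * cabs x ^- k.
Proof.
move=> x0 hx; have [xh0 gap] := half_gap x0 hx.
have c0 : 0 < cabs x by rewrite cabs_gt0.
have -> : 2 ^+ k * cabs x ^- k = (cabs x / 2) ^- k.
  by rewrite expr_div_n invfM invrK mulrC.
rewrite cabs_powV lef_pV2 ?posrE ?exprn_gt0 ?cabs_gt0//; last by lra.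
by rewrite lerXn2r ?nnegrE ?cabs_ge0//; lra.
Qed.

(** The remainders are computed in closed form; the constant [1000] covers the
    three expansions of this part. *)
Lemma taylor2 x h : x != 0 -> cabs h <= cabs x / 2 ->
  cabs ((x + h) ^- 2 - x ^- 2 - (- 2 * h * x ^- 3 + 3 * h ^+ 2 * x ^- 4
     - 4 * h ^+ 3 * x ^- 5 + 5 * h ^+ 4 * x ^- 6))
  <= 1000 * cabs h ^+ 5 * cabs (x ^- 7).
Proof.
move=> x0 hx; have [xh0 gap] := half_gap x0 hx.
have c0 : 0 < cabs x by rewrite cabs_gt0.
have -> : (x + h) ^- 2 - x ^- 2 - (- 2 * h * x ^- 3 + 3 * h ^+ 2 * x ^- 4
     - 4 * h ^+ 3 * x ^- 5 + 5 * h ^+ 4 * x ^- 6)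
  = - h ^+ 5 * x ^- 6 * (6 * x + 5 * h) * (x + h) ^- 2.
  by field; rewrite x0 xh0.
rewrite 3!cabsM cabsN cabsX !cabs_powV.
rewrite [leRHS](_ : _ = cabs h ^+ 5 * cabs x ^- 6 * (250 * cabs x) * (2 ^+ 2 * cabs x ^- 2));
  last by field; rewrite gt_eqF.
have p0 : 0 <= cabs h ^+ 5 by rewrite exprn_ge0 ?cabs_ge0.
have p1 : 0 <= cabs x ^- 6 by rewrite invr_ge0 exprn_ge0 ?cabs_ge0.
rewrite -(cabs_powV (x + h)); apply: ler_pM; rewrite ?cabs_ge0 ?inv_pow_half_gap ?mulr_ge0 ?cabs_ge0//.
apply: ler_wpM2l; first exact: mulr_ge0.
by have := cabsD (6 * x) (5 * h); rewrite !cabsM !cabs_nat; lra.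
Qed.

Lemma taylor3 x h : x != 0 -> cabs h <= cabs x / 2 ->
  cabs ((x + h) ^- 3 - (x ^- 3 - 3 * h * x ^- 4 + 6 * h ^+ 2 * x ^- 5
     - 10 * h ^+ 3 * x ^- 6))
  <= 1000 * cabs h ^+ 4 * cabs (x ^- 7).
Proof.
move=> x0 hx; have [xh0 gap] := half_gap x0 hx.
have c0 : 0 < cabs x by rewrite cabs_gt0.
have -> : (x + h) ^- 3 - (x ^- 3 - 3 * h * x ^- 4 + 6 * h ^+ 2 * x ^- 5
     - 10 * h ^+ 3 * x ^- 6)
  = h ^+ 4 * x ^- 6 * (15 * (x * x) + 24 * (x * h) + 10 * (h * h)) * (x + h) ^- 3.
  by field; rewrite x0 xh0.
rewrite 3!cabsM cabsX !cabs_powV.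
rewrite [leRHS](_ : _ = cabs h ^+ 4 * cabs x ^- 6 * (125 * (cabs x * cabs x)) * (2 ^+ 3 * cabs x ^- 3));
  last by field; rewrite gt_eqF.
have p0 : 0 <= cabs h ^+ 4 by rewrite exprn_ge0 ?cabs_ge0.
have p1 : 0 <= cabs x ^- 6 by rewrite invr_ge0 exprn_ge0 ?cabs_ge0.
rewrite -(cabs_powV (x + h)); apply: ler_pM; rewrite ?cabs_ge0 ?inv_pow_half_gap ?mulr_ge0 ?cabs_ge0//.
apply: ler_wpM2l; first exact: mulr_ge0.
have := cabsDD (15 * (x * x)) (24 * (x * h)) (10 * (h * h)).
rewrite !cabsM !cabs_nat; have := cabs_ge0 h; nra.
Qed.

Lemma taylor4 x h : x != 0 -> cabs h <= cabs x / 2 ->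
  cabs ((x + h) ^- 4 - (x ^- 4 - 4 * h * x ^- 5 + 10 * h ^+ 2 * x ^- 6))
  <= 1000 * cabs h ^+ 3 * cabs (x ^- 7).
Proof.
move=> x0 hx; have [xh0 gap] := half_gap x0 hx.
have c0 : 0 < cabs x by rewrite cabs_gt0.
have -> : (x + h) ^- 4 - (x ^- 4 - 4 * h * x ^- 5 + 10 * h ^+ 2 * x ^- 6)
  = - h ^+ 3 * x ^- 6 * (x * (20 * (x * x) + 45 * (x * h) + 36 * (h * h))
      + 10 * (h * (h * h))) * (x + h) ^- 4.
  by field; rewrite x0 xh0.
rewrite 3!cabsM cabsN cabsX !cabs_powV.
rewrite [leRHS](_ : _ = cabs h ^+ 3 * cabs x ^- 6 * (1000 / 16 * (cabs x * (cabs x * cabs x))) * (2 ^+ 4 * cabs x ^- 4));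
  last by field; rewrite gt_eqF.
have p0 : 0 <= cabs h ^+ 3 by rewrite exprn_ge0 ?cabs_ge0.
have p1 : 0 <= cabs x ^- 6 by rewrite invr_ge0 exprn_ge0 ?cabs_ge0.
rewrite -(cabs_powV (x + h)); apply: ler_pM; rewrite ?cabs_ge0 ?inv_pow_half_gap ?mulr_ge0 ?cabs_ge0//.
apply: ler_wpM2l; first exact: mulr_ge0.
have := cabsD (x * (20 * (x * x) + 45 * (x * h) + 36 * (h * h))) (10 * (h * (h * h))).
have := cabsDD (20 * (x * x)) (45 * (x * h)) (36 * (h * h)).
rewrite !cabsM; set b := cabs (_ + _ + _); rewrite !cabs_nat.
have b0 : 0 <= b by exact: cabs_ge0.
have := cabs_ge0 h => h0 hb.
set X := cabs x in hx c0 hb *; set H := cabs h in hx h0 hb *.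
have HX : H * H <= X * X / 4 by nra.
have HXX : H * X <= X * X / 2 by nra.
have hb' : b <= 52 * (X * X) by lra.
have : X * b <= X * (52 * (X * X)) by rewrite ler_wpM2l// ltW.
have : H * (H * H) <= X / 2 * (X * X / 4) by rewrite ler_pM ?mulr_ge0.
have := mulr_ge0 (ltW c0) (mulr_ge0 (ltW c0) (ltW c0)).
lra.
Qed.

End Taylor.

Section TaylorSums.
Variable R : realType.
Implicit Types (A : set R[i]) (x h : R[i]).

Definition shift_diff A h : R[i] := set_sum A (fun x => (x + h) ^- 2 - x ^- 2).
Definition shift_sum k A h : R[i] := set_sum A (fun x => (x + h) ^- k).

Variable (A : set R[i]).
Hypothesis tA : thin A.
Local Notation T := (@power_sum R).

Lemma sum_remainder : exists c d : R, [/\ 0 <= c, 0 < d & forall (f : R[i] -> R[i]) M, 0 <= M ->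
  (forall x, A x -> cabs (f x) <= M * cabs (x ^- 7)) ->
  abs_summable A f /\ cabs (set_sum A f) <= c * M] /\
  (forall x, A x -> d <= cabs x).
Proof.
have [_ [d [d0 dA]]] := tA.
have [M hM] := thin_pow 4 tA.
exists M, d; split=> //; split=> //.
  by apply: le_trans (hM fset0); rewrite big_seq_fset0.
move=> f N N0 fN.
have fS : abs_bounded_on A f (N * M) by apply: abs_bounded_on_le N0 fN hM.
have fS' : abs_summable A f by exists (N * M).
split=> //; rewrite mulrC; apply: has_set_sum_le fS; exact: abs_summableP.
Qed.

(** Termwise expansion: each remainder is at most a multiple of [x ^- 7], and
    these sum up on a thin set. *)
Lemma taylor_sums : exists C d : R, [/\ 0 <= C, 0 < d, 
  (forall x, A x -> 2 * d <= cabs x) & forall h, cabs h <= d ->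
  [/\ cabs (shift_diff A h - (- 2 * h * T 3 A + 3 * h ^+ 2 * T 4 A
     - 4 * h ^+ 3 * T 5 A + 5 * h ^+ 4 * T 6 A)) <= C * cabs h ^+ 5,
   cabs (shift_sum 3 A h - (T 3 A - 3 * h * T 4 A + 6 * h ^+ 2 * T 5 A
     - 10 * h ^+ 3 * T 6 A)) <= C * cabs h ^+ 4
 & cabs (shift_sum 4 A h - (T 4 A - 4 * h * T 5 A + 10 * h ^+ 2 * T 6 A))
     <= C * cabs h ^+ 3]].
Proof.
have [c [d [[c0 d0 hc] dA]]] := sum_remainder.
exists (c * 1000), (d / 2); split=> [||x Ax|h hd].
- exact: mulr_ge0 c0 (ler0n _ 1000).
- by rewrite divr_gt0.
- by have := dA _ Ax; lra.
have x0 x : A x -> x != 0 by move=> Ax; rewrite -cabs_gt0; have := dA _ Ax; lra.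
have hx x : A x -> cabs h <= cabs x / 2 by move=> Ax; have := dA _ Ax; lra.
have P k : 0 <= 1000 * cabs h ^+ k by apply: mulr_ge0; [exact: ler0n|rewrite exprn_ge0 ?cabs_ge0].
have H k := has_power_sum k tA.
have := H 0%N; have := H 1%N; have := H 2%N; have := H 3%N.
rewrite !addSn !add0n => H6 H5 H4 H3.
split.
- have [S1 S2] := hc _ _ (P 5%N) (fun x Ax => taylor2 (x0 _ Ax) (hx _ Ax)).
  rewrite -[leRHS]mulrA; apply: le_trans S2; rewrite le_eqVlt; apply/orP; left; apply/eqP.
  congr cabs; apply/eqP; rewrite subr_eq; apply/eqP; apply: has_set_sumE.
  have := has_set_sumD (abs_summableP S1) (has_set_sumD (has_set_sumD (has_set_sumD
    (has_set_sumZ (- 2 * h) H3) (has_set_sumZ (3 * h ^+ 2) H4))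
    (has_set_sumZ (- (4 * h ^+ 3)) H5)) (has_set_sumZ (5 * h ^+ 4) H6)).
  rewrite !mulNr => hs; apply: eq_has_set_sum hs => x Ax; cbv beta; ring.
- have [S1 S2] := hc _ _ (P 4%N) (fun x Ax => taylor3 (x0 _ Ax) (hx _ Ax)).
  rewrite -[leRHS]mulrA; apply: le_trans S2; rewrite le_eqVlt; apply/orP; left; apply/eqP.
  congr cabs; apply/eqP; rewrite subr_eq; apply/eqP; apply: has_set_sumE.
  have := has_set_sumD (abs_summableP S1) (has_set_sumD (has_set_sumD (has_set_sumD
    H3 (has_set_sumZ (- (3 * h)) H4))
    (has_set_sumZ (6 * h ^+ 2) H5)) (has_set_sumZ (- (10 * h ^+ 3)) H6)).
  rewrite !mulNr => hs; apply: eq_has_set_sum hs => x Ax; cbv beta; ring.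
- have [S1 S2] := hc _ _ (P 3%N) (fun x Ax => taylor4 (x0 _ Ax) (hx _ Ax)).
  rewrite -[leRHS]mulrA; apply: le_trans S2; rewrite le_eqVlt; apply/orP; left; apply/eqP.
  congr cabs; apply/eqP; rewrite subr_eq; apply/eqP; apply: has_set_sumE.
  have := has_set_sumD (abs_summableP S1) (has_set_sumD (has_set_sumD 
    H4 (has_set_sumZ (- (4 * h)) H5))
    (has_set_sumZ (10 * h ^+ 2) H6)).
  rewrite !mulNr => hs; apply: eq_has_set_sum hs => x Ax; cbv beta; ring.
Qed.

End TaylorSums.

(** * Lattices with a basis *)

Section PlaneLattice.
Variable R : realType.
Implicit Types (x y z u v w : R[i]) (m n : int) (A : set R[i]).

Definition area a b : R :=
  complex.Re a * complex.Im b - complex.Im a * complex.Re b.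

Definition lat a b : set R[i] :=
  [set x | exists m n, x = m%:~R * a + n%:~R * b].

Lemma intC n : (n%:~R : R[i]) = (n%:~R)%:C.
Proof. by rewrite rmorph_int. Qed.

Lemma area_comb a b (s t : R) :
  area a (s%:C * a + t%:C * b) = t * area a b /\
  area (s%:C * a + t%:C * b) b = s * area a b.
Proof. by case: a b => [a1 a2] [b1 b2]; rewrite /area /=; split; ring. Qed.

Lemma area_le a z : `|area a z| <= 2 * (cabs a * cabs z).
Proof.
rewrite /area; apply: le_trans (ler_normB _ _) _; rewrite !normrM.
have := ler_pM (normr_ge0 _) (normr_ge0 _) (Re_le_cabs a) (Im_le_cabs z).
have := ler_pM (normr_ge0 _) (normr_ge0 _) (Im_le_cabs a) (Re_le_cabs z).
lra.
Qed.

Lemma coordE a b z : area a b != 0 ->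
  z = (area z b / area a b)%:C * a + (area a z / area a b)%:C * b.
Proof.
case: a b z => [a1 a2] [b1 b2] [z1 z2]; rewrite /area /= => d0.
apply/eqP; rewrite eq_complex /=; apply/andP; split; apply/eqP;
  by field; rewrite d0.
Qed.

Lemma lat_subgroup a b : subgroup (lat a b).
Proof.
split; first by exists 0, 0; rewrite !mul0r addr0.
move=> x y [m [n ->]] [m' [n' ->]]; exists (m - m'), (n - n').
by rewrite !rmorphB/=; ring.
Qed.

Lemma latl a b : lat a b a.
Proof. by exists 1, 0; rewrite mul0r addr0 mul1r. Qed.

Lemma latr a b : lat a b b.
Proof. by exists 0, 1; rewrite mul0r add0r mul1r. Qed.

End PlaneLattice.

Section SubgroupOps.
Variables (R : realType) (G : set R[i]).
Hypothesis sG : subgroup G.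

Lemma subgroup0 : G 0. Proof. by case: sG. Qed.
Lemma subgroupB x y : G x -> G y -> G (x - y). Proof. by case: sG => _; exact. Qed.
Lemma subgroupN x : G x -> G (- x).
Proof. by move=> Gx; rewrite -sub0r; apply: subgroupB => //; exact: subgroup0. Qed.
Lemma subgroupD x y : G x -> G y -> G (x + y).
Proof. by move=> Gx Gy; rewrite -[y]opprK; apply: subgroupB => //; exact: subgroupN. Qed.
Lemma subgroupMn x n : G x -> G (x *+ n).
Proof.
move=> Gx; elim: n => [|n IH]; first by rewrite mulr0n; exact: subgroup0.
by rewrite mulrS; exact: subgroupD.
Qed.
Lemma subgroupMz x (m : int) : G x -> G (m%:~R * x).
Proof.
move=> Gx; case: m => n.
  by rewrite mulrzl; exact: subgroupMn.
by rewrite NegzE rmorphN mulNr mulrzl; apply: subgroupN; exact: (subgroupMn n.+1).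
Qed.
Lemma lat_subset a b : G a -> G b -> lat a b `<=` G.
Proof. by move=> Ga Gb x [m [n ->]]; apply: subgroupD; exact: subgroupMz. Qed.
Lemma subgroupDr x y : G y -> G (x + y) <-> G x.
Proof.
move=> Gy; split=> [Gxy|Gx]; last exact: subgroupD.
by rewrite -[x](addrK y); exact: subgroupB.
Qed.
End SubgroupOps.

(** * Convergence of lattice sums *)

Section LatticeSums.
Variable R : realType.
Implicit Types (m n : int).

(** Bounding [|x| ^- 3] by a product of weights of the two coordinates
    decouples the double sum. *)
Definition weight (m : int) : R := Num.sqrt (1 + `|m%:~R|) ^- 3.

Lemma weight_ge0 m : 0 <= weight m.
Proof. by rewrite invr_ge0 exprn_ge0 ?sqrtr_ge0. Qed.

Definition int_box N := [seq Posz i | i <- iota 0 N] ++ [seq Negz i | i <- iota 0 N].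

Lemma mem_int_box N m : (absz m < N)%N -> m \in int_box N.
Proof.
case: m => n /= h; rewrite mem_cat; apply/orP; [left|right];
  apply/mapP; exists n => //; rewrite mem_iota add0n//= ltnW//.
Qed.

(** Telescoping: [q ^- 3 <= 2 / p - 2 / q] for consecutive square roots [p]
    and [q]. *)
Lemma sum_weight_nat N : \sum_(i < N) (Num.sqrt (1 + i%:R) ^- 3 : R) <= 3.
Proof.
suff : \sum_(i < N.+1) (Num.sqrt (1 + i%:R) ^- 3 : R) <= 3 - 2 * (Num.sqrt (N.+1%:R))^-1.
  rewrite big_ord_recr/= => h.
  have : 0 <= (Num.sqrt (1 + N%:R) ^- 3 : R) by rewrite invr_ge0 exprn_ge0 ?sqrtr_ge0.
  have : 0 <= (Num.sqrt (N.+1%:R))^-1 :> R by rewrite invr_ge0 sqrtr_ge0.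
  lra.
elim: N => [|N IH].
  by rewrite big_ord_recl big_ord0 /= !addr0 !sqrtr1 expr1n !invr1; lra.
rewrite big_ord_recr/=.
have x0 : 1 <= N.+1%:R :> R by rewrite ler1n.
have -> : N.+2%:R = 1 + N.+1%:R :> R by rewrite -natr1 addrC.
set x : R := N.+1%:R in IH x0 *.
set p := Num.sqrt x in IH *; set q := Num.sqrt (1 + x).
have p2 : p ^+ 2 = x by rewrite sqr_sqrtr//; lra.
have q2 : q ^+ 2 = 1 + x by rewrite sqr_sqrtr//; lra.
have p0 : 0 < p by rewrite sqrtr_gt0; lra.
have q0 : 0 < q by rewrite sqrtr_gt0; lra.
have pq : p <= q by rewrite ler_sqrt; lra.
suff : q ^- 3 <= 2 * p^-1 - 2 * q^-1 by lra.
have -> : 2 * p^-1 - 2 * q^-1 = 2 / (p * q * (p + q)).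
  have -> : 2 * p^-1 - 2 * q^-1 = 2 * (q ^+ 2 - p ^+ 2) / (p * q * (p + q)).
    by field; rewrite !gt_eqF// addr_gt0.
  by rewrite p2 q2 addrK mulr1.
rewrite ler_pdivlMr ?mulr_gt0 ?addr_gt0// mulrC ler_pdivrMr ?exprn_gt0//.
have : p * q <= q * q by rewrite ler_pM2r.
move=> h; have : (p * q) * (p + q) <= (q * q) * (q + q).
  by apply: ler_pM => //; rewrite ?mulr_ge0 ?addr_ge0 ?lerD2r// ltW.
have -> : 2 * q ^+ 3 = q * q * (q + q) by ring.
by [].
Qed.

Lemma sum_weight_box N : \sum_(m <- int_box N) weight m <= 6.
Proof.
rewrite big_cat !big_map/=.
have h := sum_weight_nat N.
have := sum_weight_nat N.+1; rewrite big_ord_recl/= => h'.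
have E1 : \sum_(j <- iota 0 N) weight (Posz j) = \sum_(i < N) (Num.sqrt (1 + i%:R) ^- 3 : R).
  have -> : iota 0 N = index_iota 0 N by rewrite /index_iota subn0.
  rewrite big_mkord; apply: eq_bigr => i _.
  by rewrite /weight ger0_norm.
have E2 : \sum_(j <- iota 0 N) weight (Negz j) <= \sum_(i < N) (Num.sqrt (1 + i%:R) ^- 3 : R).
  have -> : iota 0 N = index_iota 0 N by rewrite /index_iota subn0.
  rewrite big_mkord; apply: ler_sum => i _.
  have e : (Negz i)%:~R = - i.+1%:R :> R by rewrite NegzE mulrNz.
  rewrite /weight e normrN ger0_norm//.
  rewrite lef_pV2 ?posrE ?exprn_gt0 ?sqrtr_gt0 ?ltr_pwDl ?ler0n//.
  rewrite lerXn2r ?nnegrE ?sqrtr_ge0// ler_sqrt ?addr_ge0// lerD2l ler_nat//.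
lra.
Qed.

Lemma sum_sub_seq (T : eqType) (s t : seq T) (F : T -> R) :
  (forall x, 0 <= F x) -> uniq s -> {subset s <= t} ->
  \sum_(x <- s) F x <= \sum_(x <- t) F x.
Proof.
move=> F0; elim: s t => [|x s IH] t.
  by rewrite big_nil sumr_ge0.
move=> /= /andP[xs us] st; rewrite big_cons.
have xt : x \in t by apply: st; rewrite mem_head.
rewrite (perm_big _ (perm_to_rem xt))/= big_cons lerD2l; apply: IH => // y ys.
apply: rem_mem; first by apply: contraNneq xs => <-.
by apply: st; rewrite inE ys orbT.
Qed.

Variables a b : R[i].
Hypothesis ab : area a b != 0.

(** The coordinates are quotients of areas by Cramer's rule. *)
Lemma coord_bound : exists c : R, 0 < c /\ forall s t : R,
  `|s| + `|t| <= c * cabs (s%:C * a + t%:C * b).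
Proof.
have d0 : 0 < `|area a b| by rewrite normr_gt0.
have p0 : 0 <= 2 * (cabs a + cabs b) / `|area a b|.
  by rewrite divr_ge0 ?mulr_ge0 ?addr_ge0 ?cabs_ge0.
exists (2 * (cabs a + cabs b) / `|area a b| + 1); split=> [|s t]; first lra.
have [h1 h2] := area_comb a b s t.
set z := _ + _ in h1 h2 *.
apply: (@le_trans _ _ (2 * (cabs a + cabs b) / `|area a b| * cabs z)); last first.
  by rewrite ler_wpM2r ?cabs_ge0//; lra.
rewrite mulrAC ler_pdivlMr// mulrDl -!normrM -h1 -h2.
have := area_le a z; have := area_le z b.
lra.
Qed.

(** Every finite set of lattice points lies in a box of coordinates, where the
    sum of products of weights factors. *)
Lemma lat_abs_summable (f : R[i] -> R[i]) (K : R) :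
  (forall m n, cabs (f (m%:~R * a + n%:~R * b)) <= K * (weight m * weight n)) ->
  abs_summable (lat a b) f.
Proof.
move=> fK; exists (K * (6 * 6)) => X.
have K0 : 0 <= K.
  have := fK 0 0; have := cabs_ge0 (f (0%:~R * a + 0%:~R * b)).
  by rewrite /weight normr0 addr0 sqrtr1 expr1n invr1; lra.
have [c [c0 cP]] := coord_bound.
have [phi phiP] : {phi : R[i] -> int * int & forall x, lat a b x ->
    x = (phi x).1%:~R * a + (phi x).2%:~R * b}.
  pose phi x := xget (0, 0) [set p : int * int | x = p.1%:~R * a + p.2%:~R * b].
  exists phi => x [m [n xE]]; rewrite /phi; case: xgetP => [p _ //|/(_ (m, n))].
  by case.
pose t := [seq x <- X | x \in lat a b].
have tP x : x \in t -> lat a b x by rewrite mem_filter => /andP[/set_mem].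
have -> : \sum_(x <- X) cabs (patch (fun=> 0) (lat a b) f x) = \sum_(x <- t) cabs (f x).
  rewrite [RHS]big_filter [RHS]big_mkcond/=; apply: eq_bigr => x _; rewrite patchE.
  by case: ifP => // _; rewrite cabs0.
apply: (@le_trans _ _ (\sum_(x <- t) K * (weight (phi x).1 * weight (phi x).2))).
  rewrite !(big_seq _ _ t); apply: ler_sum => x /tP Lx; rewrite {1}(phiP x Lx); exact: fK.
rewrite -mulr_sumr ler_wpM2l//.
rewrite -(big_map phi xpredT (fun p => weight p.1 * weight p.2)).
pose N := (\sum_(p <- map phi t) (absz p.1 + absz p.2)).+1.
apply: (@le_trans _ _ (\sum_(p <- [seq (m, n) | m <- int_box N, n <- int_box N])
  weight p.1 * weight p.2)).
  apply: sum_sub_seq.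
  - by move=> p; rewrite mulr_ge0 ?weight_ge0.
  - rewrite map_inj_in_uniq ?filter_uniq ?fset_uniq// => x y /tP Lx /tP Ly e.
    by rewrite (phiP x Lx) (phiP y Ly) e.
  - move=> [m n] pt; apply/allpairsP; exists (m, n); split=> //;
    apply: mem_int_box; rewrite ltnS (big_rem _ pt)/=; lia.
rewrite big_allpairs/=.
under eq_bigr do rewrite -mulr_sumr.
rewrite -mulr_suml.
have S0 : 0 <= \sum_(m <- int_box N) weight m by apply: sumr_ge0 => m _; exact: weight_ge0.
by apply: ler_pM => //; exact: sum_weight_box.
Qed.

Lemma weight_le m n (Y : R) : 1 + `|m%:~R| <= Y -> 1 + `|n%:~R| <= Y ->
  Y ^- 3 <= weight m * weight n.
Proof.
move=> mY nY; rewrite /weight -invfM -exprMn.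
have m0 : 0 <= `|m%:~R : R| by []. have n0 : 0 <= `|n%:~R : R| by [].
rewrite lef_pV2 ?posrE ?exprn_gt0 ?mulr_gt0 ?sqrtr_gt0//; try lra.
rewrite lerXn2r ?nnegrE ?mulr_ge0 ?sqrtr_ge0//; try lra.
have -> : Y = Num.sqrt (Y * Y) by rewrite -expr2 sqrtr_sqr ger0_norm//; lra.
by rewrite -sqrtrM ?ler_sqrt ?mulr_ge0 ?ler_pM//; lra.
Qed.

Lemma lat_translate_summable (z : R[i]) (c : R) (f : R[i] -> R[i]) : 0 < c ->
  (forall m n, f (m%:~R * a + n%:~R * b) = 0 \/
    [/\ cabs (f (m%:~R * a + n%:~R * b)) <= cabs ((z + (m%:~R * a + n%:~R * b)) ^- 3),
       1 + `|m%:~R| <= c * cabs (z + (m%:~R * a + n%:~R * b)) &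
       1 + `|n%:~R| <= c * cabs (z + (m%:~R * a + n%:~R * b))]) ->
  abs_summable (lat a b) f.
Proof.
move=> c0 H; apply: (@lat_abs_summable _ (c ^+ 3)) => m n.
have w0 : 0 <= weight m * weight n by rewrite mulr_ge0 ?weight_ge0.
have [->|[h1 h2 h3]] := H m n.
  by rewrite cabs0; apply: mulr_ge0 => //; rewrite exprn_ge0 ?(ltW c0).
apply: le_trans h1 _; have := weight_le h2 h3; rewrite cabs_powV exprMn invfM.
by rewrite ler_pdivrMl ?exprn_gt0.
Qed.

End LatticeSums.

Section ThinLattices.
Variable R : realType.
Variables a b : R[i].
Hypothesis ab : area a b != 0.
Local Notation G := (lat a b).

Definition translate (z : R[i]) (A : set R[i]) : set R[i] := [set x | A (x - z)].

Lemma abs_summable_sub (A B : set R[i]) (f : R[i] -> R[i]) : B `<=` A ->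
  abs_summable A f -> abs_summable B f.
Proof.
move=> BA [M fM]; exists M => X; apply: le_trans (fM X).
apply: ler_sum => x _; have [Bx|Bx] := pselect (B x).
  by rewrite !patch_in//; exact: (BA _ Bx).
by rewrite (patch_out _ Bx) cabs0 cabs_ge0.
Qed.

Lemma eq_abs_summable (A : set R[i]) (f g : R[i] -> R[i]) :
  (forall x, A x -> f x = g x) -> abs_summable A f -> abs_summable A g.
Proof. by move=> fg; rewrite /abs_summable /abs_bounded_on (eq_patch fg). Qed.

Lemma dist_int (s : R) : (forall m : int, s != m%:~R) ->
  exists e : R, 0 < e /\ forall m : int, e <= `|s + m%:~R|.
Proof.
move=> sZ; have /andP[h1 h2] := floor_itv s.
have h0 : (Num.floor s)%:~R < s by rewrite lt_def sZ h1.
set k := Num.floor s in h0 h1 h2.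
exists (Num.min (s - k%:~R) ((k + 1)%:~R - s)); split.
  by rewrite lt_min; apply/andP; split; rewrite subr_gt0.
move=> m; rewrite ge_min.
have [mk|mk] := lerP (- m) k.
  apply/orP; left; apply: le_trans (ler_norm _).
  have : (- m)%:~R <= k%:~R :> R by rewrite ler_int.
  by rewrite mulrNz; lra.
apply/orP; right; rewrite -normrN; apply: le_trans (ler_norm _).
have : (k + 1)%:~R <= (- m)%:~R :> R by rewrite ler_int; lia.
by rewrite mulrNz; lra.
Qed.

Lemma lat_coordE m n : m%:~R * a + n%:~R * b
  = (m%:~R : R)%:C * a + (n%:~R : R)%:C * b.
Proof. by rewrite !intC. Qed.

Lemma int_norm_ge1 (m : int) : m != 0 -> 1 <= `|m%:~R : R|.
Proof. by move=> m0; rewrite -intr_norm ler1z; lia. Qed.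

Lemma lat0_gap : exists d : R, 0 < d /\ forall x, (G `\ 0) x -> d <= cabs x.
Proof.
have [c [c0 cP]] := coord_bound ab.
exists c^-1; split=> [|x [[m [n ->]] /= x0]]; first by rewrite invr_gt0.
rewrite lat_coordE -[_^-1]mul1r ler_pdivrMr// mulrC.
apply: le_trans (cP _ _).
have m0 : 0 <= `|m%:~R : R| by [].
have n0 : 0 <= `|n%:~R : R| by [].
have [mE|/int_norm_ge1] := eqVneq m 0; last by lra.
have [nE|/int_norm_ge1] := eqVneq n 0; last by lra.
by exfalso; apply: x0; rewrite mE nE !mul0r addr0.
Qed.

(** Off the lattice one of the two real coordinates is not an integer, and then
    keeps a positive distance from the integers. *)
Lemma translate_gap z : ~ G z ->
  exists d : R, 0 < d /\ forall u, G u -> d <= cabs (z + u).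
Proof.
move=> Gz; have [c [c0 cP]] := coord_bound ab.
set s := area z b / area a b; set t := area a z / area a b.
have zE : z = s%:C * a + t%:C * b by rewrite -coordE.
have H e : 0 < e -> (forall m : int, e <= `|s + m%:~R|) \/
  (forall m : int, e <= `|t + m%:~R|) ->
  exists d : R, 0 < d /\ forall u, G u -> d <= cabs (z + u).
  move=> e0 H; exists (e / c); split; first exact: divr_gt0.
  move=> u [m [n ->]]; rewrite ler_pdivrMr// mulrC.
  have -> : z + (m%:~R * a + n%:~R * b)
    = (s + m%:~R)%:C * a + (t + n%:~R)%:C * b.
    by rewrite lat_coordE {1}zE !rmorphD/=; ring.
  apply: le_trans (cP _ _).
  have := normr_ge0 (s + m%:~R); have := normr_ge0 (t + n%:~R).
  by case: H => [/(_ m)|/(_ n)]; lra.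
have nint (r : R) : ~ (forall m : int, r != m%:~R) -> exists m : int, r = m%:~R.
  by move=> /existsNP[m /negP]; rewrite negbK => /eqP; exists m.
have [sZ|/nint[m sm]] := pselect (forall m : int, s != m%:~R).
  by have [e [e0 eP]] := dist_int sZ; apply: (H e) => //; left.
have [tZ|/nint[n tn]] := pselect (forall m : int, t != m%:~R).
  by have [e [e0 eP]] := dist_int tZ; apply: (H e) => //; right.
by exfalso; apply: Gz; rewrite zE sm tn -lat_coordE; exists m, n.
Qed.

Lemma thin_lat0 : thin (G `\ 0).
Proof.
have [d [d0 dP]] := lat0_gap; split; last by exists d.
have [c [c0 cP]] := coord_bound ab.
apply: (@abs_summable_sub G); first by move=> x [].
pose f (x : R[i]) := if x == 0 then 0 else x ^- 3.
apply: (@eq_abs_summable _ f).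
  move=> x _; rewrite /f; case: eqP => // ->.
  by rewrite expr0n/= invr0.
apply: (@lat_translate_summable _ _ _ ab 0 (d^-1 + c)).
  by rewrite addr_gt0 ?invr_gt0.
move=> m n; rewrite /f; case: eqVneq => [//|x0]; first by left.
right; rewrite add0r; have dx := dP _ (conj (ex_intro _ m (ex_intro _ n erefl)) (elimN eqP x0)).
have := cP m%:~R n%:~R; rewrite -lat_coordE mulrDl.
have : 1 <= d^-1 * cabs (m%:~R * a + n%:~R * b) by rewrite mulrC ler_pdivlMr ?mul1r.
by have := normr_ge0 (m%:~R : R); have := normr_ge0 (n%:~R : R); split=> //; lra.
Qed.

Lemma thin_translate z : ~ G z -> thin (translate z G).
Proof.
move=> Gz; have [d [d0 dP]] := translate_gap Gz; split; last first.
  by exists d; split=> // x /dP; rewrite addrC subrK.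
have [c [c0 cP]] := coord_bound ab.
have B : bijective (fun x => x - z) by exists (fun x => x + z) => x; rewrite ?subrK ?addrK.
suff S : abs_summable G (fun u => (z + u) ^- 3).
  have := abs_summable_bij (B:=translate z G) B (fun x => iff_refl _) S.
  by apply: eq_abs_summable => x _ /=; rewrite addrC subrK.
have k0 : 0 <= (1 + c * cabs z) / d.
  by rewrite divr_ge0 ?addr_ge0 ?mulr_ge0 ?cabs_ge0// ltW.
apply: (@lat_translate_summable _ _ _ ab z ((1 + c * cabs z) / d + c)); first by lra.
move=> m n; right; have dx := dP _ (ex_intro _ m (ex_intro _ n erefl)).
have h := cP m%:~R n%:~R; rewrite -lat_coordE in h.
set u := _ + n%:~R * b in dx h *.
have h' : c * cabs u <= c * (cabs (z + u) + cabs z).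
  rewrite ler_pM2l//; have := cabsD (z + u) (- z).
  by rewrite cabsN (_ : z + u - z = u)//; ring.
have h'' : 1 + c * cabs z <= (1 + c * cabs z) / d * cabs (z + u).
  by rewrite -mulrA ler_peMr// ?addr_ge0 ?mulr_ge0 ?cabs_ge0 ?(ltW c0)// mulrC ler_pdivlMr// mul1r.
have := normr_ge0 (m%:~R : R); have := normr_ge0 (n%:~R : R).
by split=> //; lra.
Qed.

End ThinLattices.

(** * Periodicity of the Weierstrass function *)

Section Weierstrass.
Variable R : realType.
Variables a b : R[i].
Hypothesis ab : area a b != 0.
Local Notation G := (lat a b).
Local Notation T := (@power_sum R).
Implicit Types z h u v : R[i].

Let sG : subgroup G := lat_subgroup a b.

Lemma wpE z : wp z G = z ^- 2 + set_sum (G `\ 0) (fun u => (z - u) ^- 2 - u ^- 2).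
Proof. by []. Qed.

Lemma bij_opp : bijective (fun x : R[i] => - x).
Proof. by exists (fun x => - x) => x; rewrite opprK. Qed.

Lemma bij_sub z : bijective (fun x : R[i] => z - x).
Proof. by exists (fun x => z - x) => x; rewrite subKr. Qed.

Lemma bij_addr z : bijective (fun x : R[i] => x + z).
Proof. by exists (fun x => x - z) => x; rewrite ?subrK ?addrK. Qed.

Lemma lat0_opp x : (G `\ 0) (- x) <-> (G `\ 0) x.
Proof.
split=> -[Gx x0]; split.
- by rewrite -[x]opprK; exact: subgroupN.
- by move=> /= xE; apply: x0; rewrite /= xE oppr0.
- exact: subgroupN.
- by move=> /= /eqP; rewrite oppr_eq0 => /eqP.
Qed.

(** With [p] and [q] the inverse moduli, [p * q * (p + q)] is at most
    [p ^+ 3 + q ^+ 3]. *)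
Lemma sqr_inv_diff (x y : R[i]) : x != 0 -> y != 0 ->
  cabs (y ^- 2 - x ^- 2) <=
    2 * cabs (x - y) * (cabs (x ^- 3) + cabs (y ^- 3)).
Proof.
move=> x0 y0.
have -> : y ^- 2 - x ^- 2 = (x - y) * (x^-1 * y^-1 * (x^-1 + y^-1)).
  by field; rewrite x0 y0.
rewrite cabsM (mulrC 2) -[leRHS]mulrA; apply: ler_wpM2l; first exact: cabs_ge0.
rewrite 2!cabsM !cabs_powV !cabsV -!exprVn.
have := cabsD x^-1 y^-1; rewrite !cabsV.
have : 0 <= (cabs x)^-1 by rewrite invr_ge0 cabs_ge0.
have : 0 <= (cabs y)^-1 by rewrite invr_ge0 cabs_ge0.
set p := (cabs x)^-1; set q := (cabs y)^-1 => q0 p0 h.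
apply: (@le_trans _ _ (p * q * (p + q))); first by rewrite ler_wpM2l ?mulr_ge0.
have : 0 <= (p + q) * (p - q) ^+ 2 by rewrite mulr_ge0 ?sqr_ge0 ?addr_ge0.
have := exprn_ge0 3 p0; have := exprn_ge0 3 q0.
lra.
Qed.

Lemma wp_summable z : ~ G z ->
  abs_summable (G `\ 0) (fun u => (z - u) ^- 2 - u ^- 2).
Proof.
move=> Gz.
have S1 : abs_summable (G `\ 0) (fun u => u ^- 3) by have [] := thin_lat0 ab.
have S2 : abs_summable (G `\ 0) (fun u => (z - u) ^- 3).
  apply: (@abs_summable_sub _ G); first by move=> x [].
  have [S _] := thin_translate ab Gz.
  apply: (abs_summable_bij (bij_sub z) _ S) => x /=; rewrite /translate/=.
  have -> : z - x - z = - x by ring.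
  split=> [h|]; last exact: subgroupN.
  by rewrite -[x]opprK; exact: subgroupN.
have k0 : 0 <= 2 * cabs z by rewrite mulr_ge0 ?cabs_ge0.
apply: (abs_summable_le2 k0 _ S1 S2) => u [Gu /eqP u0].
have uz : u - z != 0.
  by rewrite subr_eq0; apply: contra_notN Gz => /eqP <-.
have := sqr_inv_diff u0 uz.
have -> : u - (u - z) = z by ring.
have -> : (u - z) ^- 2 = (z - u) ^- 2 by rewrite -sqrrN opprB.
by rewrite !cabs_powV cabsB.
Qed.

Lemma wp_even z : ~ G z -> wp (- z) G = wp z G.
Proof.
move=> Gz; rewrite !wpE sqrrN; congr (_ + _).
apply: has_set_sumE.
have := has_set_sum_bij bij_opp lat0_opp (abs_summableP (wp_summable Gz)).
apply: eq_has_set_sum => u _ /=.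
by rewrite opprK sqrrN -(sqrrN (z + u)) opprD.
Qed.

Lemma translate_memN z x : translate z G x <-> G (z - x).
Proof.
rewrite /translate/=; split=> h; first by rewrite -opprB; exact: subgroupN.
by rewrite -opprB; exact: subgroupN.
Qed.

(** Differences of [wp] lose the correction terms [u ^- 2], so that they only
    depend on the two cosets. *)
Lemma wp_shift z h : ~ G z -> ~ G (z + h) ->
  wp (z + h) G - wp z G = shift_diff (translate z G) h.
Proof.
move=> Gz Gzh; apply: esym; apply: has_set_sumE.
have H1 := abs_summableP (wp_summable Gz).
have H2 := abs_summableP (wp_summable Gzh).
have H3 := has_set_sumD H2 (has_set_sumZ (-1) H1).
have H4 := has_set_sum1 0 (fun u => (z + h - u) ^- 2 - (z - u) ^- 2).
have H5 : has_set_sum (G `\ 0) (fun u => (z + h - u) ^- 2 - (z - u) ^- 2)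
   (set_sum (G `\ 0) (fun u => (z + h - u) ^- 2 - u ^- 2) +
    -1 * set_sum (G `\ 0) (fun u => (z - u) ^- 2 - u ^- 2)).
  by apply: eq_has_set_sum H3 => u _; cbv beta; ring.
have D u : (G `\ 0) u -> ~ [set (0 : R[i])] u by case.
have := has_set_sum_bij (B := translate z G) (bij_sub z) _ (has_set_sumU D H5 H4).
rewrite !wpE !subr0 => H.
have E : (fun u => (z + h - u) ^- 2 - (z - u) ^- 2) \o (fun x => z - x) =
  (fun x => (x + h) ^- 2 - x ^- 2).
  by apply/funext => x /=; rewrite subKr (_ : z + h - (z - x) = x + h)//; ring.
rewrite E in H; set s := (X in has_set_sum _ _ X).
suff -> : s = set_sum (G `\ 0) (fun u => (z + h - u) ^- 2 - u ^- 2) +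
    -1 * set_sum (G `\ 0) (fun u => (z - u) ^- 2 - u ^- 2) + ((z + h) ^- 2 - z ^- 2).
  apply: H => x; split=> [[[]|]|/translate_memN].
  - by move=> h1 _; exact/translate_memN.
  - by move=> /= h1; apply/translate_memN; rewrite h1; exact: subgroup0.
  - by move=> h1; have [->|/eqP] := eqVneq (z - x) 0; [right|left].
by rewrite /s; ring.
Qed.

Lemma translate_period z v : G v -> translate (z + v) G = translate z G.
Proof.
move=> Gv; apply/seteqP; split=> x; rewrite /translate/=.
  by move=> h; have := subgroupD sG h Gv; rewrite (_ : x - (z + v) + v = x - z)//; ring.
by move=> h; have := subgroupB sG h Gv; rewrite (_ : x - z - v = x - (z + v))//; ring.
Qed.

(** The difference of two values of [wp] depends on the cosets of the arguments
    only, so adding a period changes all values by the same amount. *)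
Lemma wp_diff_period z z' v : G v -> ~ G z -> ~ G z' ->
  wp (z + v) G - wp z G = wp (z' + v) G - wp z' G.
Proof.
move=> Gv Gz Gz'.
have Gzv : ~ G (z + v) by move/(subgroupDr sG _ Gv).
have Gzv' : ~ G (z' + v) by move/(subgroupDr sG _ Gv).
have h1 := wp_shift Gz (h := z' - z); have h2 := wp_shift Gzv (h := z' - z).
have e1 : z + (z' - z) = z' by ring.
have e2 : z + v + (z' - z) = z' + v by ring.
rewrite e1 in h1; rewrite e2 (translate_period _ Gv) in h2.
have := h1 Gz'; rewrite -(h2 Gzv') => h.
have -> : wp (z + v) G - wp z G =
  (wp z' G - wp z G) - (wp (z' + v) G - wp (z + v) G) + (wp (z' + v) G - wp z' G) by ring.
by rewrite h subrr add0r.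
Qed.

(** At [- (v / 2)] the change is zero because [wp] is even. *)
Lemma half_period_wp v z : G v -> ~ G (v / 2) -> ~ G z -> wp (z + v) G = wp z G.
Proof.
move=> Gv Gv2 Gz; apply/eqP; rewrite -subr_eq0; apply/eqP.
have Gv2' : ~ G (- (v / 2)).
  by move=> h; apply: Gv2; rewrite -[v / 2]opprK; exact: subgroupN.
rewrite (wp_diff_period Gv Gz Gv2').
have -> : - (v / 2) + v = v / 2 by field.
by rewrite wp_even ?subrr.
Qed.

Lemma lat_coord_inj m n m' n' :
  m%:~R * a + n%:~R * b = m'%:~R * a + n'%:~R * b -> m = m' /\ n = n'.
Proof.
rewrite !lat_coordE => E.
have [h1 h2] := area_comb a b m%:~R n%:~R.
have [h1' h2'] := area_comb a b m'%:~R n'%:~R.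
rewrite E h1' in h1; rewrite E h2' in h2.
by move/(mulIf ab)/intr_inj: h1 => ->; move/(mulIf ab)/intr_inj: h2 => ->.
Qed.

Lemma half_in_lat m n : G ((m%:~R * a + n%:~R * b) / 2) -> exists m' n', m = 2 * m' /\ n = 2 * n'.
Proof.
move=> [m' [n' E]]; exists m', n'.
have : m%:~R * a + n%:~R * b = (2 * m')%:~R * a + (2 * n')%:~R * b.
  have -> : m%:~R * a + n%:~R * b = 2 * ((m%:~R * a + n%:~R * b) / 2) by field.
  by rewrite E !rmorphM/= -!mulrA -mulrDr.
by move/lat_coord_inj.
Qed.

(** A period in [2 G] is the sum of two periods outside [2 G]. *)
Lemma wp_period z v : G v -> ~ G z -> wp (z + v) G = wp z G.
Proof.
move=> Gv Gz.
have [Gv2|Gv2] := pselect (G (v / 2)); last exact: half_period_wp.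
have Ga : G a by exact: latl.
have Ga2 : ~ G (a / 2).
  have -> : a / 2 = (1%:~R * a + 0%:~R * b) / 2 by rewrite mul0r addr0 mul1r.
  by move/half_in_lat => [m [n [h _]]]; lia.
have Gva : ~ G ((v - a) / 2).
  move=> h; apply: Ga2; have := subgroupB sG Gv2 h.
  by rewrite (_ : v / 2 - (v - a) / 2 = a / 2)//; field.
have -> : z + v = z + a + (v - a) by ring.
rewrite half_period_wp//; last by move/(subgroupDr sG _ Ga).
- exact: half_period_wp.
- exact: subgroupB.
Qed.

End Weierstrass.

(** * Second-order expansions and continuity *)

Section Bounded.
Variable R : realType.
Implicit Types (f g F : R[i] -> R[i]) (z h : R[i]).

Definition bounded_near0 f := exists (C d : R), 0 < d /\
  forall h, h != 0 -> cabs h <= d -> cabs (f h) <= C.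

Lemma bounded_near0_cst k : bounded_near0 (fun=> k).
Proof. by exists (cabs k), 1; split. Qed.

Lemma bounded_near0_id : bounded_near0 id.
Proof. by exists 1, 1; split. Qed.

Lemma bounded_near0_pos f : bounded_near0 f -> exists (C d : R),
  [/\ 0 <= C, 0 < d & forall h, h != 0 -> cabs h <= d -> cabs (f h) <= C].
Proof.
move=> [C [d [d0 fC]]]; exists `|C|, d; split=> // h h0 hd.
by apply: le_trans (fC h h0 hd) (ler_norm _).
Qed.

Lemma bounded_near0D f g : bounded_near0 f -> bounded_near0 g ->
  bounded_near0 (fun h => f h + g h).
Proof.
move=> [C [d [d0 fC]]] [D [e [e0 gD]]]; exists (C + D), (Num.min d e).
split=> [|h h0]; first by rewrite lt_min d0.
rewrite le_min => /andP[hd he]; apply: le_trans (cabsD _ _) _.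
by apply: lerD; [exact: fC|exact: gD].
Qed.

Lemma bounded_near0M f g : bounded_near0 f -> bounded_near0 g ->
  bounded_near0 (fun h => f h * g h).
Proof.
move=> [C [d [d0 fC]]] [D [e [e0 gD]]]; exists (C * D), (Num.min d e).
split=> [|h h0]; first by rewrite lt_min d0.
rewrite le_min => /andP[hd he]; rewrite cabsM.
by apply: ler_pM; rewrite ?cabs_ge0 ?fC ?gD.
Qed.

Lemma bounded_near0N f : bounded_near0 f -> bounded_near0 (fun h => - f h).
Proof. by move=> [C [d [d0 fC]]]; exists C, d; split=> // h h0 /(fC h h0); rewrite cabsN. Qed.

Lemma bounded_near0X f n : bounded_near0 f -> bounded_near0 (fun h => f h ^+ n).
Proof.
move=> [C [d [d0 fC]]]; exists (C ^+ n), d; split=> // h h0 /(fC h h0) fh.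
rewrite cabsX lerXn2r ?nnegrE ?cabs_ge0//; apply: le_trans fh; exact: cabs_ge0.
Qed.

Lemma eq_bounded_near0 f g d : 0 < d -> 
  (forall h, h != 0 -> cabs h <= d -> f h = g h) -> bounded_near0 f -> bounded_near0 g.
Proof.
move=> d0 fg [C [e [e0 fC]]]; exists C, (Num.min d e).
split=> [|h h0]; first by rewrite lt_min d0.
by rewrite le_min => /andP[hd he]; rewrite -fg// fC.
Qed.

(** A second-order complex Taylor expansion at [z]: the form of holomorphy from
    which the maximum principle is derived. *)
Definition jet2 F z := exists b c,
  bounded_near0 (fun h => (F (z + h) - (F z + b * h + c * h ^+ 2)) / h ^+ 3).

Lemma jet2D F H z : jet2 F z -> jet2 H z -> jet2 (fun x => F x + H x) z.
Proof.
move=> [b [c Fb]] [b' [c' Hb]]; exists (b + b'), (c + c').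
apply: eq_bounded_near0 (ltr01) _ (bounded_near0D Fb Hb) => h h0 _.
by field; rewrite h0.
Qed.

Lemma jet2M F H z : jet2 F z -> jet2 H z -> jet2 (fun x => F x * H x) z.
Proof.
move=> [b [c Fb]] [b' [c' Hb]].
exists (F z * b' + b * H z), (F z * c' + b * b' + c * H z).
set r := fun h => _ in Fb; set s := fun h => _ in Hb.
pose k h := F z * s h + H z * r h + b * c' + c * b' + c * c' * h
  + (b * s h + b' * r h) * h + (c * s h + c' * r h) * h ^+ 2 + r h * s h * h ^+ 3.
have kb : bounded_near0 k.
  by rewrite /k; repeat first [ exact: Fb | exact: Hb | apply: bounded_near0D
    | apply: bounded_near0M | apply: bounded_near0X | exact: bounded_near0_id
    | exact: bounded_near0_cst ].
apply: eq_bounded_near0 (ltr01) _ kb => h h0 _; rewrite /k.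
have Fz : F (z + h) = F z + b * h + c * h ^+ 2 + r h * h ^+ 3.
  by rewrite /r divfK ?expf_neq0// [RHS]addrC subrK.
have Hz : H (z + h) = H z + b' * h + c' * h ^+ 2 + s h * h ^+ 3.
  by rewrite /s divfK ?expf_neq0// [RHS]addrC subrK.
by rewrite Fz Hz; field; rewrite h0.
Qed.

Lemma jet2_cst k z : jet2 (fun=> k) z.
Proof.
exists 0, 0; apply: eq_bounded_near0 (ltr01) _ (bounded_near0_cst 0) => h h0 _.
by field; rewrite h0.
Qed.

Lemma jet2_inv z : z != 0 -> jet2 (fun x => x^-1) z.
Proof.
move=> z0; exists (- z ^- 2), (z ^- 3).
have cz : 0 < cabs z by rewrite cabs_gt0.
have zb : bounded_near0 (fun h => (z + h)^-1).
  exists (2 * (cabs z)^-1), (cabs z / 2); split; first by lra.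
  by move=> h h0 hz; have := inv_pow_half_gap 1 z0 hz; rewrite !expr1.
apply: eq_bounded_near0 (_ : 0 < cabs z / 2) _
  (bounded_near0M zb (bounded_near0_cst (- z ^- 3))); first by lra.
move=> h h0 hz; have [zh _] := half_gap z0 hz.
by field; rewrite h0 zh z0.
Qed.

Lemma eq_jet2 F H z d : 0 < d -> F z = H z ->
  (forall h, h != 0 -> cabs h <= d -> F (z + h) = H (z + h)) -> jet2 F z -> jet2 H z.
Proof.
move=> d0 FHz FH [b [c Fb]]; exists b, c.
by apply: eq_bounded_near0 d0 _ Fb => h h0 hd; rewrite FHz FH.
Qed.

Definition rcontinuous_at (f : R[i] -> R) z := forall e, 0 < e -> exists d : R,
  0 < d /\ forall h, cabs h <= d -> `|f (z + h) - f z| <= e.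

Definition ccontinuous_at (f : R[i] -> R[i]) z := forall e, 0 < e -> exists d : R,
  0 < d /\ forall h, cabs h <= d -> cabs (f (z + h) - f z) <= e.

(** A Lipschitz bound at one point is the form in which continuity arises. *)
Lemma lipschitz_ccontinuous_at F z (C d : R) : 0 < d ->
  (forall h, h != 0 -> cabs h <= d -> cabs (F (z + h) - F z) <= C * cabs h) ->
  ccontinuous_at F z.
Proof.
move=> d0 FC e e0; have C1 : 0 < `|C| + 1 by have := normr_ge0 C; lra.
exists (Num.min d (e / (`|C| + 1))); split.
  by rewrite lt_min d0 divr_gt0.
move=> h; rewrite le_min => /andP[hd he].
have [->|h0] := eqVneq h 0; first by rewrite addr0 subrr cabs0 ltW.
apply: le_trans (FC h h0 hd) _.
move: he; rewrite ler_pdivlMr// => he.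
have := ler_norm C; have := cabs_ge0 h; nra.
Qed.

Lemma jet2_ccontinuous F z : jet2 F z -> ccontinuous_at F z.
Proof.
move=> [b [c Fb]]; set r := fun h => _ in Fb.
have kb : bounded_near0 (fun h => b + c * h + r h * h ^+ 2).
  by repeat first [ exact: Fb | apply: bounded_near0D
    | apply: bounded_near0M | apply: bounded_near0X | exact: bounded_near0_id
    | exact: bounded_near0_cst ].
have [C [d [d0 kC]]] := kb.
apply: (@lipschitz_ccontinuous_at _ _ C d) => // h h0 hd.
have -> : F (z + h) - F z = (b + c * h + r h * h ^+ 2) * h.
  by rewrite /r; field; rewrite h0.
by rewrite cabsM ler_wpM2r ?cabs_ge0// kC.
Qed.

Lemma continuous_at_cabs F z : ccontinuous_at F z -> rcontinuous_at (fun x => cabs (F x)) z.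
Proof.
move=> Fc e /Fc[d [d0 Fd]]; exists d; split=> // h /Fd; apply: le_trans.
rewrite ler_norml; have := cabsD (F (z + h) - F z) (F z).
have := cabsD (F z - F (z + h)) (F (z + h)).
rewrite !subrK (cabsB (F z)) => h1 h2; apply/andP; split; lra.
Qed.

Definition square (r : R) : set R[i] :=
  [set z | `|complex.Re z| <= r /\ `|complex.Im z| <= r].

(** A square is a product of two segments, hence compact. *)
Lemma square_max (f : R[i] -> R) (r : R) : 0 <= r ->
  (forall z, rcontinuous_at f z) ->
  exists z0, square r z0 /\ forall z, square r z -> f z <= f z0.
Proof.
move=> r0 fc; pose g (p : R * R) : R := f (p.1 +i* p.2).
pose A : set (R * R) := `[- r, r]%classic `*` `[- r, r]%classic.
have mA p : (p \in A) = (`|p.1| <= r) && (`|p.2| <= r).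
  rewrite !ler_norml; apply/idP/idP.
    by move=> /set_mem [] /=; rewrite !in_itv /= => -> ->.
  by move=> /andP[h1 h2]; apply/mem_set; split; rewrite /= in_itv.
have gc : continuous g.
  move=> [x y]; apply/cvgrPdist_le => e e0.
  have [d [d0 fd]] := fc (x +i* y) _ e0.
  have d20 : 0 < d / 2 by lra.
  exists (ball x (d / 2), ball y (d / 2)).
    by split; exact: nbhsx_ballx.
  move=> [x' y'] /= [xx yy]; rewrite /ball/= in xx yy.
  have -> : g (x', y') = f ((x +i* y) + ((x' - x) +i* (y' - y))).
    by rewrite /g/=; congr f; apply/eqP; rewrite eq_complex /= !subrKC !eqxx.
  rewrite distrC; apply: fd; apply: le_trans (cabs_le_ReIm _) _ => /=.
  by rewrite (distrC x') (distrC y'); lra.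
have [| | |p pA pM] := @compact_EVT_max _ R g A.
- exists (0, 0); apply/set_mem; rewrite mA /= normr0 r0//.
- by apply: compact_setX; exact: segment_compact.
- exact: continuous_subspaceT.
exists (p.1 +i* p.2); split; first by move: pA; rewrite mA => /andP[].
by move=> [x y] [/= zx zy]; apply: (pM (x, y)); rewrite mA /= zx.
Qed.

End Bounded.

(** * Maximum principle and Liouville theorem *)

Section MaximumPrinciple.
Variable R : realType.
Implicit Types (K : R[i] -> R[i]) (z h : R[i]).

(** The fourth roots of unity kill the linear and quadratic terms of a Taylor
    expansion. *)
Lemma four_point_mean K z : jet2 K z -> exists C d : R, [/\ 0 <= C, 0 < d &
  forall t : R, 0 < t -> t <= d ->
    4 * cabs (K z) - C * t ^+ 3 <=
      cabs (K (z + t%:C)) + cabs (K (z - t%:C)) +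
      cabs (K (z + 'i%C * t%:C)) + cabs (K (z - 'i%C * t%:C))].
Proof.
move=> [b [c Kb]]; have [C [d [C0 d0 KC]]] := bounded_near0_pos Kb.
exists (4 * C), d; split=> [||t t0 td] //; first by rewrite mulr_ge0.
set r := fun h => _ in Kb KC.
have KE h : h != 0 -> K (z + h) = K z + b * h + c * h ^+ 2 + r h * h ^+ 3.
  by move=> h0; rewrite /r; field; rewrite h0.
have ct : cabs (t%:C : R[i]) = t by rewrite cabsR gtr0_norm.
have ci : cabs ('i%C : R[i]) = 1 by rewrite /cabs /= expr0n add0r expr1n sqrtr1.
have bound h : cabs h = t -> h != 0 /\ cabs (r h * h ^+ 3) <= C * t ^+ 3.
  move=> ht; have h0 : h != 0 by rewrite -cabs_gt0 ht.
  split=> //; rewrite cabsM cabsX ht; apply: ler_wpM2r; first exact: exprn_ge0 (ltW t0).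
  by apply: KC; rewrite ?ht.
have [n1 b1] := bound _ ct.
have [|n2 b2] := bound (- t%:C); first by rewrite cabsN.
have [|n3 b3] := bound ('i%C * t%:C); first by rewrite cabsM ci mul1r.
have [|n4 b4] := bound (- ('i%C * t%:C)); first by rewrite cabsN cabsM ci mul1r.
set w1 := (X in cabs X <= _) in b1; set w2 := (X in cabs X <= _) in b2.
set w3 := (X in cabs X <= _) in b3; set w4 := (X in cabs X <= _) in b4.
have E : K (z + t%:C) + K (z - t%:C) + K (z + 'i%C * t%:C) + K (z - 'i%C * t%:C)
  = 4 * K z + (w1 + w2 + w3 + w4).
  rewrite !KE// -/w1 -/w2 -/w3 -/w4.
  have i2 : 'i%C ^+ 2 = -1 :> R[i] by exact: sqr_i.
  rewrite sqrrN sqrrN exprMn i2; ring.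
have := cabsD (K (z + t%:C) + K (z - t%:C)) (K (z + 'i%C * t%:C) + K (z - 'i%C * t%:C)).
have := cabsD (K (z + t%:C)) (K (z - t%:C)).
have := cabsD (K (z + 'i%C * t%:C)) (K (z - 'i%C * t%:C)).
rewrite [X in cabs X <= cabs (_ + _) + _]addrA E.
have := cabsD_sub (4 * K z) (w1 + w2 + w3 + w4); rewrite cabsM cabs_nat.
have := cabsDD (w1 + w2) w3 w4; have := cabsD w1 w2.
lra.
Qed.

Lemma ReD (x y : R[i]) : complex.Re (x + y) = complex.Re x + complex.Re y.
Proof. by case: x y => [? ?] [? ?]. Qed.
Lemma ImD (x y : R[i]) : complex.Im (x + y) = complex.Im x + complex.Im y.
Proof. by case: x y => [? ?] [? ?]. Qed.

(** The maximum of [|K| + e |z|^2] over the square is not attained at an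
    interior point where [K] has a Taylor expansion, by averaging over four
    points. *)
Lemma square_principle K (r e B : R) : 0 < r -> 0 < e -> 0 <= B ->
  (forall z, ccontinuous_at K z) ->
  (forall z, K z = 0 \/ jet2 K z) ->
  (forall z, square r z -> `|complex.Re z| = r \/ `|complex.Im z| = r -> cabs (K z) <= B) ->
  forall z, square r z -> cabs (K z) <= B + e * (2 * r ^+ 2).
Proof.
move=> r0 e0 B0 Kc Kj KB.
pose f z := cabs (K z) + e * cabs z ^+ 2.
have fc z : rcontinuous_at f z.
  move=> eps eps0; have eps20 : 0 < eps / 2 by lra.
  have [d [d0 Kd]] := continuous_at_cabs (Kc z) eps20.
  have D0 : 0 < e * (2 * cabs z + 1).
    by rewrite mulr_gt0//; have := cabs_ge0 z; lra.
  exists (Num.min d (Num.min 1 (eps / 2 / (e * (2 * cabs z + 1))))); split.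
    by rewrite !lt_min d0 ltr01 divr_gt0.
  move=> h; rewrite !le_min => /and3P[/Kd hd h1].
  rewrite ler_pdivlMr// => he.
  have s1 : `|e * cabs (z + h) ^+ 2 - e * cabs z ^+ 2| <= eps / 2.
    rewrite -mulrBr subr_sqr normrM (gtr0_norm e0) normrM.
    have a1 : `|cabs (z + h) - cabs z| <= cabs h.
      have := cabsD z h; have := cabsD (z + h) (- h); rewrite addrK cabsN.
      by rewrite ler_norml => ? ?; apply/andP; split; lra.
    have a2 : `|cabs (z + h) + cabs z| <= 2 * cabs z + 1.
      rewrite ger0_norm ?addr_ge0 ?cabs_ge0//; have := cabsD z h; lra.
    apply: le_trans he; rewrite [leRHS]mulrCA; apply: ler_wpM2l; first exact: ltW.
    by apply: ler_pM.
  apply: le_trans (_ : eps / 2 + eps / 2 <= eps); last lra.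
  rewrite /f opprD addrACA; apply: le_trans (ler_normD _ _) _; exact: lerD.
have [z1 [z1S z1M]] := square_max (ltW r0) fc.
have sqr_bound z : square r z -> cabs z ^+ 2 <= 2 * r ^+ 2.
  move=> [h1 h2]; rewrite sqr_cabs -(real_normK (num_real (complex.Re z))) -(real_normK (num_real (complex.Im z))).
  have := ler_pM (normr_ge0 _) (normr_ge0 _) h1 h1; have := ler_pM (normr_ge0 _) (normr_ge0 _) h2 h2.
  rewrite -!expr2; lra.
suff : cabs (K z1) <= B.
  move=> hB z zS; have := z1M z zS; rewrite /f.
  have : 0 <= e * cabs z ^+ 2 by rewrite mulr_ge0 ?exprn_ge0 ?cabs_ge0 ?ltW.
  have : e * cabs z1 ^+ 2 <= e * (2 * r ^+ 2) by rewrite ler_pM2l// sqr_bound.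
  lra.
have [->|Kj1] := Kj z1; first by rewrite cabs0.
have [z1re|z1re] := eqVneq (`|complex.Re z1|) r; first by apply: KB => //; left.
have [z1im|z1im] := eqVneq (`|complex.Im z1|) r; first by apply: KB => //; right.
exfalso; have [C [d [C0 d0 Kd]]] := four_point_mean Kj1.
have [s1 s2] := z1S.
have g1 : 0 < r - `|complex.Re z1| by rewrite subr_gt0 lt_def eq_sym z1re.
have g2 : 0 < r - `|complex.Im z1| by rewrite subr_gt0 lt_def eq_sym z1im.
pose t := Num.min d (Num.min (r - `|complex.Re z1|) (Num.min (r - `|complex.Im z1|) (2 * e / (C + 1)))).
have t0 : 0 < t by rewrite /t !lt_min d0 g1 g2 divr_gt0 ?mulr_gt0//; lra.
have : t <= t by []. rewrite {2}/t !le_min => /and4P[td t1 t2].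
rewrite ler_pdivlMr; last by lra.
move=> te; have K4 := Kd t t0 td.
have tn : `|t| = t by rewrite gtr0_norm.
have S (x y : R) : `|x| <= t -> `|y| <= t -> square r (z1 + (x +i* y)).
  by move=> hx hy; split; rewrite ?ReD ?ImD /=; apply: le_trans (ler_normD _ _) _; lra.
have e1 : t%:C = t +i* 0 :> R[i] by [].
have e2 : - t%:C = (- t) +i* 0 :> R[i] by rewrite e1; apply/eqP; rewrite eq_complex /= oppr0 !eqxx.
have e3 : 'i%C * t%:C = 0 +i* t :> R[i] by apply/eqP; rewrite eq_complex /=; apply/andP; split; apply/eqP; ring.
have e4 : - ('i%C * t%:C) = 0 +i* (- t) :> R[i] by rewrite e3; apply/eqP; rewrite eq_complex /= oppr0 !eqxx.
have n0 : `|0 : R| <= t by rewrite normr0 ltW.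
have M1 := z1M _ (S t 0 _ n0); have M2 := z1M _ (S (- t) 0 _ n0).
have M3 := z1M _ (S 0 t n0 _); have M4 := z1M _ (S 0 (- t) n0 _).
rewrite -e1 in M1; rewrite -e2 in M2; rewrite -e3 in M3; rewrite -e4 in M4.
rewrite /f in M1 M2 M3 M4.
have Q : cabs (z1 + t%:C) ^+ 2 + cabs (z1 - t%:C) ^+ 2 + cabs (z1 + 'i%C * t%:C) ^+ 2
   + cabs (z1 - 'i%C * t%:C) ^+ 2 = 4 * cabs z1 ^+ 2 + 4 * t ^+ 2.
  by rewrite e4 e3 e2 e1 !sqr_cabs !ReD !ImD /=; ring.
rewrite normrN tn in M1 M2 M3 M4.
have {}M1 := M1 (lexx _); have {}M2 := M2 (lexx _); have {}M3 := M3 (lexx _); have {}M4 := M4 (lexx _).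
have : e * (cabs (z1 + t%:C) ^+ 2 + cabs (z1 - t%:C) ^+ 2 + cabs (z1 + 'i%C * t%:C) ^+ 2
   + cabs (z1 - 'i%C * t%:C) ^+ 2) = e * (4 * cabs z1 ^+ 2 + 4 * t ^+ 2) by rewrite Q.
rewrite !mulrDr => Q'.
have T3 : t ^+ 3 = t * t ^+ 2 by rewrite exprS.
have t20 : 0 < t ^+ 2 by rewrite exprn_gt0.
have : C * t ^+ 3 <= 2 * e * t ^+ 2.
  by rewrite T3 mulrA ler_pM2r//; nra.
have : 0 < e * t ^+ 2 by rewrite mulr_gt0.
lra.
Qed.

End MaximumPrinciple.

Section Liouville.
Variable R : realType.
Variables a b : R[i].
Hypothesis ab : area a b != 0.
Local Notation G := (lat a b).
Let sG : subgroup G := lat_subgroup a b.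

Lemma lat_cover z : exists u, G u /\ cabs (z - u) <= cabs a + cabs b.
Proof.
set s := area z b / area a b; set t := area a z / area a b.
exists ((Num.floor s)%:~R * a + (Num.floor t)%:~R * b); split.
  by exists (Num.floor s), (Num.floor t).
rewrite {1}(coordE z ab) lat_coordE -/s -/t.
have -> : s%:C * a + t%:C * b - ((Num.floor s)%:~R%:C * a + (Num.floor t)%:~R%:C * b)
  = (s - (Num.floor s)%:~R)%:C * a + (t - (Num.floor t)%:~R)%:C * b.
  by rewrite !rmorphB/=; ring.
have H (x : R) : `|x - (Num.floor x)%:~R| <= 1.
  have /andP[h1 h2] := floor_itv x; rewrite rmorphD/= in h2.
  by rewrite ger0_norm; lra.
apply: le_trans (cabsD _ _) _; rewrite !cabsM !cabsR.
by apply: lerD; rewrite ler_piMl ?cabs_ge0.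
Qed.

(** Liouville's theorem. If [M] bounds [F], then [F z ^+ 2 / z] is at most
    [M ^+ 2 / r] on the boundary of the square of half-side [r], and it tends to
    [0] at every lattice point, the origin included because of the square. The
    maximum principle bounds it inside, and [r] is arbitrary. *)
Lemma elliptic_eq0 (F : R[i] -> R[i]) :
  (forall z u, G u -> F (z + u) = F z) ->
  (forall z, G z -> F z = 0) ->
  (forall z, ~ G z -> jet2 F z) ->
  bounded_near0 (fun h => F h / h) ->
  forall z, F z = 0.
Proof.
move=> Fper F0 Fj /bounded_near0_pos[C [d [C0 d0 FC]]].
have FG u : G u -> forall h, h != 0 -> cabs h <= d -> cabs (F (u + h)) <= C * cabs h.
  move=> Gu h h0 hd; rewrite addrC Fper//; have := FC h h0 hd.
  by rewrite cabsM cabsV ler_pdivrMr ?cabs_gt0.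
have Fc z : ccontinuous_at F z.
  have [Gz|Gz] := pselect (G z); last exact: jet2_ccontinuous (Fj z Gz).
  apply: (@lipschitz_ccontinuous_at _ _ _ C d) => // h h0 hd.
  by rewrite (F0 z)// subr0 FG.
have [M FM] : exists M : R, forall z, cabs (F z) <= M.
  have r0 : 0 <= cabs a + cabs b by rewrite addr_ge0 ?cabs_ge0.
  have [z0 [_ z0M]] := square_max r0 (fun z => continuous_at_cabs (Fc z)).
  exists (cabs (F z0)) => z; have [u [Gu zu]] := lat_cover z.
  have -> : F z = F (z - u) by rewrite Fper//; exact: subgroupN.
  by apply: z0M; split; apply: le_trans zu; [exact: Re_le_cabs|exact: Im_le_cabs].
have M0 : 0 <= M by apply: le_trans (FM 0); exact: cabs_ge0.
pose K z := if z == 0 then 0 else F z ^+ 2 / z.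
have KG z : G z -> K z = 0.
  by move=> Gz; rewrite /K; case: ifP => // _; rewrite F0// expr0n mul0r.
have Kj z : ~ G z -> jet2 K z.
  move=> Gz; have z0 : z != 0 by apply: contra_notN Gz => /eqP->; exact: subgroup0 sG.
  have cz : 0 < cabs z by rewrite cabs_gt0.
  apply: (@eq_jet2 _ (fun x => F x * F x * x^-1) _ _ (cabs z / 2)); first by lra.
  - by rewrite /K (negbTE z0) expr2.
  - move=> h h0 hz; have [zh _] := half_gap z0 hz.
    by rewrite /K (negbTE zh) expr2.
  - by apply: jet2M; [apply: jet2M; exact: Fj|exact: jet2_inv].
have Kc z : ccontinuous_at K z.
  have [Gz|Gz] := pselect (G z); last exact: jet2_ccontinuous (Kj z Gz).
  have [z0|z0] := eqVneq z 0.
    apply: (@lipschitz_ccontinuous_at _ _ _ (C ^+ 2) d) => // h h0 hd.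
    rewrite (KG z)// subr0 /K z0 add0r (negbTE h0) cabsM cabsX cabsV.
    rewrite ler_pdivrMr ?cabs_gt0// -mulrA -expr2 -exprMn.
    rewrite lerXn2r ?nnegrE ?cabs_ge0 ?mulr_ge0 ?cabs_ge0//.
    by have := FG _ (subgroup0 sG) h h0 hd; rewrite add0r.
  have cz : 0 < cabs z by rewrite cabs_gt0.
  apply: (@lipschitz_ccontinuous_at _ _ _ (M * C * (2 * (cabs z)^-1)) (Num.min d (cabs z / 2))).
    by rewrite lt_min d0; lra.
  move=> h h0; rewrite le_min => /andP[hd hz]; have [zh _] := half_gap z0 hz.
  rewrite (KG z)// subr0 /K (negbTE zh) cabsM cabsX expr2.
  rewrite [leRHS](_ : _ = M * (C * cabs h) * (2 * (cabs z)^-1)); last by ring.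
  apply: ler_pM; rewrite ?cabs_ge0 ?mulr_ge0 ?cabs_ge0//.
    by apply: ler_pM; rewrite ?cabs_ge0 ?FM ?FG.
  by have := inv_pow_half_gap 1 z0 hz; rewrite !expr1.
have KB r z : 0 < r -> square r z -> cabs (K z) <= (M ^+ 2 + 2) / r.
  move=> r0 zS; have e0 : 0 < r ^- 3 by rewrite invr_gt0 exprn_gt0.
  rewrite (_ : (M ^+ 2 + 2) / r = M ^+ 2 / r + r ^- 3 * (2 * r ^+ 2)); last first.
    by field; rewrite gt_eqF.
  have B0 : 0 <= M ^+ 2 / r by apply: divr_ge0; [exact: exprn_ge0|exact: ltW].
  apply: (square_principle r0 e0 B0 Kc _ _ zS).
    by move=> x; have [/KG|/Kj] := pselect (G x); [left|right].
  move=> x _ xr; have rx : r <= cabs x.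
    by case: xr => <-; [exact: Re_le_cabs|exact: Im_le_cabs].
  have cx : 0 < cabs x by apply: lt_le_trans rx.
  rewrite /K -cabs_eq0 gt_eqF// cabsM cabsX cabsV.
  apply: ler_pM; rewrite ?exprn_ge0 ?invr_ge0 ?cabs_ge0//.
    by rewrite lerXn2r ?nnegrE ?cabs_ge0.
  by rewrite lef_pV2 ?posrE.
move=> z; have [->|z0] := eqVneq z 0; first by apply: F0; exact: subgroup0 sG.
suff : K z = 0.
  rewrite /K (negbTE z0) => /eqP; rewrite mulf_eq0 invr_eq0 (negbTE z0) orbF.
  by rewrite expf_eq0/= => /eqP.
apply/eqP; rewrite -cabs_eq0; apply/negPn/negP => Kz.
have Kz0 : 0 < cabs (K z) by rewrite lt_def Kz cabs_ge0.
pose r := cabs z + (M ^+ 2 + 2) / cabs (K z) + 1.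
have P : 0 < M ^+ 2 + 2 by have := exprn_ge0 2 M0; lra.
have Q : 0 < (M ^+ 2 + 2) / cabs (K z) by rewrite divr_gt0.
have cz := cabs_ge0 z.
have r0 : 0 < r by rewrite /r; lra.
have := KB r z r0; rewrite ler_pdivlMr// => H.
have : cabs (K z) * r <= M ^+ 2 + 2.
  by apply: H; split; [apply: le_trans (Re_le_cabs z) _|apply: le_trans (Im_le_cabs z) _]; rewrite /r; lra.
rewrite mulrC -ler_pdivlMr// /r; lra.
Qed.

End Liouville.

(** * Differential equations of the Weierstrass function *)

Section EllipticIdentities.
Variable R : realType.
Variables a b : R[i].
Hypothesis ab : area a b != 0.
Local Notation G := (lat a b).
Local Notation T := (@power_sum R).
Implicit Types z h u v w : R[i].
Let sG : subgroup G := lat_subgroup a b.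
Local Notation G4 := (T 4 (G `\ 0)).
Local Notation G6 := (T 6 (G `\ 0)).
Local Notation p z := (wp z G).
Local Notation p3 z := (T 3 (translate z G)).
Local Notation p4 z := (T 4 (translate z G)).

Ltac bounded := lazymatch goal with
  | |- bounded_near0 (fun _ => ?k) => exact: bounded_near0_cst
  | |- bounded_near0 (fun h => h) => exact: bounded_near0_id
  | |- bounded_near0 (fun h => @?f h + @?g h) =>
      apply: (@bounded_near0D _ f g); bounded
  | |- bounded_near0 (fun h => @?f h * @?g h) =>
      apply: (@bounded_near0M _ f g); bounded
  | |- bounded_near0 (fun h => - @?f h) =>
      apply: (@bounded_near0N _ f); bounded
  | |- bounded_near0 (fun h => @?f h ^+ ?n) =>
      apply: (@bounded_near0X _ f n); bounded
  | |- _ => assumption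
  end.

Lemma bounded_quotient (f : R[i] -> R[i]) (C d : R) n : 0 < d ->
  (forall h, h != 0 -> cabs h <= d -> cabs (f h) <= C * cabs h ^+ n) ->
  bounded_near0 (fun h => f h / h ^+ n).
Proof.
move=> d0 fC; exists C, d; split=> // h h0 hd.
by rewrite cabsM cabs_powV ler_pdivrMr ?exprn_gt0 ?cabs_gt0 ?fC.
Qed.

Lemma power_sum_translate k z h : ~ G (z + h) ->
  T (k + 3) (translate (z + h) G) = shift_sum (k + 3) (translate z G) h.
Proof.
move=> Gzh; apply: esym; apply: has_set_sumE.
apply: (has_set_sum_bij (bij_addr h) _ (has_power_sum k (thin_translate ab Gzh))).
by move=> x; rewrite /translate /= (_ : x + h - (z + h) = x - z)//; ring.
Qed.

Lemma near_notin z : ~ G z -> exists d : R, 0 < d /\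
  forall h, cabs h <= d -> ~ G (z + h).
Proof.
move=> Gz; have [d [d0 dP]] := translate_gap ab Gz.
exists (d / 2); split=> [|h hd Gzh]; first by lra.
have := dP _ (subgroupN sG Gzh); rewrite opprD addrA subrr sub0r cabsN; lra.
Qed.

Lemma near0_notin : exists d : R, 0 < d /\
  forall h, h != 0 -> cabs h <= d -> ~ G h.
Proof.
have [d [d0 dP]] := lat0_gap ab.
exists (d / 2); split=> [|h h0 hd Gh]; first by lra.
by have := dP h (conj Gh (elimN eqP h0)); lra.
Qed.

(** Remainders of the Taylor expansions, divided by the power of [h] that they
    are comparable to. *)
Definition wp_rem z h : R[i] := (p (z + h) - (p z - 2 * h * p3 z
  + 3 * h ^+ 2 * p4 z - 4 * h ^+ 3 * T 5 (translate z G) + 5 * h ^+ 4 * T 6 (translate z G))) / h ^+ 5.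
Definition p3_rem z h : R[i] := (p3 (z + h) - (p3 z - 3 * h * p4 z
  + 6 * h ^+ 2 * T 5 (translate z G) - 10 * h ^+ 3 * T 6 (translate z G))) / h ^+ 4.
Definition p4_rem z h : R[i] := (p4 (z + h) - (p4 z - 4 * h * T 5 (translate z G)
  + 10 * h ^+ 2 * T 6 (translate z G))) / h ^+ 3.

Lemma taylor_regular z : ~ G z -> [/\ bounded_near0 (wp_rem z),
  bounded_near0 (p3_rem z) & bounded_near0 (p4_rem z)].
Proof.
move=> Gz; have [d [d0 dP]] := near_notin Gz.
have [C [e [C0 e0 _ eP]]] := taylor_sums (thin_translate ab Gz).
have m0 : 0 < Num.min d e by rewrite lt_min d0.
split; apply: (bounded_quotient (C := C) m0) => h h0; rewrite le_min => /andP[/dP Gzh /eP[h1 h2 h3]].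
- have -> : p (z + h) = p z + shift_diff (translate z G) h.
    by rewrite -wp_shift// [RHS]addrC subrK.
  apply: le_trans h1; rewrite le_eqVlt; apply/orP; left; apply/eqP; congr cabs; ring.
- by rewrite (@power_sum_translate 0).
- by rewrite (@power_sum_translate 1).
Qed.

Lemma remE (x y k : R[i]) : k != 0 -> x = y + k * ((x - y) / k).
Proof. by move=> k0; field. Qed.

Lemma wp_remE z h : h != 0 -> p (z + h) = p z - 2 * h * p3 z
  + 3 * h ^+ 2 * p4 z - 4 * h ^+ 3 * T 5 (translate z G) + 5 * h ^+ 4 * T 6 (translate z G)
  + h ^+ 5 * wp_rem z h.
Proof. by move=> h0; apply: remE; rewrite expf_neq0. Qed.
Lemma p3_remE z h : h != 0 -> p3 (z + h) = p3 z - 3 * h * p4 z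
  + 6 * h ^+ 2 * T 5 (translate z G) - 10 * h ^+ 3 * T 6 (translate z G)
  + h ^+ 4 * p3_rem z h.
Proof. by move=> h0; apply: remE; rewrite expf_neq0. Qed.
Lemma p4_remE z h : h != 0 -> p4 (z + h) = p4 z - 4 * h * T 5 (translate z G)
  + 10 * h ^+ 2 * T 6 (translate z G) + h ^+ 3 * p4_rem z h.
Proof. by move=> h0; apply: remE; rewrite expf_neq0. Qed.

(** The terms at [x] and [- x] cancel. *)
Lemma power_sum_odd k (A : set R[i]) : thin A -> (forall x, A (- x) <-> A x) ->
  odd (k + 3) -> T (k + 3) A = 0.
Proof.
move=> tA sA ok; have hA := has_power_sum k tA.
have h1 := has_set_sum_bij (@bij_opp R) sA hA.
have h2 : has_set_sum A (fun x => x ^- (k + 3)) (-1 * T (k + 3) A).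
  apply: eq_has_set_sum (has_set_sumZ (-1) h1) => x _ /=.
  by rewrite exprNn -signr_odd ok expr1 !mulN1r invrN opprK.
have := has_sum_unique hA h2; rewrite mulN1r => /eqP.
by rewrite -subr_eq0 opprK -mulr2n -mulr_natl mulf_eq0 pnatr_eq0 => /eqP.
Qed.

(** The same at the origin, where the expansions are Laurent expansions. *)
Definition wp_rem0 h : R[i] := (p h - (h ^- 2 + 3 * h ^+ 2 * G4 + 5 * h ^+ 4 * G6)) / h ^+ 5.
Definition p3_rem0 h : R[i] := (p3 h - (h ^- 3 - 3 * h * G4 - 10 * h ^+ 3 * G6)) / h ^+ 4.
Definition p4_rem0 h : R[i] := (p4 h - (h ^- 4 + G4 + 10 * h ^+ 2 * G6)) / h ^+ 3.

Lemma shift_sum_lat0 k h : ~ G h ->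
  T (k + 3) (translate h G) = h ^- (k + 3) + shift_sum (k + 3) (G `\ 0) h.
Proof.
move=> Gh; have tA := thin_translate ab Gh.
have H1 : has_set_sum [set h] (fun x => x ^- (k + 3)) (h ^- (k + 3)).
  exact: has_set_sum1.
have S2 : abs_summable (G `\ 0) (fun x => (x + h) ^- (k + 3)).
  apply: (@abs_summable_sub _ G); first by move=> x [].
  apply: (abs_summable_bij (bij_addr h) _ (thin_pow k tA)) => x.
  by rewrite /translate/= addrK.
have H2 : has_set_sum (translate h (G `\ 0)) (fun x => x ^- (k + 3)) (shift_sum (k + 3) (G `\ 0) h).
  have Bij : bijective (fun x => x - h) by exists (fun x => x + h) => x; rewrite ?subrK ?addrK.
  have := has_set_sum_bij (B := translate h (G `\ 0)) Bij (fun x => iff_refl _) (abs_summableP S2).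
  by apply: eq_has_set_sum => x _ /=; rewrite subrK.
apply: has_set_sumE; have D x : [set h] x -> ~ translate h (G `\ 0) x.
  by move=> /= ->; rewrite /translate /= subrr => -[].
have := has_set_sumU D H1 H2.
suff -> : [set h] `|` translate h (G `\ 0) = translate h G by [].
apply/seteqP; split=> x /=; rewrite /translate/=.
  by case=> [->|[]//]; rewrite subrr; exact: subgroup0 sG.
move=> Gx; have [/eqP|xh] := eqVneq (x - h) 0; first by rewrite subr_eq0 => /eqP; left.
by right; split=> //; apply/eqP.
Qed.

Lemma wp_lat0 h : ~ G h -> p h = h ^- 2 + shift_diff (G `\ 0) h.
Proof.
move=> Gh; rewrite wpE; congr (_ + _); apply: has_set_sumE.
have := has_set_sum_bij (@bij_opp R) (@lat0_opp R a b) (abs_summableP (wp_summable ab Gh)).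
have E : (fun u => (h - u) ^- 2 - u ^- 2) \o -%R = (fun x => (x + h) ^- 2 - x ^- 2).
  by apply/funext => x /=; rewrite opprK sqrrN (addrC h).
rewrite E => /has_set_sumE H; rewrite /shift_diff H.
exact: abs_summableP (wp_summable ab Gh).
Qed.

Lemma taylor_origin : [/\ bounded_near0 wp_rem0,
  bounded_near0 p3_rem0 & bounded_near0 p4_rem0].
Proof.
have [d [d0 dP]] := near0_notin.
have tA := thin_lat0 ab.
have [C [e [C0 e0 _ eP]]] := taylor_sums tA.
have m0 : 0 < Num.min d e by rewrite lt_min d0.
have T3 : T 3 (G `\ 0) = 0 by apply: (@power_sum_odd 0) => //; exact: lat0_opp.
have T5 : T 5 (G `\ 0) = 0 by apply: (@power_sum_odd 2) => //; exact: lat0_opp.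
split; apply: (bounded_quotient (C := C) m0) => h h0; rewrite le_min => /andP[/(dP h h0) Gh /eP[]];
  rewrite T3 T5 !mulr0 => h1 h2 h3.
- rewrite wp_lat0//.
  apply: le_trans h1; rewrite le_eqVlt; apply/orP; left; apply/eqP; congr cabs; ring.
- rewrite (@shift_sum_lat0 0)//.
  apply: le_trans h2; rewrite le_eqVlt; apply/orP; left; apply/eqP; congr cabs; ring.
- rewrite (@shift_sum_lat0 1)//.
  apply: le_trans h3; rewrite le_eqVlt; apply/orP; left; apply/eqP; congr cabs; ring.
Qed.

Lemma wp_rem0E h : h != 0 -> p h = h ^- 2 + 3 * h ^+ 2 * G4 + 5 * h ^+ 4 * G6
  + h ^+ 5 * wp_rem0 h.
Proof. by move=> h0; apply: remE; rewrite expf_neq0. Qed.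
Lemma p3_rem0E h : h != 0 -> p3 h = h ^- 3 - 3 * h * G4 - 10 * h ^+ 3 * G6
  + h ^+ 4 * p3_rem0 h.
Proof. by move=> h0; apply: remE; rewrite expf_neq0. Qed.
Lemma p4_rem0E h : h != 0 -> p4 h = h ^- 4 + G4 + 10 * h ^+ 2 * G6 + h ^+ 3 * p4_rem0 h.
Proof. by move=> h0; apply: remE; rewrite expf_neq0. Qed.

Lemma jet2_wp z : ~ G z -> jet2 (fun x => p x) z.
Proof.
move=> /taylor_regular[pb _ _]; exists (- 2 * p3 z), (3 * p4 z).
set r := wp_rem z in pb.
apply: (eq_bounded_near0 ltr01 (f := fun h => - (4 * T 5 (translate z G))
  + 5 * T 6 (translate z G) * h + h ^+ 2 * r h)); last by bounded.
by move=> h h0 _; rewrite wp_remE// -/r; field; rewrite h0.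
Qed.

Lemma jet2_p3 z : ~ G z -> jet2 (fun x => p3 x) z.
Proof.
move=> /taylor_regular[_ pb _]; exists (- 3 * p4 z), (6 * T 5 (translate z G)).
set r := p3_rem z in pb.
apply: (eq_bounded_near0 ltr01 (f := fun h => - (10 * T 6 (translate z G)) + h * r h)); last by bounded.
by move=> h h0 _; rewrite p3_remE// -/r; field; rewrite h0.
Qed.

Lemma jet2_p4 z : ~ G z -> jet2 (fun x => p4 x) z.
Proof.
move=> /taylor_regular[_ _ pb]; exists (- 4 * T 5 (translate z G)), (10 * T 6 (translate z G)).
set r := p4_rem z in pb.
apply: (eq_bounded_near0 ltr01 (f := fun h => r h)); last by bounded.
by move=> h h0 _; rewrite p4_remE// -/r; field; rewrite h0.
Qed.

(** Only values off the lattice matter, so the function is redefined as [0] on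
    the lattice. *)
Lemma elliptic_vanish (F : R[i] -> R[i]) :
  (forall z u, G u -> ~ G z -> F (z + u) = F z) ->
  (forall z, ~ G z -> jet2 F z) -> bounded_near0 (fun h => F h / h) ->
  forall z, ~ G z -> F z = 0.
Proof.
move=> Fper Fj Fb z Gz; pose F' x := if `[< G x >] then 0 else F x.
have F'in x : G x -> F' x = 0 by move=> Gx; rewrite /F'; case: asboolP.
have F'out x : ~ G x -> F' x = F x by move=> Gx; rewrite /F'; case: asboolP.
rewrite -F'out//; apply: (elliptic_eq0 ab) => //.
- move=> x u Gu; have [Gx|Gx] := pselect (G x).
    by rewrite !F'in//; exact: subgroupD.
  by rewrite !F'out ?Fper//; move/(subgroupDr sG _ Gu).
- move=> x Gx; have [d [d0 dP]] := near_notin Gx.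
  apply: eq_jet2 d0 _ _ (Fj x Gx); first by rewrite F'out.
  by move=> h h0 /dP Gh; rewrite F'out.
- have [d [d0 dP]] := near0_notin.
  by apply: eq_bounded_near0 d0 _ Fb => h h0 /(dP h h0) Gh; rewrite F'out.
Qed.

(** This is [wp'' = 6 wp ^+ 2 - g2 / 2] in terms of lattice sums. The Laurent
    expansions at the origin cancel up to order one. *)
Lemma second_order_equation z : ~ G z -> p4 z = p z ^+ 2 - 5 * G4.
Proof.
move=> Gz; apply/eqP; rewrite -subr_eq0; apply/eqP.
pose F x := p4 x + ((-1) * (p x * p x) + 5 * G4).
rewrite (_ : _ - _ = F z); last by rewrite /F; ring.
apply: elliptic_vanish Gz => {z}.
- by move=> z u Gu Gz; rewrite /F translate_period// wp_period.
- move=> z Gz; apply: jet2D; first exact: jet2_p4.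
  apply: jet2D; last exact: jet2_cst.
  apply: jet2M; first exact: jet2_cst.
  by apply: jet2M; exact: jet2_wp.
have [pb _ qb] := taylor_origin.
set r := wp_rem0 in pb; set s := p4_rem0 in qb.
apply: (eq_bounded_near0 ltr01 (f := fun h => h ^+ 2 * s h + - (2 * (h ^+ 2 * r h))
  + - (h ^+ 3 * (3 * G4 + 5 * G6 * h ^+ 2 + h ^+ 3 * r h) ^+ 2))); last by bounded.
move=> h h0 _; rewrite /F wp_rem0E// p4_rem0E// -/r -/s.
by field; rewrite h0.
Qed.

(** This is [wp' ^+ 2 = 4 wp ^+ 3 - g2 wp - g3] in terms of lattice sums. *)
Lemma first_order_equation z : ~ G z ->
  p3 z ^+ 2 = p z ^+ 3 - 15 * G4 * p z - 35 * G6.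
Proof.
move=> Gz; apply/eqP; rewrite -subr_eq0; apply/eqP.
pose F x := p3 x * p3 x + ((-1) * (p x * (p x * p x)) + (15 * G4 * p x + 35 * G6)).
rewrite (_ : _ - _ = F z); last by rewrite /F; ring.
apply: elliptic_vanish Gz => {z}.
- by move=> z u Gu Gz; rewrite /F translate_period// wp_period.
- move=> z Gz; apply: jet2D; first by apply: jet2M; exact: jet2_p3.
  apply: jet2D.
    apply: jet2M; first exact: jet2_cst.
    by do 2! [apply: jet2M; first exact: jet2_wp]; exact: jet2_wp.
  apply: jet2D; last exact: jet2_cst.
  by apply: jet2M; [exact: jet2_cst|exact: jet2_wp].
have [pb qb _] := taylor_origin.
set r := wp_rem0 in pb; set s := p3_rem0 in qb.
pose Y h := 3 * G4 + 5 * G6 * h ^+ 2 + h ^+ 3 * r h.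
have Yb : bounded_near0 Y by rewrite /Y; bounded.
apply: (eq_bounded_near0 ltr01 (f := fun h => 2 * s h + h * (- (3 * G4) + - (10 * G6 * h ^+ 2)
   + h ^+ 3 * s h) ^+ 2 + - (3 * r h) + - (3 * (h * Y h ^+ 2)) + - (h ^+ 5 * Y h ^+ 3)
   + 15 * G4 * (h * Y h))); last by bounded.
move=> h h0 _; rewrite /F wp_rem0E// p3_rem0E// -/r -/s /Y.
by field; rewrite h0.
Qed.

Lemma translate_opp w : G (w + w) -> forall x, translate w G (- x) <-> translate w G x.
Proof.
move=> Gw x; rewrite translate_memN opprK.
have -> : w + x = (x - w) + (w + w) by ring.
exact: subgroupDr.
Qed.

Lemma bounded_mul_eq0 (f : R[i] -> R[i]) (k : R[i]) (d : R) : 0 < d -> bounded_near0 f ->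
  (forall h, h != 0 -> cabs h <= d -> k = h * f h) -> k = 0.
Proof.
move=> d0 /bounded_near0_pos[C [e [C0 e0 fC]]] kE.
apply/eqP; rewrite -cabs_eq0; apply/negPn/negP => k0.
have kp : 0 < cabs k by rewrite lt_def k0 cabs_ge0.
pose t := Num.min d (Num.min e (cabs k / (2 * (C + 1)))).
have t0 : 0 < t by rewrite !lt_min d0 e0 divr_gt0// mulr_gt0//; lra.
have : t <= t by []. rewrite {2}/t !le_min => /and3P[td te].
rewrite ler_pdivlMr; last by lra.
have tc : cabs (t%:C : R[i]) = t by rewrite cabsR gtr0_norm.
have tn : (t%:C : R[i]) != 0 by rewrite -cabs_gt0 tc.
have := kE _ tn; rewrite tc => /(_ td) ->; rewrite cabsM tc.
have := fC _ tn; rewrite tc => /(_ te) hf.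
nra.
Qed.

(** At a half period the odd Taylor coefficients vanish. The second identity is
    the next coefficient of [second_order_equation] at [w], and the third is
    [first_order_equation] there, where the derivative of [wp] vanishes. *)
Lemma half_period_identities w : ~ G w -> G (w + w) ->
  [/\ p4 w = p w ^+ 2 - 5 * G4,
      5 * T 6 (translate w G) = 3 * p w * p4 w &
      p w ^+ 3 = 15 * G4 * p w + 35 * G6].
Proof.
move=> Gw Gww; have tA := thin_translate ab Gw.
have sA := translate_opp Gww.
have T3 : T 3 (translate w G) = 0 by apply: (@power_sum_odd 0).
have T5 : T 5 (translate w G) = 0 by apply: (@power_sum_odd 2).
split; first exact: second_order_equation.
- have [pb _ qb] := taylor_regular Gw.
  have [d [d0 dP]] := near_notin Gw.
  set r := wp_rem w in pb; set s := p4_rem w in qb.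
  suff : 10 * T 6 (translate w G) - 6 * p w * p4 w = 0.
    move=> H; apply/eqP; rewrite -subr_eq0; apply/eqP.
    have -> : 5 * T 6 (translate w G) - 3 * p w * p4 w =
      2^-1 * (10 * T 6 (translate w G) - 6 * p w * p4 w) by field.
    by rewrite H mulr0.
  pose Y h := 3 * p4 w + 5 * T 6 (translate w G) * h ^+ 2 + h ^+ 3 * r h.
  pose f h := 2 * p w * (5 * T 6 (translate w G) * h + h ^+ 2 * r h) + h * Y h ^+ 2 + - s h.
  have fb : bounded_near0 f by rewrite /f /Y; bounded.
  apply: bounded_mul_eq0 d0 fb _ => h h0 /dP Gh.
  have E := second_order_equation Gh.
  rewrite wp_remE// p4_remE// T3 T5 -/r -/s (second_order_equation Gw) in E.
  have {}E : (10 * T 6 (translate w G) - 6 * p w * p4 w) * h ^+ 2 = h * f h * h ^+ 2.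
    rewrite /f /Y (second_order_equation Gw).
    move/eqP: E; rewrite -subr_eq0 => /eqP E.
    apply/eqP; rewrite -subr_eq0; apply/eqP; rewrite -[RHS]E; ring.
  exact: (mulIf (expf_neq0 2 h0) E).
- have := first_order_equation Gw; rewrite T3 expr0n/= => E.
  by move/eqP: E; rewrite eq_sym -addrA -opprD subr_eq0 => /eqP.
Qed.

End EllipticIdentities.

(** * Sublattices of index two *)

Section Sublattices.
Variable R : realType.
Local Notation T := (@power_sum R).
Implicit Types (a b z x : R[i]).

Lemma latC a b : lat a b = lat b a.
Proof.
by apply/seteqP; split=> x [m [n ->]]; exists n, m; rewrite addrC.
Qed.

Lemma latDl a b : lat (a + b) b = lat a b.
Proof.
apply/seteqP; split=> x [m [n ->]].
  by exists m, (m + n); rewrite rmorphD/=; ring.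
by exists m, (n - m); rewrite rmorphB/=; ring.
Qed.

Lemma areaC a b : area b a = - area a b.
Proof. by rewrite /area; ring. Qed.

Lemma areaDl a b : area (a + b) b = area a b.
Proof. by case: a b => [? ?] [? ?]; rewrite /area/=; ring. Qed.

Lemma area_half a b : area (a / 2) b = area a b / 2.
Proof.
have -> : a / 2 = (2^-1 : R)%:C * a by rewrite mulrC fmorphV/= rmorph_nat.
by case: a b => [? ?] [? ?]; rewrite /area/=; field.
Qed.

Lemma area_double a b : area a (2 * b) = 2 * area a b.
Proof.
have -> : 2 * b = (2 : R)%:C * b by rewrite rmorph_nat.
by case: a b => [? ?] [? ?]; rewrite /area/=; ring.
Qed.

Lemma half_not_in a b m n : area a b != 0 -> ~~ (2 %| m)%Z || ~~ (2 %| n)%Z ->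
  ~ lat a b ((m%:~R * a + n%:~R * b) / 2).
Proof.
move=> ab /orP mn /(half_in_lat ab)[m' [n' [mE nE]]].
by case: mn => /negP; apply; apply/dvdzP; [exists m'; rewrite mE mulrC|exists n'; rewrite nE mulrC].
Qed.

Lemma halfl_not_in a b : area a b != 0 -> ~ lat a b (a / 2).
Proof.
by move=> ab; have := @half_not_in a b 1 0 ab isT; rewrite mul0r addr0 mul1r.
Qed.

(** The first coordinate of a point of the finer lattice is even or odd. *)
Lemma half_latP a b x : lat (a / 2) b x <-> lat a b x \/ lat a b (x - a / 2).
Proof.
split=> [[m [n ->]]|[[m [n ->]]|[m [n E]]]].
- have mE := divz_eq m 2; set q := (m %/ 2)%Z in mE.
  have : (m %% 2)%Z = 0 \/ (m %% 2)%Z = 1 by lia.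
  case=> r; rewrite r in mE; [left|right]; exists q, n; rewrite mE ?addr0 ?rmorphD !rmorphM/=; by field.
- by exists (m * 2), n; rewrite rmorphM/=; field.
- exists (m * 2 + 1), n; rewrite -[x](subrK (a / 2)) E rmorphD rmorphM/=; by field.
Qed.

Section OneStep.
Variables a b : R[i].
Hypothesis ab : area a b != 0.
Local Notation G := (lat a b).
Local Notation G2 := (lat (a / 2) b).
Let sG : subgroup G := lat_subgroup a b.

Lemma area_half_neq0 : area (a / 2) b != 0.
Proof. by rewrite area_half mulf_neq0// invr_neq0// pnatr_eq0. Qed.

Lemma half_disjoint x : G x -> ~ G (x - a / 2).
Proof.
move=> Gx Gxa; apply: (halfl_not_in ab).
by have := subgroupB sG Gx Gxa; rewrite subKr.
Qed.

Lemma power_sum_half k : T (k + 3) (G2 `\ 0) =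
  T (k + 3) (G `\ 0) + T (k + 3) (translate (a / 2) G).
Proof.
have H1 := has_power_sum k (thin_lat0 ab).
have H2 := has_power_sum k (thin_translate ab (halfl_not_in ab)).
apply: has_set_sumE.
have D x : (G `\ 0) x -> ~ translate (a / 2) G x by case=> Gx _; exact: half_disjoint.
have := has_set_sumU D H1 H2; congr has_set_sum.
apply/seteqP; split=> x.
  case=> [[Gx x0]|Gx]; split=> //; first by apply/half_latP; left.
    by apply/half_latP; right.
  move=> /= x0; apply: (halfl_not_in ab); move: Gx; rewrite /translate/= x0 sub0r.
  by move=> /(subgroupN sG); rewrite opprK.
by case=> /half_latP[Gx|Gx] x0; [left|right].
Qed.

Lemma power_sum_half_translate k z : ~ G2 z -> T (k + 3) (translate z G2) =
  T (k + 3) (translate z G) + T (k + 3) (translate (z + a / 2) G).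
Proof.
move=> Gz.
have Gz1 : ~ G z by move=> h; apply: Gz; apply/half_latP; left.
have Gz2 : ~ G (z + a / 2).
  move=> h; apply: Gz; apply/half_latP; right.
  have := subgroupB sG h (latl a b); rewrite (_ : z + a / 2 - a = z - a / 2)//; by field.
apply: has_set_sumE.
have D x : translate z G x -> ~ translate (z + a / 2) G x.
  by rewrite /translate/= => /half_disjoint; rewrite (_ : x - z - a / 2 = x - (z + a / 2))//; ring.
have := has_set_sumU D (has_power_sum k (thin_translate ab Gz1)) (has_power_sum k (thin_translate ab Gz2)).
congr has_set_sum; apply/seteqP; split=> x; rewrite /translate/=.
  move=> h; apply/half_latP; case: h; first by left.
  by rewrite (_ : x - z - a / 2 = x - (z + a / 2)); [right|ring].
by move=> /half_latP; rewrite (_ : x - z - a / 2 = x - (z + a / 2))//; ring.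
Qed.

End OneStep.

Lemma power_sum_scale k a b (c : R[i]) : c != 0 -> area a b != 0 ->
  T (k + 3) (lat (c * a) (c * b) `\ 0) = c ^- (k + 3) * T (k + 3) (lat a b `\ 0).
Proof.
move=> c0 ab; apply: has_set_sumE.
have B : bijective (fun x => c^-1 * x).
  by exists (fun x => c * x) => x; rewrite ?mulVKf ?mulKf.
have Hm x : (lat a b `\ 0) (c^-1 * x) <-> (lat (c * a) (c * b) `\ 0) x.
  split=> -[[m [n E]] /eqP x0]; split.
  - by exists m, n; rewrite -[x](mulVKf c0) E; ring.
  - by apply/eqP; move: x0; rewrite mulf_eq0 negb_or => /andP[].
  - by exists m, n; rewrite E; field.
  - by apply/eqP; rewrite mulf_neq0// invr_neq0.
have := has_set_sumZ (c ^- (k + 3)) (has_set_sum_bij B Hm (has_power_sum k (thin_lat0 ab))).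
apply: eq_has_set_sum => x _ /=.
by rewrite exprMn exprVn invfM invrK mulrA mulVf ?mul1r// expf_neq0.
Qed.

Lemma g2E a b : area a b != 0 -> g2 (lat a b) = 60 * T 4 (lat a b `\ 0).
Proof.
move=> ab; apply: has_set_sumE; apply: has_set_sumZ.
exact: (has_power_sum 1 (thin_lat0 ab)).
Qed.

Lemma g3E a b : area a b != 0 -> g3 (lat a b) = 140 * T 6 (lat a b `\ 0).
Proof.
move=> ab; apply: has_set_sumE; apply: has_set_sumZ.
exact: (has_power_sum 3 (thin_lat0 ab)).
Qed.

Lemma double_in a b : lat a b (a / 2 + a / 2).
Proof. by rewrite -splitr; exact: latl. Qed.

Lemma power_sum_index2 k a b : area a b != 0 ->
  T (k + 3) (lat a (2 * b) `\ 0) = 2 ^- (k + 3) *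
    (T (k + 3) (lat a b `\ 0) + T (k + 3) (translate (a / 2) (lat a b))).
Proof.
move=> ab; rewrite -power_sum_half// -power_sum_scale ?pnatr_eq0 ?area_half_neq0//.
by rewrite (_ : 2 * (a / 2) = a)//; field.
Qed.

(** Half the sublattice is the lattice together with its translate by [a / 2].
    The power sums of that translate are Taylor coefficients of [wp] at the half
    period, which the differential equation expresses by [wp (a / 2)]. *)
Lemma index2_invariants a b : area a b != 0 ->
  let e := wp (a / 2) (lat a b) in
  g2 (lat a (2 * b)) = (15 * e ^+ 2 - g2 (lat a b)) / 4 /\
  g3 (lat a (2 * b)) = (7 * e ^+ 3 + g3 (lat a b)) / 8.
Proof.
move=> ab e.
have ab2 : area a (2 * b) != 0 by rewrite area_double mulf_neq0// pnatr_eq0.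
have [H4 H6 H3] := half_period_identities ab (halfl_not_in ab) (double_in a b).
rewrite -/e in H4 H6 H3.
rewrite !g2E// !g3E// (@power_sum_index2 1)// (@power_sum_index2 3)//.
have H6' : T 6 (translate (a / 2) (lat a b)) = 3 * e * (e ^+ 2 - 5 * T 4 (lat a b `\ 0)) / 5.
  by rewrite -H4 -H6; field.
split; first by rewrite H4; field.
rewrite -[(3 + 3)%N]/6%N H6' H3.
rewrite (_ : 3 * e * (e ^+ 2 - 5 * T 4 (lat a b `\ 0)) / 5 =
  (3 * e ^+ 3 - 15 * e * T 4 (lat a b `\ 0)) / 5); last by field.
by rewrite H3; field.
Qed.

(** The finer lattice of all half periods splits into the lattice and its three
    nontrivial translates. *)
Lemma half_period_sums k a b : area a b != 0 ->
  (2 ^+ (k + 3) - 1) * T (k + 3) (lat a b `\ 0) =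
  T (k + 3) (translate (a / 2) (lat a b)) + T (k + 3) (translate (b / 2) (lat a b))
  + T (k + 3) (translate ((a + b) / 2) (lat a b)).
Proof.
move=> ab.
have a2b : area b (a / 2) != 0 by rewrite areaC oppr_eq0; exact: area_half_neq0.
have a2b2 : area (a / 2) (b / 2) != 0.
  by rewrite areaC oppr_eq0; exact: area_half_neq0.
have := @power_sum_scale k _ _ 2 _ a2b2; rewrite pnatr_eq0 => /(_ isT).
rewrite (_ : 2 * (a / 2) = a); last by field.
rewrite (_ : 2 * (b / 2) = b); last by field.
rewrite [in RHS]latC power_sum_half// (latC b) power_sum_half// => E.
have nb : ~ lat (a / 2) b (b / 2).
  by rewrite latC; apply: halfl_not_in.
have := power_sum_half_translate ab k nb.
rewrite (_ : b / 2 + a / 2 = (a + b) / 2); last by field.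
move=> E2; rewrite E2 in E.
have two : (2 : R[i]) ^+ (k + 3) != 0 by rewrite expf_neq0// pnatr_eq0.
move/(congr1 (fun x => 2 ^+ (k + 3) * x)): E.
rewrite mulVKf// => E; rewrite mulrBl E; ring.
Qed.

End Sublattices.

(** * Cubic polynomials with distinct roots *)

Section Roots.
Variable K : numFieldType.
Implicit Types (x r s A B : K).

Lemma two_roots x y A B : x != y -> x ^+ 3 = A * x + B -> y ^+ 3 = A * y + B ->
  x ^+ 2 + x * y + y ^+ 2 = A.
Proof.
move=> xy hx hy; have xy0 : x - y != 0 by rewrite subr_eq0.
apply: (mulIf xy0); have -> : (x ^+ 2 + x * y + y ^+ 2) * (x - y) = x ^+ 3 - y ^+ 3 by ring.
by rewrite hx hy; ring.
Qed.

Lemma three_roots x y z A B : uniq [:: x; y; z] -> 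
  x ^+ 3 = A * x + B -> y ^+ 3 = A * y + B -> z ^+ 3 = A * z + B ->
  x + y + z = 0.
Proof.
rewrite /= !inE negb_or andbT => /andP[/andP[xy xz] yz] hx hy hz.
have h1 := two_roots xy hx hy; have h2 := two_roots xz hx hz.
have yz0 : y - z != 0 by rewrite subr_eq0.
apply: (mulIf yz0); rewrite mul0r.
have -> : (x + y + z) * (y - z) = x ^+ 2 + x * y + y ^+ 2 - (x ^+ 2 + x * z + z ^+ 2) by ring.
by rewrite h1 h2 subrr.
Qed.

Lemma simple_root x y z A B : uniq [:: x; y; z] ->
  x ^+ 3 = A * x + B -> y ^+ 3 = A * y + B -> z ^+ 3 = A * z + B ->
  3 * x ^+ 2 != A.
Proof.
move=> u hx hy hz; have s := three_roots u hx hy hz.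
move: u; rewrite /= !inE negb_or andbT => /andP[/andP[xy xz] yz].
have h1 := two_roots xy hx hy.
apply/negP => /eqP h; have : (x - y) * (x - z) = 0.
  have -> : (x - y) * (x - z) = 3 * x ^+ 2 - (x ^+ 2 + x * y + y ^+ 2)
    - (x - y) * (x + y + z) by ring.
  by rewrite h h1 s subrr mulr0 subrr.
by move/eqP; rewrite mulf_eq0 !subr_eq0 (negbTE xy) (negbTE xz).
Qed.

(** If [e = f], the power sums force [3 * e ^+ 2 = A], so that [e] would be a
    double root: either [g = - 2 * e], or [A = 0] and comparing the sixth powers
    of [e] and [g] gives [e = 0]. *)
Lemma power_sums_distinct e f g A B :
  (forall x, x ^+ 3 = A * x + B -> 3 * x ^+ 2 != A) ->
  e ^+ 3 = A * e + B -> f ^+ 3 = A * f + B -> g ^+ 3 = A * g + B ->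
  e ^+ 2 + f ^+ 2 + g ^+ 2 = 2 * A -> A * (e + f + g) = 0 -> e != f.
Proof.
move=> simple he hf hg s2 As; apply/negP => /eqP ef; subst f.
have /negP := simple e he; apply; apply/eqP.
have [A0|A0] := eqVneq A 0.
  have g2 : g ^+ 2 = - (2 * e ^+ 2).
    by apply/eqP; rewrite -subr_eq0; apply/eqP; rewrite A0 mulr0 in s2; rewrite -[RHS]s2; ring.
  rewrite A0 mul0r add0r in he; rewrite A0 mul0r add0r in hg.
  have : 9 * (e ^+ 3) ^+ 2 = 0.
    have : (g ^+ 3) ^+ 2 = (g ^+ 2) ^+ 3 by ring.
    rewrite g2 hg -he => h; have -> : 9 * (e ^+ 3) ^+ 2 = (e ^+ 3) ^+ 2 - (- (2 * e ^+ 2)) ^+ 3 by ring.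
    by rewrite h subrr.
  move/eqP; rewrite mulf_eq0 pnatr_eq0/= !expf_eq0/= => /eqP ->.
  by rewrite A0 expr0n mulr0.
have g2e : g = - (2 * e).
  apply: (mulfI A0); apply/eqP; rewrite -subr_eq0; apply/eqP; rewrite -[RHS]As; ring.
rewrite g2e in s2; have two : (2 : K) != 0 by rewrite pnatr_eq0.
by apply: (mulfI two); rewrite -s2; ring.
Qed.

End Roots.

(** * Bases of discrete subgroups *)

Section DiscreteSubgroups.
Variable R : realType.
Implicit Types (G H S : set R[i]) (x y z a b : R[i]).

Lemma discrete_gap G : subgroup G -> G `<=` isolated G ->
  exists d : R, 0 < d /\ forall x, G x -> x != 0 -> d <= cabs x.
Proof.
move=> sG /(_ 0 (subgroup0 sG))[_ [V /nbhs_normP[e /= e0 eV] VG]].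
have [e1 e2] : complex.Im e = 0 /\ 0 < complex.Re e.
  by move: e0; rewrite ltcE /= => /andP[/eqP -> ->].
exists (complex.Re e); split=> // x Gx x0; rewrite leNgt; apply/negP => xe.
have : (V `&` G) x.
  split=> //; apply: eV; rewrite /ball_/= sub0r normrN normE ltcE /= xe.
  by rewrite e1 eqxx.
by rewrite VG /= => /eqP; rewrite (negbTE x0).
Qed.

(** Below a given modulus there are finitely many points, because a point of
    the group is determined by its cell in a fine square grid. *)
Lemma discrete_min G S (d : R) : subgroup G -> 0 < d ->
  (forall x, G x -> x != 0 -> d <= cabs x) -> S `<=` G -> S !=set0 ->
  exists x, S x /\ forall y, S y -> cabs x <= cabs y.
Proof.
move=> sG d0 dP SG [x0 Sx0].
pose r := cabs x0; pose q := d / 2.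
have q0 : 0 < q by rewrite /q; lra.
pose cell x : int * int := (Num.floor (complex.Re x / q), Num.floor (complex.Im x / q)).
have floor_close (s t : R) : Num.floor (s / q) = Num.floor (t / q) -> `|s - t| < q.
  move=> E; have /andP[h1 h2] := floor_itv (s / q).
  have /andP[h3 h4] := floor_itv (t / q).
  rewrite E in h1 h2; rewrite rmorphD/= in h2 h4.
  have : `|s / q - t / q| < 1 by rewrite ltr_norml; apply/andP; split; lra.
  by rewrite -mulrBl normrM normfV (gtr0_norm q0) ltr_pdivrMr// mul1r.
have cell_inj x y : G x -> G y -> cell x = cell y -> x = y.
  move=> Gx Gy [/floor_close h1 /floor_close h2].
  apply/eqP; rewrite -subr_eq0; apply/negPn/negP => xy.
  have := dP _ (subgroupB sG Gx Gy) xy; have := cabs_le_ReIm (x - y).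
  have -> : complex.Re (x - y) = complex.Re x - complex.Re y by case: x y {xy h1 h2 Gx Gy} => [? ?] [? ?].
  have -> : complex.Im (x - y) = complex.Im x - complex.Im y by case: x y {xy h1 h2 Gx Gy} => [? ?] [? ?].
  by rewrite /q in h1 h2; lra.
pose S' := [set x | S x /\ cabs x <= r].
pose rep c := xget x0 [set x | S' x /\ cell x = c].
have S'x0 : S' x0 by split.
have repS c : S' (rep c) by rewrite /rep; case: xgetP => [? _ []|].
pose N := (absz (Num.floor (r / q))).+2.
have floor_small (s : R) : `|s| <= r -> (absz (Num.floor (s / q)) < N)%N.
  move=> sr; have r0 : 0 <= r := cabs_ge0 x0.
  have sq : `|s / q| <= r / q by rewrite normrM normfV (gtr0_norm q0) ler_pM2r ?invr_gt0.
  have /andP[h1 h2] := floor_itv (s / q).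
  have /andP[h3 h4] := floor_itv (r / q).
  move: sq; rewrite ler_norml => /andP[h5 h6].
  rewrite !rmorphD/= in h2 h4.
  have k0 : (0 <= Num.floor (r / q))%R by rewrite floor_ge0 divr_ge0// ltW.
  have u1 : ((Num.floor (s / q))%:~R < (Num.floor (r / q))%:~R + 1 :> R) by lra.
  have u2 : (- (Num.floor (r / q))%:~R - 2 < (Num.floor (s / q))%:~R :> R) by lra.
  have {}u1 : Num.floor (s / q) < Num.floor (r / q) + 1.
    by rewrite -(ltr_int R) rmorphD.
  have {}u2 : - Num.floor (r / q) - 2 < Num.floor (s / q).
    by rewrite -(ltr_int R) rmorphB/= rmorphN.
  rewrite /N; lia.
pose L := [seq rep c | c <- [seq (m, n) | m <- int_box N, n <- int_box N]].
have SL x : S' x -> x \in L.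
  move=> S'x; have [Sx xr] := S'x; apply/mapP; exists (cell x).
    apply/allpairsP; exists (cell x); split=> //; apply: mem_int_box; apply: floor_small;
      apply: le_trans xr; [exact: Re_le_cabs|exact: Im_le_cabs].
  rewrite /rep; case: xgetP => [y _ [[Sy _] yc]|/(_ x)]; last by case.
  by apply: cell_inj => //; exact: SG.
have [x [S'x xmin]] : exists x, S' x /\ forall y, y \in L -> cabs x <= cabs y.
  have : forall y, y \in L -> S' y by move=> y /mapP[c _ ->].
  elim: L {SL} => [|y s IH] sS; first by exists x0.
  have [|x [S'x xs]] := IH; first by move=> z zs; apply: sS; rewrite inE zs orbT.
  have [yx|xy] := lerP (cabs y) (cabs x).
    exists y; split; first by apply: sS; rewrite mem_head.
    by move=> z; rewrite inE => /orP[/eqP->//|/xs]; exact: le_trans.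
  by exists x; split=> // z; rewrite inE => /orP[/eqP->|/xs//]; exact: ltW.
exists x; split; first by case: S'x.
move=> y Sy; have [yr|yr] := lerP (cabs y) r; first by apply: xmin; exact: SL.
by case: S'x => _ h; apply: le_trans h (ltW yr).
Qed.

Lemma round_close (s : R) : exists m : int, `|s - m%:~R| <= 1 / 2.
Proof.
exists (Num.floor (s + 1 / 2)); have /andP[h1 h2] := floor_itv (s + 1 / 2).
by rewrite rmorphD/= in h2; rewrite ler_norml; apply/andP; split; lra.
Qed.

Lemma sqr_cabs_comb a b (s t : R) :
  cabs (s%:C * a + t%:C * b) ^+ 2 = s ^+ 2 * cabs a ^+ 2 + t ^+ 2 * cabs b ^+ 2
  + 2 * s * t * (complex.Re a * complex.Re b + complex.Im a * complex.Im b).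
Proof. by rewrite !sqr_cabs; case: a b => [? ?] [? ?] /=; ring. Qed.

Lemma lagrange a b : (complex.Re a * complex.Re b + complex.Im a * complex.Im b) ^+ 2
  + area a b ^+ 2 = cabs a ^+ 2 * cabs b ^+ 2.
Proof. by rewrite !sqr_cabs /area; ring. Qed.

(** The cross term is strictly smaller than the product of the moduli, as [a] and
    [b] are not parallel. *)
Lemma short_comb a b (s t : R) : area a b != 0 -> cabs a <= cabs b ->
  `|s| <= 1 / 2 -> `|t| <= 1 / 2 -> cabs (s%:C * a + t%:C * b) < cabs b.
Proof.
move=> ab hab hs ht; rewrite -(@ltr_pXn2r _ 2)// ?nnegrE ?cabs_ge0// sqr_cabs_comb.
have := lagrange a b; set rho := complex.Re a * complex.Re b + complex.Im a * complex.Im b.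
set A := cabs a; set B := cabs b => L.
have A0 : 0 <= A by exact: cabs_ge0. have B0 : 0 <= B by exact: cabs_ge0.
have d0 : 0 < area a b ^+ 2 by rewrite exprn_even_gt0.
have rho1 : `|rho| < B ^+ 2.
  rewrite -(@ltr_pXn2r _ 2)// ?nnegrE ?exprn_ge0// real_normK ?num_real//.
  have : A ^+ 2 * B ^+ 2 <= B ^+ 2 * B ^+ 2.
    by rewrite ler_wpM2r ?exprn_ge0// lerXn2r.
  by lra.
have s2 : s ^+ 2 <= 1 / 4.
  by rewrite -real_normK ?num_real//; have := ler_pM (normr_ge0 s) (normr_ge0 s) hs hs; rewrite -expr2; lra.
have t2 : t ^+ 2 <= 1 / 4.
  by rewrite -real_normK ?num_real//; have := ler_pM (normr_ge0 t) (normr_ge0 t) ht ht; rewrite -expr2; lra.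
have h1 : s ^+ 2 * A ^+ 2 <= 1 / 4 * B ^+ 2.
  by apply: ler_pM; rewrite ?sqr_ge0 ?exprn_ge0// lerXn2r.
have h2 : t ^+ 2 * B ^+ 2 <= 1 / 4 * B ^+ 2 by rewrite ler_wpM2r ?exprn_ge0.
have h3 : 2 * s * t * rho <= 1 / 2 * `|rho|.
  apply: le_trans (ler_norm _) _; rewrite !normrM (ger0_norm (ler0n _ 2)).
  rewrite ler_wpM2r//; have := ler_pM (normr_ge0 s) (normr_ge0 t) hs ht; lra.
lra.
Qed.

(** Gauss reduction: [a] is a shortest nonzero vector and [b] a shortest one off
    the line of [a]. After rounding coordinates, [short_comb] leaves a vector
    shorter than [b], hence on the line of [a], hence zero. *)
Lemma lattice_basis G : lattice G -> exists a b, area a b != 0 /\ G = lat a b.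
Proof.
move=> [[sG iG] [[v [vG vI]] _]].
have [d [d0 dP]] := discrete_gap sG iG.
have vne i : v i != 0.
  apply/eqP => vi; have := vI (fun j => (j == i)%:R).
  rewrite (bigD1 i)//= big1 ?addr0; last by move=> j /negbTE ->; rewrite mulr0z.
  by rewrite vi mul0rz => /(_ erefl i); rewrite eqxx.
have [| |a [[Ga /= /eqP a0] amin]] := @discrete_min G (G `\ 0) d sG d0 dP.
- by move=> x [].
- by exists (v ord0); split=> //=; apply/eqP.
have amin' x : G x -> x != 0 -> cabs a <= cabs x by move=> Gx /eqP x0; exact: amin.
have ca : 0 < cabs a by rewrite cabs_gt0.
have line x : G x -> area a x = 0 -> exists m : int, x = m%:~R * a.
  move=> Gx ax.
  have an : cabs a ^+ 2 != 0 by rewrite expf_neq0// gt_eqF.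
  pose s := (complex.Re a * complex.Re x + complex.Im a * complex.Im x) / cabs a ^+ 2.
  have xE : x = s%:C * a.
    rewrite /s sqr_cabs in an *; move: ax an {Gx s}; rewrite /area.
    case: a {amin amin' a0 Ga ca} => a1 a2; case: x => x1 x2 /= ax an.
    apply/eqP; rewrite eq_complex /=; apply/andP; split; apply/eqP.
      have e : x1 - ((a1 * x1 + a2 * x2) / (a1 ^+ 2 + a2 ^+ 2) * a1 - 0 * a2)
        = - a2 * (a1 * x2 - a2 * x1) / (a1 ^+ 2 + a2 ^+ 2) by field; exact: an.
      by apply/eqP; rewrite -subr_eq0 e ax mulr0 mul0r.
    have e : x2 - ((a1 * x1 + a2 * x2) / (a1 ^+ 2 + a2 ^+ 2) * a2 + 0 * a1)
      = a1 * (a1 * x2 - a2 * x1) / (a1 ^+ 2 + a2 ^+ 2) by field; exact: an.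
    by apply/eqP; rewrite -subr_eq0 e ax mulr0 mul0r.
  have [m hm] := round_close s; exists m.
  apply/eqP; rewrite -subr_eq0; apply/negPn/negP => ne.
  have := amin' _ (subgroupB sG Gx (subgroupMz sG m Ga)) ne.
  rewrite {1}xE intC -mulrBl -rmorphB cabsM cabsR.
  have := ler_wpM2r (ltW ca) hm; lra.
have [| |b [[Gb /= /eqP b0] bmin]] := @discrete_min G [set x | G x /\ area a x <> 0] d sG d0 dP.
- by move=> x [].
- apply: contrapT => /set0P/negP; rewrite negbK => /eqP E.
  have L x : G x -> area a x = 0.
    move=> Gx; apply: contrapT => ne.
    by have : [set x | G x /\ area a x <> 0] x by []; rewrite E.
  have [m mE] := line _ (vG ord0) (L _ (vG ord0)).
  have [n nE] := line _ (vG ord_max) (L _ (vG ord_max)).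
  have := vI (fun i => if i == ord0 then n else - m).
  rewrite big_ord_recl big_ord1 /= => /(_ _ ord_max).
  have -> : lift ord0 ord0 = ord_max :> 'I_2 by apply/val_inj.
  rewrite -(mulrzl _ n) -(mulrzl _ (- m)) mE nE rmorphN/= => H.
  have m0 : - m = 0 by apply: H; ring.
  have : m = 0 by lia.
  by move=> m00; have := vne ord0; rewrite mE m00 mul0r eqxx.
exists a, b; split=> //; apply/seteqP; split; last exact: lat_subset.
move=> x Gx; have hab : cabs a <= cabs b.
  by apply: amin' => //; apply: contraNneq b0 => ->; rewrite /area /= !mulr0 subrr.
have [m hm] := round_close (area x b / area a b).
have [n hn] := round_close (area a x / area a b).
pose w := x - (m%:~R * a + n%:~R * b).
have Gw : G w by apply: subgroupB => //; apply: subgroupD => //; exact: subgroupMz.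
set s := _ / _ - _ in hm; set t := _ / _ - _ in hn.
have wE : w = s%:C * a + t%:C * b.
  rewrite /w {1}(coordE x b0) lat_coordE /s /t !rmorphB/=; ring.
have wb : cabs w < cabs b by rewrite wE short_comb.
have [aw|aw] := eqVneq (area a w) 0; last first.
  have := bmin w; rewrite leNgt wb => H; exfalso.
  by have : false by apply: H; split=> //; apply/eqP.
have t0 : t = 0.
  have [h _] := area_comb a b s t; move: h; rewrite -wE aw => /esym/eqP.
  by rewrite mulf_eq0 (negbTE b0) orbF => /eqP.
have w0 : w = 0.
  apply/eqP/negPn/negP => ne; have := amin' w Gw ne.
  rewrite wE t0 mul0r addr0 cabsM cabsR; have := ler_wpM2r (ltW ca) hm; lra.
exists m, n; apply/eqP; rewrite -subr_eq0; exact/eqP.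
Qed.

End DiscreteSubgroups.

(** * Bases adapted to a subgroup of index two *)

Section IndexTwo.
Variable R : realType.
Implicit Types (G H S : set R[i]) (x y z a b : R[i]).

Definition coset x H : set R[i] := [set x + y | y in H].

Lemma coset_eq H x y : subgroup H -> coset x H = coset y H -> H (x - y).
Proof.
move=> sH E; have : coset x H x by exists 0; [exact: subgroup0|rewrite addr0].
by rewrite E => -[z Hz <-]; rewrite addrC addKr.
Qed.

(** With two cosets, all points outside [H] are in the same one. *)
Lemma index2_props G H : subgroup G -> subgroup_of_index 2 H G ->
  (exists x, G x /\ ~ H x) /\ (forall x y, G x -> G y -> ~ H x -> ~ H y -> H (x - y)).
Proof.
move=> sG [sH HG /card_set_bijP[f [fsub finj fsurj]]].
have H0 : coset 0 H = H.
  apply/seteqP; split=> [_ [y Hy <-]|y Hy]; first by rewrite add0r.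
  by exists y => //; rewrite add0r.
have C x : G x -> cosets H G (coset x H) by move=> Gx; exists x.
have inj x y : G x -> G y -> f (coset x H) = f (coset y H) -> H (x - y).
  move=> Gx Gy E; apply: coset_eq => //.
  by apply: finj => //; apply/mem_set; exact: C.
have lt2 x : G x -> (f (coset x H) < 2)%N by move=> Gx; have := fsub _ (C _ Gx).
split.
  apply: contrapT => no.
  have all x : G x -> H x by move=> Gx; apply: contrapT => nH; apply: no; exists x.
  have [_ [x Gx <-] f0] := fsurj 0%N isT.
  have [_ [y Gy <-] f1] := fsurj 1%N isT.
  suff E : coset x H = coset y H by move: f1; rewrite -/(coset y H) -E f0.
  have sub u v : G u -> G v -> coset u H `<=` coset v H.
    move=> Gu Gv _ [z Hz <-]; exists (u + z - v); last by rewrite addrC subrK.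
    by apply: all; apply: subgroupB => //; apply: subgroupD => //; exact: HG.
  by apply/seteqP; split; exact: sub.
move=> x y Gx Gy Hx Hy; apply: (inj x y) => //.
have n0 z : G z -> ~ H z -> f (coset z H) <> f (coset 0 H).
  by move=> Gz Hz E; apply: Hz; have := inj _ _ Gz (subgroup0 sG) E; rewrite subr0.
have := n0 _ Gx Hx; have := n0 _ Gy Hy.
have := lt2 _ Gx; have := lt2 _ Gy; have := lt2 _ (subgroup0 sG).
lia.
Qed.

Lemma lat_index2 a b : area a b != 0 -> subgroup_of_index 2 (lat a (2 * b)) (lat a b).
Proof.
move=> ab; set H := lat a (2 * b); set G := lat a b.
have sH : subgroup H by exact: lat_subgroup.
have bH : ~ H b.
  move=> [m [n E]]; have : 0%:~R * a + 1%:~R * b = m%:~R * a + (n * 2)%:~R * b.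
    by rewrite rmorphM/= mul0r add0r mul1r {1}E; ring.
  by move/(lat_coord_inj ab) => [_]; lia.
have HG : H `<=` G by apply: lat_subset; [exact: lat_subgroup|exact: latl|
   rewrite mulr_natl; apply: subgroupMn; [exact: lat_subgroup|exact: latr]].
split=> //.
pose f (i : nat) := if i == 0%N then coset 0 H else coset b H.
have E : cosets H G = [set f i | i in `I_2].
  apply/seteqP; split=> [_ [x [m [n ->]] <-]|_ [i _ <-]]; last first.
    by rewrite /f; case: ifP => _; [exists 0|exists b] => //; [exact: subgroup0 (lat_subgroup a b)|exact: latr].
  have nE := divz_eq n 2; set q := (n %/ 2)%Z in nE.
  have key u v : H (u - v) -> coset v H = coset u H.
    move=> Huv; apply/seteqP; split=> _ [z Hz <-].
      by exists (z - (u - v)); [exact: subgroupB|ring].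
    by exists (z + (u - v)); [exact: subgroupD|ring].
  have : (n %% 2)%Z = 0 \/ (n %% 2)%Z = 1 by lia.
  case=> r; rewrite r in nE; [exists 0%N|exists 1%N] => //; rewrite /f/=; apply: key.
    by exists m, q; rewrite nE addr0 rmorphM/=; ring.
  by exists m, q; rewrite nE rmorphD rmorphM/=; ring.
rewrite E; apply: inj_card_eq => i j /set_mem /= i2 /set_mem /= j2.
rewrite /f; case: i i2 => [|[|]]//; case: j j2 => [|[|]]//= _ _.
  by move=> /esym/(coset_eq sH); rewrite subr0.
by move=> /(coset_eq sH); rewrite subr0.
Qed.

(** The class of [omega] modulo [2 G] is one of the three nonzero classes of
    [a], [b] and [a + b]; exchanging the basis vectors makes it the class of the
    first one. The sublattice contains [2 G], and not the second basis vector,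
    so it is determined. *)
Lemma index2_basis a b H omega : area a b != 0 -> subgroup_of_index 2 H (lat a b) ->
  H omega -> ~ [set x *+ 2 | x in lat a b] omega ->
  exists a' b' u, [/\ area a' b' != 0, lat a b = lat a' b', H = lat a' (2 * b'),
     lat a' b' u & omega = a' + 2 * u].
Proof.
move=> ab H2 Ho o2.
have sG := lat_subgroup a b.
have [[y [Gy Hy]] diff] := index2_props sG H2.
have [sH HG _] := H2.
have dbl x : lat a b x -> H (2 * x).
  move=> Gx; rewrite mulr_natl mulr2n; have [Hx|Hx] := pselect (H x); first exact: subgroupD.
  rewrite -[x in x + _]opprK addrC; apply: diff => //.
  - exact: subgroupN.
  - by move=> h; apply: Hx; rewrite -[x]opprK; exact: subgroupN.
have [a' [b' [u [ab' GE Gu oE]]]] : exists a' b' u,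
    [/\ area a' b' != 0, lat a b = lat a' b', lat a' b' u & omega = a' + 2 * u].
  have [m [n E]] := HG _ Ho.
  have mE := divz_eq m 2; set p := (m %/ 2)%Z in mE.
  have nE := divz_eq n 2; set q := (n %/ 2)%Z in nE.
  have Gpq : lat a b (p%:~R * a + q%:~R * b) by exists p, q.
  have : (m %% 2)%Z = 0 \/ (m %% 2)%Z = 1 by lia.
  have : (n %% 2)%Z = 0 \/ (n %% 2)%Z = 1 by lia.
  case=> rn [] rm; rewrite rn in nE; rewrite rm in mE.
  - exfalso; apply: o2; exists (p%:~R * a + q%:~R * b) => //.
    by rewrite E mE nE !addr0 !rmorphM/=; ring.
  - exists a, b, (p%:~R * a + q%:~R * b); split=> //.
    by rewrite E mE nE addr0 rmorphD !rmorphM/=; ring.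
  - exists b, a, (p%:~R * a + q%:~R * b); split=> //; [by rewrite areaC oppr_eq0|exact: latC|by rewrite latC|].
    by rewrite E mE nE addr0 rmorphD !rmorphM/=; ring.
  - exists (a + b), b, (p%:~R * a + q%:~R * b); split=> //; [by rewrite areaDl|by rewrite latDl|by rewrite latDl|].
    by rewrite E mE nE !rmorphD !rmorphM/=; ring.
exists a', b', u; rewrite -GE; split=> //; last by rewrite GE.
have Ha : H a'.
  have -> : a' = omega - 2 * u by rewrite oE addrK.
  by apply: subgroupB => //; apply: dbl; rewrite GE.
have Gb : lat a b b' by rewrite GE; exact: latr.
have Hb : ~ H b'.
  move=> Hb; apply: Hy; move: Gy; rewrite GE => -[m [n ->]].
  by apply: subgroupD => //; exact: subgroupMz.
apply/seteqP; split; last by apply: lat_subset => //; exact: dbl.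
move=> x Hx; have := HG _ Hx; rewrite GE => -[m [n E]].
have nE := divz_eq n 2; set q := (n %/ 2)%Z in nE.
have : (n %% 2)%Z = 0 \/ (n %% 2)%Z = 1 by lia.
case=> r; rewrite r in nE.
  by exists m, q; rewrite E nE addr0 rmorphM/=; ring.
exfalso; apply: Hb.
have -> : b' = x - (m%:~R * a' + q%:~R * (2 * b')) by rewrite E nE rmorphD rmorphM/=; ring.
by apply: subgroupB => //; apply: subgroupD => //; apply: subgroupMz => //; exact: dbl.
Qed.

End IndexTwo.

(** * Optimal sublattices and root differences *)

Section LatticeStep.
Variable R : realType.
Implicit Types (G H : set R[i]) (a b x y e f g : R[i]).

Lemma root_weierstrass G x :
  root (weierstrass_poly G) x <-> x ^+ 3 = g2 G / 4 * x + g3 G / 4.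
Proof.
rewrite /root /weierstrass_poly !(hornerD, hornerN, hornerZ, hornerXn, hornerX, hornerC).
have -> : 4 * x ^+ 3 - g2 G * x - g3 G = 4 * (x ^+ 3 - (g2 G / 4 * x + g3 G / 4)) by field.
rewrite mulf_eq0 pnatr_eq0 /= subr_eq0.
by split=> [/eqP|->].
Qed.

Lemma wp_halfD a b u x : area a b != 0 -> lat a b u ->
  x = a + 2 * u -> wp (x / 2) (lat a b) = wp (a / 2) (lat a b).
Proof.
move=> ab Gu ->; have -> : (a + 2 * u) / 2 = a / 2 + u by field.
by apply: wp_period => //; exact: halfl_not_in.
Qed.

(** The three half-period values satisfy the cubic by [first_order_equation], and
    summing the identities of [half_period_identities] over the three half
    periods gives their power sums, hence they are distinct. *)
Lemma half_period_roots a b e1 e2 e3 : area a b != 0 ->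
  uniq [:: e1; e2; e3] ->
  (forall x, root (weierstrass_poly (lat a b)) x <-> x \in [:: e1; e2; e3]) ->
  e1 = wp (a / 2) (lat a b) ->
  e1 + e2 + e3 = 0 /\
  ((wp (b / 2) (lat a b) = e2 /\ wp ((a + b) / 2) (lat a b) = e3) \/
   (wp (b / 2) (lat a b) = e3 /\ wp ((a + b) / 2) (lat a b) = e2)).
Proof.
move=> ab u rts e1E.
set G := lat a b in rts e1E *; set eb := wp (b / 2) G; set ec := wp ((a + b) / 2) G.
pose A := g2 G / 4; pose B := g3 G / 4.
have rt x : x \in [:: e1; e2; e3] -> x ^+ 3 = A * x + B by move/rts/root_weierstrass.
have tr x : x ^+ 3 = A * x + B -> x \in [:: e1; e2; e3] by move=> h; apply/rts/root_weierstrass.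
have [h1 h2 h3] : [/\ e1 ^+ 3 = A * e1 + B, e2 ^+ 3 = A * e2 + B & e3 ^+ 3 = A * e3 + B].
  by split; apply: rt; rewrite !inE eqxx ?orbT.
have u' : uniq [:: e2; e3; e1] by rewrite -(rot_uniq 1) in u.
have u'' : uniq [:: e3; e1; e2] by rewrite -(rot_uniq 2) in u.
have simple x : x ^+ 3 = A * x + B -> 3 * x ^+ 2 != A.
  move/tr; rewrite !inE => /or3P[]/eqP->.
  - exact: simple_root u h1 h2 h3.
  - exact: simple_root u' h2 h3 h1.
  - exact: simple_root u'' h3 h1 h2.
have ba : area b a != 0 by rewrite areaC oppr_eq0.
have cb : area (a + b) b != 0 by rewrite areaDl.
have [Ia4 Ia6 Ia3] := half_period_identities ab (halfl_not_in ab) (double_in a b).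
have [Ib4 Ib6 Ib3] := half_period_identities ba (halfl_not_in ba) (double_in b a).
have [Ic4 Ic6 Ic3] := half_period_identities cb (halfl_not_in cb) (double_in (a + b) b).
rewrite (latC b) -/G -/eb in Ib4 Ib6 Ib3; rewrite latDl -/G -/ec in Ic4 Ic6 Ic3.
rewrite -/G -e1E in Ia4 Ia6 Ia3.
have S4 := half_period_sums 1 ab; have S6 := half_period_sums 3 ab.
rewrite -[(1 + 3)%N]/4%N -/G Ia4 Ib4 Ic4 in S4.
rewrite -[(3 + 3)%N]/6%N -/G in S6.
set t4 := power_sum 4 (G `\ 0) in Ia4 Ib4 Ic4 Ia3 Ib3 Ic3 S4.
set t6 := power_sum 6 (G `\ 0) in Ia3 Ib3 Ic3 S6.
have AE : A = 15 * t4 by rewrite /A g2E// -/G -/t4; field.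
have BE : B = 35 * t6 by rewrite /B g3E// -/G -/t6; field.
rewrite -AE -BE in Ia3 Ib3 Ic3; clearbody eb ec t4 t6 A B.
have s2 : e1 ^+ 2 + eb ^+ 2 + ec ^+ 2 = 2 * A.
  rewrite AE; apply/eqP; rewrite -subr_eq0.
  move/eqP: S4; rewrite -subr_eq0 => /eqP S4; apply/eqP.
  by rewrite -[RHS]oppr0 -S4; ring.
have As : A * (e1 + eb + ec) = 0.
  have : 5 * (63 * t6) = 3 * (e1 ^+ 3 + eb ^+ 3 + ec ^+ 3) - A * (e1 + eb + ec).
    have -> : 63 * t6 = (2 ^+ 6 - 1) * t6 by ring.
    rewrite S6 !mulrDr Ia6 Ib6 Ic6 Ia4 Ib4 Ic4 AE; ring.
  rewrite Ia3 Ib3 Ic3 BE => E.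
  move/eqP: E; rewrite -subr_eq0 => /eqP E.
  have two : (2 : R[i]) != 0 by rewrite pnatr_eq0.
  by apply: (mulfI two); rewrite mulr0 -[RHS]oppr0 -E; ring.
have n1 : e1 != eb by exact: power_sums_distinct simple Ia3 Ib3 Ic3 s2 As.
have n2 : e1 != ec.
  apply: power_sums_distinct simple Ia3 Ic3 Ib3 _ _; first by rewrite -s2; ring.
  by rewrite -[RHS]As; ring.
have n3 : eb != ec.
  apply: power_sums_distinct simple Ib3 Ic3 Ia3 _ _; first by rewrite -s2; ring.
  by rewrite -[RHS]As; ring.
split; first exact: three_roots u h1 h2 h3.
move: (tr _ Ib3) (tr _ Ic3); rewrite !inE ![_ == e1]eq_sym (negbTE n1) (negbTE n2) /=.
move=> /orP[]/eqP bE /orP[]/eqP cE; rewrite ?bE ?cE; try by [left|right].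
  by move: n3; rewrite bE cE eqxx.
by move: n3; rewrite bE cE eqxx.
Qed.

(** Substituting [index2_invariants] turns the discriminant of the sublattice
    into a product of differences of roots, which makes optimality a statement
    about the roots alone. *)
Lemma Delta_index2 a b e f g : area a b != 0 -> e = wp (a / 2) (lat a b) ->
  e + f + g = 0 ->
  g2 (lat a b) = 4 * (e ^+ 2 + e * f + f ^+ 2) ->
  g3 (lat a b) = 4 * (e * f * g) ->
  16 * Delta (lat a (2 * b)) = (f - g) ^+ 4 * ((e - f) * (e - g)).
Proof.
move=> ab eE s h2 h3; have [E2 E3] := index2_invariants ab.
rewrite -eE in E2 E3; rewrite /Delta E2 E3 h2 h3.
have -> : g = - e - f by apply/eqP; rewrite -subr_eq0; apply/eqP; rewrite -[RHS]s; ring.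
by field.
Qed.

Lemma index2_mem a b : area a b != 0 ->
  [/\ subgroup_of_index 2 (lat b (2 * a)) (lat a b) &
      subgroup_of_index 2 (lat (a + b) (2 * b)) (lat a b)].
Proof.
move=> ab; split.
  by rewrite (latC a b); apply: lat_index2; rewrite areaC oppr_eq0.
by rewrite -(latDl a b); apply: lat_index2; rewrite areaDl.
Qed.

Lemma optimal_gap (x y z : R) : 0 < x -> 0 < y -> 0 < z ->
  x ^+ 4 * (y * z) <= z ^+ 4 * (y * x) -> x <= z.
Proof.
move=> x0 y0 z0 h.
rewrite -(@ler_pXn2r _ 3)// ?nnegrE ?(ltW x0) ?(ltW z0)//.
have k : 0 < x * y * z by rewrite !mulr_gt0.
rewrite -(ler_pM2r k).
have -> : x ^+ 3 * (x * y * z) = x ^+ 4 * (y * z) by ring.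
by have -> : z ^+ 3 * (x * y * z) = z ^+ 4 * (y * x) by ring.
Qed.

(** By [Delta_index2], optimality compares products that differ in the powers of
    two root differences, and leaves the difference of [e2] and [e3] the
    smallest. *)
Lemma lattice_step G H om e1 e2 e3 : (exists a b, area a b != 0 /\ G = lat a b) ->
  optimal H G -> (H `\` [set x *+ 2 | x in G]) om ->
  uniq [:: e1; e2; e3] ->
  (forall x, root (weierstrass_poly G) x <-> x \in [:: e1; e2; e3]) ->
  e1 = wp (om / 2) G ->
  [/\ e1 + e2 + e3 = 0, 
      g2 G = 4 * (e1 ^+ 2 + e1 * e2 + e2 ^+ 2) /\ g3 G = 4 * (e1 * e2 * e3),
      cabs (e2 - e3) <= cabs (e1 - e3) /\ cabs (e2 - e3) <= cabs (e1 - e2),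
      g2 H = (15 * e1 ^+ 2 - g2 G) / 4 /\ g3 H = (7 * e1 ^+ 3 + g3 G) / 8 &
      exists a b, area a b != 0 /\ H = lat a b].
Proof.
move=> [a0 [b0 [ab0 GE]]]; rewrite {}GE => -[H2 opt] [Ho o2] u rts e1E.
have [a [b [v [ab GE HE Gv oE]]]] := index2_basis ab0 H2 Ho o2.
rewrite {}GE in opt rts e1E *; rewrite (wp_halfD ab Gv oE) in e1E.
rewrite {}HE in opt *.
have [s bc] := half_period_roots ab u rts e1E.
have rt x : x \in [:: e1; e2; e3] -> x ^+ 3 = g2 (lat a b) / 4 * x + g3 (lat a b) / 4.
  by move/rts/root_weierstrass.
have [h1 h2 h3] : [/\ e1 ^+ 3 = g2 (lat a b) / 4 * e1 + g3 (lat a b) / 4,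
  e2 ^+ 3 = g2 (lat a b) / 4 * e2 + g3 (lat a b) / 4 & e3 ^+ 3 = g2 (lat a b) / 4 * e3 + g3 (lat a b) / 4].
  by split; apply: rt; rewrite !inE eqxx ?orbT.
have e3E : e3 = - e1 - e2 by apply/eqP; rewrite -subr_eq0; apply/eqP; rewrite -[RHS]s; ring.
move: (u); rewrite /= !inE negb_or andbT => /andP[/andP[n12 n13] n23].
have G2 : g2 (lat a b) = 4 * (e1 ^+ 2 + e1 * e2 + e2 ^+ 2).
  by rewrite (two_roots n12 h1 h2); field.
have G3 : g3 (lat a b) = 4 * (e1 * e2 * e3).
  have -> : g3 (lat a b) = 4 * (e1 ^+ 3 - g2 (lat a b) / 4 * e1) by rewrite h1; field.
  by rewrite G2 e3E; field.
have ba : area b a != 0 by rewrite areaC oppr_eq0.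
have cb : area (a + b) b != 0 by rewrite areaDl.
have [i1 i2] := index2_mem ab.
have [E2 E3] := index2_invariants ab; rewrite -e1E in E2 E3.
have D1 := Delta_index2 ab e1E s G2 G3.
have sub e f g a' b' : area a' b' != 0 -> lat a' b' = lat a b ->
    e = wp (a' / 2) (lat a b) -> e + f + g = 0 ->
    e ^+ 2 + e * f + f ^+ 2 = e1 ^+ 2 + e1 * e2 + e2 ^+ 2 -> e * f * g = e1 * e2 * e3 ->
    16 * Delta (lat a' (2 * b')) = (f - g) ^+ 4 * ((e - f) * (e - g)).
  by move=> ab' L eE s' q2 q3; apply: Delta_index2 => //; rewrite ?L// ?G2 ?G3 ?q2 ?q3.
have opt' H' : subgroup_of_index 2 H' (lat a b) ->
    cabs (16 * Delta (lat a (2 * b))) <= cabs (16 * Delta H').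
  by move=> /opt; rewrite !normE lecR !cabsM => h; apply: ler_wpM2l => //; exact: cabs_ge0.
have p12 : 0 < cabs (e1 - e2) by rewrite cabs_gt0 subr_eq0.
have p13 : 0 < cabs (e1 - e3) by rewrite cabs_gt0 subr_eq0.
have p23 : 0 < cabs (e2 - e3) by rewrite cabs_gt0 subr_eq0.
have [c2 c3] : cabs ((e2 - e3) ^+ 4 * ((e1 - e2) * (e1 - e3))) <=
      cabs ((e1 - e3) ^+ 4 * ((e2 - e1) * (e2 - e3))) /\
    cabs ((e2 - e3) ^+ 4 * ((e1 - e2) * (e1 - e3))) <=
      cabs ((e1 - e2) ^+ 4 * ((e3 - e1) * (e3 - e2))).
  have o1 := opt' _ i1; have o2' := opt' _ i2; rewrite D1 in o1 o2'.
  have s2 : e2 + e1 + e3 = 0 by rewrite -[RHS]s; ring.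
  have s3 : e3 + e1 + e2 = 0 by rewrite -[RHS]s; ring.
  have q2 : e2 ^+ 2 + e2 * e1 + e1 ^+ 2 = e1 ^+ 2 + e1 * e2 + e2 ^+ 2 by ring.
  have q3 : e3 ^+ 2 + e3 * e1 + e1 ^+ 2 = e1 ^+ 2 + e1 * e2 + e2 ^+ 2 by rewrite e3E; ring.
  have r2 : e2 * e1 * e3 = e1 * e2 * e3 by ring.
  have r3 : e3 * e1 * e2 = e1 * e2 * e3 by ring.
  case: bc => -[/esym bE /esym cE].
    rewrite (sub _ _ _ _ _ ba (latC b a) bE s2 q2 r2) in o1.
    by rewrite (sub _ _ _ _ _ cb (latDl a b) cE s3 q3 r3) in o2'.
  rewrite (sub _ _ _ _ _ ba (latC b a) bE s3 q3 r3) in o1.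
  by rewrite (sub _ _ _ _ _ cb (latDl a b) cE s2 q2 r2) in o2'.
have cabs_prod x y z : cabs (x ^+ 4 * (y * z)) = cabs x ^+ 4 * (cabs y * cabs z).
  by rewrite cabsM cabsX cabsM.
split=> //.
- split.
    apply: (optimal_gap p23 p12 p13).
    by move: c2; rewrite !cabs_prod (cabsB e2 e1).
  apply: (optimal_gap p23 p13 p12).
  by move: c3; rewrite !cabs_prod (cabsB e3 e1) (cabsB e3 e2) (mulrC (cabs (e1 - e2))).
- exists a, (2 * b); split=> //; by rewrite area_double mulf_neq0// pnatr_eq0.
Qed.

End LatticeStep.

(** * Convergence of the iteration *)

Section Iteration.
Variable R : realType.
Implicit Types (x y z c e : R[i]).

Lemma parallelogram x y :
  cabs (x + y) ^+ 2 + cabs (x - y) ^+ 2 = 2 * (cabs x ^+ 2 + cabs y ^+ 2).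
Proof. by rewrite !sqr_cabs; case: x y => [? ?] [? ?] /=; ring. Qed.

(** The parallelogram identity for [3 * e] and [c]. *)
Lemma gap_le_root e c : cabs c <= cabs (3 * e + c) / 2 -> cabs c <= cabs (3 * e - c) / 2 ->
  cabs c ^+ 2 <= 3 * cabs e ^+ 2.
Proof.
move=> h1 h2; have := parallelogram (3 * e) c; rewrite cabsM cabs_nat exprMn.
have c0 := cabs_ge0 c.
have k1 : cabs c ^+ 2 <= (cabs (3 * e + c) / 2) ^+ 2.
  by rewrite lerXn2r ?nnegrE ?cabs_ge0 ?divr_ge0 ?cabs_ge0.
have k2 : cabs c ^+ 2 <= (cabs (3 * e - c) / 2) ^+ 2.
  by rewrite lerXn2r ?nnegrE ?cabs_ge0 ?divr_ge0 ?cabs_ge0.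
lra.
Qed.

(** The roots of one cubic are [e], [(- e + c) / 2], [(- e - c) / 2], those of
    the next [e'], [(- e' + c') / 2], [(- e' - c') / 2]. This is one step of the
    arithmetic-geometric mean, with the square roots of [e1 - e2] and [e1 - e3]
    as arguments. Up to the sign of [c'], either [- e / 2] is [e'] or [s = e - e'] is
    [c']. In the second case the equation for [g2] becomes
    [c ^+ 2 = 8 * s * (3 * e' + s)], where the last factor has modulus at least
    [2 * cabs s] and at least [2 * cabs e']. The bounds on [c] and [c'] express
    that both steps are optimal. *)
Lemma iteration_step e c e' c' : c != 0 -> 
  cabs c <= cabs (3 * e + c) / 2 -> cabs c <= cabs (3 * e - c) / 2 ->
  cabs c' <= cabs (3 * e' + c') / 2 -> cabs c' <= cabs (3 * e' - c') / 2 ->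
  3 * e' ^+ 2 + c' ^+ 2 = 3 * e ^+ 2 - c ^+ 2 / 4 ->
  [\/ - e / 2 = e', - e / 2 = (- e' + c') / 2 | - e / 2 = (- e' - c') / 2] ->
  [/\ cabs (e' - e) = cabs c', 4 * cabs c' <= cabs c
    & 16 * (cabs c' * cabs e') <= cabs c ^+ 2].
Proof.
move=> c0 h1 h2 h1' h2' q.
have cp : 0 < cabs c by rewrite cabs_gt0.
have cp' := cabs_ge0 c'.
(* Both signs of the difference are treated at once, with [s = e - e']. *)
have main s : cabs s = cabs c' -> cabs s <= cabs (3 * e' + s) / 2 -> s ^+ 2 = c' ^+ 2 ->
    e = e' + s ->
    [/\ cabs (e' - e) = cabs c', 4 * cabs c' <= cabs c
      & 16 * (cabs c' * cabs e') <= cabs c ^+ 2].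
  move=> sc sA s2 eE.
  have cE : cabs c ^+ 2 = 8 * (cabs c' * cabs (3 * e' + s)).
    rewrite -cabsX -sc -cabsM; have -> : c ^+ 2 = 8 * (s * (3 * e' + s)).
      rewrite -s2 eE in q; have -> : c ^+ 2 = 4 * (3 * (e' + s) ^+ 2 - (3 * (e' + s) ^+ 2 - c ^+ 2 / 4)) by field.
      by rewrite -q; ring.
    by rewrite cabsM cabs_nat.
  have e3 : 3 * cabs e' <= cabs (3 * e' + s) + cabs s.
    have := cabsD (3 * e' + s) (- s); rewrite addrK cabsN cabsM cabs_nat; lra.
  have eE' : e' - e = - s by rewrite eE; ring.
  rewrite sc in sA e3.
  split; first by rewrite eE' cabsN.
  - rewrite -(@ler_pXn2r _ 2)// ?nnegrE ?mulr_ge0 ?cabs_ge0// exprMn cE.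
    have : cabs c' * (2 * cabs c') <= cabs c' * cabs (3 * e' + s) by rewrite ler_wpM2l//; lra.
    by rewrite expr2 -expr2; lra.
  - rewrite cE; have : cabs c' * (2 * cabs e') <= cabs c' * cabs (3 * e' + s) by rewrite ler_wpM2l//; lra.
    lra.
case=> E.
- exfalso.
  (* Here [c' ^+ 2] is the product of the two large differences of the old roots
     and [c ^+ 2 / 16] that of the new ones, which contradicts the gaps. *)
  rewrite -E in q h1' h2'.
  have n1 : c' ^+ 2 = (3 * e + c) / 2 * ((3 * e - c) / 2).
    have -> : c' ^+ 2 = 3 * (- e / 2) ^+ 2 + c' ^+ 2 - 3 * (- e / 2) ^+ 2 by ring.
    by rewrite q; field.
  have n2 : (3 * (- e / 2) + c') / 2 * ((3 * (- e / 2) - c') / 2) = c ^+ 2 / 16.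
    have -> : (3 * (- e / 2) + c') / 2 * ((3 * (- e / 2) - c') / 2) = (9 * e ^+ 2 / 4 - c' ^+ 2) / 4 by field.
    by rewrite n1; field.
  have two : cabs (2^-1 : R[i]) = 2^-1 by rewrite cabsV cabs_nat.
  have sixteen : cabs (16^-1 : R[i]) = 16^-1 by rewrite cabsV cabs_nat.
  have m1 : cabs c' ^+ 2 = cabs (3 * e + c) / 2 * (cabs (3 * e - c) / 2).
    by rewrite -cabsX n1 cabsM cabsM [cabs (_ / 2)]cabsM two.
  have m2 : cabs (3 * (- e / 2) + c') / 2 * (cabs (3 * (- e / 2) - c') / 2) = cabs c ^+ 2 / 16.
    rewrite -cabsX -sixteen -cabsM -n2 cabsM cabsM.
    by rewrite [cabs ((3 * (- e / 2) - c') / 2)]cabsM two.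
  have k1 := ler_pM (ltW cp) (ltW cp) h1 h2; rewrite -m1 in k1.
  have k2 := ler_pM cp' cp' h1' h2'; rewrite m2 in k2.
  have : 0 < cabs c ^+ 2 by rewrite exprn_gt0.
  rewrite -!expr2 in k1 k2; lra.
- apply: (main (- c')) => //; rewrite ?cabsN ?sqrrN//.
  have -> : e = -2 * (- e / 2) by field.
  by rewrite E; field.
- apply: (main c') => //.
  have -> : e = -2 * (- e / 2) by field.
  by rewrite E; field.
Qed.

(** The factor four brings [K * x N] below [expR (- 1)] for some [N]; from then on
    squaring doubles the exponent at every step. *)
Lemma double_exponential (x : nat -> R) (K : R) : 0 < K ->
  (forall n, 0 < x n) -> (forall n, 4 * x n.+1 <= x n) ->
  (forall n, x n.+1 <= K * x n ^+ 2) ->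
  exists C q : R, [/\ 0 < C, 0 < q & forall n, x n <= C * expR (- q * 2 ^+ n)].
Proof.
move=> K0 x0 x4 xK.
have E1 : 0 < expR (-1) :> R by exact: expR_gt0.
have x_small n : 4 ^+ n * x n <= x 0%N.
  elim: n => [|n IH]; first by rewrite mul1r.
  apply: le_trans IH; rewrite exprSr -mulrA ler_pM2l ?exprn_gt0//.
have x_le n : x n <= x 0%N.
  apply: le_trans (x_small n); rewrite -[leLHS]mul1r ler_pM2r//.
  by rewrite exprn_ege1// ler1n.
have [N KN] : exists N, K * x N <= expR (-1).
  pose b := K * x 0%N / expR (-1).
  have b0 : 0 <= b by rewrite divr_ge0 ?mulr_ge0 ?ltW.
  exists (Num.trunc b).+1; set N := _.+1.
  have bN : b <= 4 ^+ N.
    have : b < N%:R by rewrite /N; have /andP[] := truncn_itv b0.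
    have : (N%:R : R) <= 4 ^+ N by rewrite -natrX ler_nat ltnW// ltn_expl.
    by move=> h1 h2; apply: ltW (lt_le_trans h2 h1).
  have p4 : 0 < (4 : R) ^+ N by rewrite exprn_gt0.
  rewrite -(ler_pM2l p4); have h := ler_wpM2l (ltW K0) (x_small N).
  apply: (@le_trans _ _ (K * x 0%N)); first by rewrite mulrCA.
  by rewrite -ler_pdivrMr.
have fast k : K * x (N + k)%N <= expR (- (2 ^+ k)).
  elim: k => [|k IH]; first by rewrite addn0 expr0.
  rewrite addnS; apply: (@le_trans _ _ ((K * x (N + k)%N) ^+ 2)).
    by rewrite exprMn expr2 -mulrA ler_pM2l.
  apply: (@le_trans _ _ (expR (- (2 ^+ k)) ^+ 2)).
    by apply: lerXn2r IH; rewrite nnegrE ?expR_ge0// mulr_ge0 ?(ltW K0) ?(ltW (x0 _)).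
  by rewrite -expRM_natl mulrN -exprS.
pose q : R := 2 ^- N.
have q0 : 0 < q by rewrite invr_gt0 exprn_gt0.
exists (K^-1 + x 0%N / expR (-1)), q; split=> // [|n].
  by rewrite addr_gt0 ?invr_gt0 ?divr_gt0.
rewrite mulrDl.
have P : 0 < expR (- q * 2 ^+ n) by exact: expR_gt0.
have P1 : 0 < x 0%N / expR (-1) by rewrite divr_gt0.
have P2 : 0 < K^-1 * expR (- q * 2 ^+ n) by rewrite mulr_gt0 ?invr_gt0.
have [nN|Nn] := ltnP n N.
  suff : x n <= x 0%N / expR (-1) * expR (- q * 2 ^+ n) by lra.
  apply: le_trans (x_le n) _; rewrite -mulrA ler_peMr ?(ltW (x0 0%N))// mulrC ler_pdivlMr// mul1r.
  rewrite ler_expR mulNr lerN2 /q mulrC ler_pdivrMr ?exprn_gt0// mul1r.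
  by rewrite ler_eXn2l ?ltr1n// ltnW.
have := fast (n - N)%N; rewrite subnKC// => h.
have : x n <= K^-1 * expR (- q * 2 ^+ n).
  rewrite -ler_pdivrMl ?invr_gt0// invrK; apply: le_trans h _.
  rewrite ler_expR mulNr lerN2 /q -{1}(subnKC Nn) exprD mulKf ?expf_neq0 ?pnatr_eq0//.
have : 0 < x 0%N / expR (-1) * expR (- q * 2 ^+ n) by rewrite mulr_gt0.
lra.
Qed.

(** Since [c] shrinks by a factor of four, [f - c / 3] increases and
    [f + c / 3] decreases. *)
Lemma real_limit (f c : nat -> R) :
  (forall n, `|f n.+1 - f n| <= c n.+1) -> (forall n, 4 * c n.+1 <= c n) ->
  (forall n, 0 <= c n) ->
  exists l, forall n, `|f n - l| <= c n.
Proof.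
move=> fc c4 c0.
have up n k : f (n + k)%N - c (n + k)%N / 3 <= f n + c n / 3 /\ f n - c n / 3 <= f (n + k)%N - c (n + k)%N / 3 /\ f (n + k)%N + c (n + k)%N / 3 <= f n + c n / 3.
  elim: k => [|k [IH1 [IH2 IH3]]].
    by rewrite addn0; have := c0 n; split; [lra|split; lra].
  rewrite addnS; set m := (n + k)%N in IH1 IH2 IH3 *.
  have := fc m; rewrite ler_norml => /andP[h1 h2].
  by have := c4 m; have := c0 m.+1; split; [lra|split; lra].
pose E := [set f n - c n / 3 | n in [set: nat]].
have ubE n : ubound E (f n + c n / 3).
  move=> _ [m _ <-]; have [nm|mn] := leqP n m.
    by have [h _] := up n (m - n)%N; rewrite subnKC in h.
  have [_ [h1 h2]] := up m (n - m)%N; rewrite subnKC ?(ltnW mn)// in h1 h2.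
  by have := c0 n; lra.
have nE : E !=set0 by exists (f 0%N - c 0%N / 3), 0%N.
exists (sup E) => n.
have h1 : f n - c n / 3 <= sup E by apply: ub_le_sup; [exists (f n + c n / 3)|exists n].
have h2 : sup E <= f n + c n / 3 by apply: ge_sup.
by have := c0 n; rewrite ler_norml => ?; apply/andP; split; lra.
Qed.

Lemma complex_limit (e : nat -> R[i]) (c : nat -> R) :
  (forall n, cabs (e n.+1 - e n) <= c n.+1) -> (forall n, 4 * c n.+1 <= c n) ->
  exists l, forall n, cabs (e n - l) <= 2 * c n.
Proof.
move=> ec c4.
have c1 n : 0 <= c n.+1 by apply: le_trans (ec n); exact: cabs_ge0.
have c0 n : 0 <= c n by have := c4 n; have := c1 n; lra.
have ReB (x y : R[i]) : complex.Re x - complex.Re y = complex.Re (x - y) by case: x y => [? ?] [? ?].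
have ImB (x y : R[i]) : complex.Im x - complex.Im y = complex.Im (x - y) by case: x y => [? ?] [? ?].
have [|u hu] := @real_limit (fun n => complex.Re (e n)) c _ c4 c0.
  by move=> n; rewrite ReB; apply: le_trans (Re_le_cabs _) (ec n).
have [|v hv] := @real_limit (fun n => complex.Im (e n)) c _ c4 c0.
  by move=> n; rewrite ImB; apply: le_trans (Im_le_cabs _) (ec n).
exists (u +i* v) => n; apply: le_trans (cabs_le_ReIm _) _.
by rewrite -ReB -ImB /=; have := hu n; have := hv n; lra.
Qed.

Lemma quadratically_fast (a : nat -> R[i]) l (C q : R) : 0 < C -> 0 < q ->
  (forall n, cabs (a n - l) <= C * expR (- q * 2 ^+ n)) ->
  converges_quadratically_fast a.
Proof.
move=> C0 q0 aC; exists l; split; last first.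
  by exists C, q; split=> // n; rewrite normE lecR.
apply/cvgrPdist_lt => e; rewrite ltcE => /andP[/eqP Ime Ree].
have b0 : 0 <= C / (q * complex.Re e) by rewrite divr_ge0 ?mulr_ge0 ?ltW.
exists (Num.trunc (C / (q * complex.Re e))).+1 => // n /= Nn.
rewrite normE ltcE /= Ime eqxx /= cabsB; apply: le_lt_trans (aC n) _.
have Cn : C / (q * complex.Re e) < n%:R.
  have /andP[_ h] := truncn_itv b0; apply: lt_le_trans h _; by rewrite ler_nat.
have n2 : (n%:R : R) <= 2 ^+ n by rewrite -natrX ler_nat ltnW// ltn_expl.
have P : 0 < expR (q * 2 ^+ n) :> R by exact: expR_gt0.
rewrite mulNr expRN ltr_pdivrMr//.
have h : q * 2 ^+ n < expR (q * 2 ^+ n).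
  by have := expR_ge1Dx (q * 2 ^+ n); lra.
move: Cn; rewrite ltr_pdivrMr ?mulr_gt0// => Cn; apply: lt_trans Cn _.
rewrite mulrA mulrC ltr_pM2l//; apply: le_lt_trans h.
by rewrite mulrC ler_pM2l.
Qed.

End Iteration.

Section RootSequences.
Variable R : realType.
Variables (G2 G3 e f g : nat -> R[i]).
Hypothesis efg0 : forall n, e n + f n + g n = 0.
Hypothesis neq_fg : forall n, f n != g n.
Hypothesis G2E : forall n, G2 n = 4 * (e n ^+ 2 + e n * f n + f n ^+ 2).
Hypothesis G3E : forall n, G3 n = 4 * (e n * f n * g n).
Hypothesis gap_eg : forall n, cabs (f n - g n) <= cabs (e n - g n).
Hypothesis gap_ef : forall n, cabs (f n - g n) <= cabs (e n - f n).
Hypothesis G2S : forall n, G2 n.+1 = (15 * e n ^+ 2 - G2 n) / 4.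
Hypothesis G3S : forall n, G3 n.+1 = (7 * e n ^+ 3 + G3 n) / 8.

Let c n := f n - g n.

Let fE n : f n = (- e n + c n) / 2.
Proof.
have -> : e n = - f n - g n by apply/eqP; rewrite -subr_eq0; apply/eqP; rewrite -[RHS](efg0 n); ring.
by rewrite /c; field.
Qed.

Let gE n : g n = (- e n - c n) / 2.
Proof.
have -> : e n = - f n - g n by apply/eqP; rewrite -subr_eq0; apply/eqP; rewrite -[RHS](efg0 n); ring.
by rewrite /c; field.
Qed.

Let G2c n : G2 n = 3 * e n ^+ 2 + c n ^+ 2.
Proof. by rewrite G2E fE; field. Qed.

Let G3c n : G3 n = e n ^+ 3 - e n * c n ^+ 2.
Proof. by rewrite G3E {1}fE gE; field. Qed.

Let gap1 n : cabs (c n) <= cabs (3 * e n + c n) / 2.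
Proof.
have -> : cabs (3 * e n + c n) / 2 = cabs (e n - g n).
  have -> : e n - g n = (3 * e n + c n) / 2 by rewrite gE; field.
  by rewrite cabsM cabsV cabs_nat.
exact: gap_eg.
Qed.

Let gap2 n : cabs (c n) <= cabs (3 * e n - c n) / 2.
Proof.
have -> : cabs (3 * e n - c n) / 2 = cabs (e n - f n).
  have -> : e n - f n = (3 * e n - c n) / 2 by rewrite fE; field.
  by rewrite cabsM cabsV cabs_nat.
exact: gap_ef.
Qed.

(** A period of the present lattice outside the next one is a half period of the
    latter, with value [- e / 2]; here that value is recognised as a root from
    the recursion for the invariants. *)
Let next_root n : [\/ - e n / 2 = e n.+1, - e n / 2 = (- e n.+1 + c n.+1) / 2 |
  - e n / 2 = (- e n.+1 - c n.+1) / 2].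
Proof.
rewrite -fE -gE.
have : (- e n / 2 - e n.+1) * (- e n / 2 - f n.+1) * (- e n / 2 - g n.+1) = 0.
  have -> : (- e n / 2 - e n.+1) * (- e n / 2 - f n.+1) * (- e n / 2 - g n.+1)
    = ((4 * (- e n / 2) ^+ 3) - G2 n.+1 * (- e n / 2) - G3 n.+1) / 4.
    by rewrite G2c G3c fE gE; field.
  by rewrite G2S G3S G2c G3c; field.
move/eqP; rewrite !mulf_eq0 !subr_eq0 => /orP[/orP[]|] /eqP ->.
- exact: Or31.
- exact: Or32.
- exact: Or33.
Qed.

Let c0 n : c n != 0. Proof. by rewrite subr_eq0. Qed.

Let step n : [/\ cabs (e n.+1 - e n) = cabs (c n.+1), 4 * cabs (c n.+1) <= cabs (c n)
    & 16 * (cabs (c n.+1) * cabs (e n.+1)) <= cabs (c n) ^+ 2].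
Proof.
apply: iteration_step => //; rewrite -G2c G2S G2c; by field.
Qed.

(** The moduli of [e] stay above [k], since the total change of [e] is at most a
    third of the first gap, which is smaller than the modulus of the first root.
    This turns the estimate of [iteration_step] into a quadratic recursion for the gaps; the
    invariants are polynomials in [e] and the gap. *)
Lemma invariants_quadratic_convergence :
  converges_quadratically_fast G2 /\ converges_quadratically_fast G3.
Proof.
have cp n : 0 < cabs (c n) by rewrite cabs_gt0.
have lower n : cabs (e 0%N) - (cabs (c 0%N) - cabs (c n)) / 3 <= cabs (e n).
  elim: n => [|n IH]; first by rewrite subrr mul0r subr0.
  have [h1 h2 _] := step n.
  by have := cabsD_sub (e n) (e n.+1 - e n); rewrite (addrC (e n)) subrK h1; lra.
pose k := cabs (e 0%N) - cabs (c 0%N) / 3.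
have k0 : 0 < k.
  have := gap_le_root (gap1 0%N) (gap2 0%N); have := cp 0%N.
  rewrite /k subr_gt0 => h0 h; rewrite -(@ltr_pXn2r _ 2)// ?nnegrE ?cabs_ge0 ?divr_ge0 ?cabs_ge0//.
  have : 0 < cabs (c 0%N) ^+ 2 by rewrite exprn_gt0.
  by rewrite expr_div_n; lra.
have ek n : k <= cabs (e n) by have := lower n; have := cp n; rewrite /k; lra.
have sq n : cabs (c n.+1) <= (16 * k)^-1 * cabs (c n) ^+ 2.
  have [_ _ h] := step n; rewrite ler_pdivlMl ?mulr_gt0//; apply: le_trans h.
  by rewrite -mulrA ler_pM2l// mulrC ler_pM2l.
have K0 : 0 < (16 * k)^-1 by rewrite invr_gt0 mulr_gt0.
have [C [q [C0 q0 cC]]] := double_exponential K0 cp (fun n => let: And3 _ h _ := step n in h) sq.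
have [l el] : exists l, forall n, cabs (e n - l) <= 2 * cabs (c n).
  by apply: (@complex_limit _ _ (fun n => cabs (c n))) => n; have [h h2 _] := step n; rewrite ?h.
have cle n : cabs (c n) <= cabs (c 0%N).
  by elim: n => // n; have [_ h _] := step n; have := cp n.+1; lra.
set D := cabs (c 0%N) in cle; set L := cabs l.
have L0 : 0 <= L by exact: cabs_ge0.
have D0 : 0 < D by exact: cp.
have eM n : cabs (e n) <= L + 2 * D.
  have := cabsD (e n - l) l; rewrite subrK -/L; have := el n; have := cle n; lra.
set M := L + 2 * D in eM.
have M0 : 0 < M by rewrite /M; lra.
have fast (a : nat -> R[i]) b (B : R) : 0 < B -> (forall n, cabs (a n - b) <= B * cabs (c n)) ->
    converges_quadratically_fast a.
  move=> B0 ab; apply: (quadratically_fast (l := b) (C := B * C) (q := q)) => //.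
    exact: mulr_gt0.
  by move=> n; apply: le_trans (ab n) _; rewrite -mulrA ler_pM2l.
have c2 n : cabs (c n) ^+ 2 <= D * cabs (c n) by rewrite expr2 ler_pM2r.
have LM : L <= M by rewrite /M; lra.
split.
- apply: (fast _ (3 * l ^+ 2) (12 * M + D)); first by lra.
  move=> n; have -> : G2 n - 3 * l ^+ 2 = 3 * ((e n - l) * (e n + l)) + c n ^+ 2.
    by rewrite G2c; ring.
  apply: le_trans (cabsD _ _) _; rewrite cabsX 2!cabsM cabs_nat.
  have s1 : cabs (e n + l) <= 2 * M by have := cabsD (e n) l; rewrite -/L; have := eM n; lra.
  have := ler_pM (cabs_ge0 _) (cabs_ge0 _) (el n) s1; have := c2 n; lra.
- apply: (fast _ (l ^+ 3) (6 * M ^+ 2 + M * D)).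
    by rewrite addr_gt0 ?mulr_gt0 ?exprn_gt0.
  move=> n; have -> : G3 n - l ^+ 3 = (e n - l) * (e n * e n + e n * l + l * l) + - (e n * c n ^+ 2).
    by rewrite G3c; ring.
  apply: le_trans (cabsD _ _) _; rewrite cabsN (cabsM (e n)) cabsX cabsM.
  have s1 : cabs (e n * e n + e n * l + l * l) <= 3 * M ^+ 2.
    have := cabsDD (e n * e n) (e n * l) (l * l); rewrite !cabsM -/L.
    have := ler_pM (cabs_ge0 _) (cabs_ge0 _) (eM n) (eM n).
    have := ler_pM (cabs_ge0 _) L0 (eM n) LM.
    have := ler_pM L0 L0 LM LM.
    by rewrite expr2; lra.
  have := ler_pM (cabs_ge0 _) (cabs_ge0 _) (el n) s1.
  have := ler_pM (cabs_ge0 _) (exprn_ge0 2 (cabs_ge0 _)) (eM n) (c2 n).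
  lra.
Qed.

End RootSequences.

Theorem theorem3p18 (R : realType) (Gamma : nat -> set R[i])
    (e1 e2 e3 omega : nat -> R[i]) :
  lattice (Gamma 0%N) ->
  (forall i, optimal (Gamma i.+1) (Gamma i)) ->
  (forall n, (Gamma n.+1 `\` [set x *+ 2 | x in Gamma n]) (omega n)) ->
  (forall n, uniq [:: e1 n; e2 n; e3 n]) ->
  (forall n x, root (weierstrass_poly (Gamma n)) x
                 <-> x \in [:: e1 n; e2 n; e3 n]) ->
  (forall n, e1 n = wp (omega n / 2) (Gamma n)) ->
  converges_quadratically_fast (fun n => g2 (Gamma n)) /\
  converges_quadratically_fast (fun n => g3 (Gamma n)).
Proof.
move=> lat0 opt om u rts e1E.
have step n B := @lattice_step R _ _ _ _ _ _ B (opt n) (om n) (u n) (rts n) (e1E n).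
have basis n : exists a b, area a b != 0 /\ Gamma n = lat a b.
  by elim: n => [|n /step[]//]; exact: lattice_basis.
apply: (@invariants_quadratic_convergence _ _ _ e1 e2 e3) => n;
  have [s [G2 G3] [h1 h2] [S2 S3] _] := step n (basis n) => //.
by have := u n; rewrite /= !inE negb_or => /and3P[_].
Qed.
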